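(* Let $f\colon\mathbb{R}^n\to\mathbb{R}^n$ be smooth with symmetric Jacobian, that is, $f_x(x)=f_x(x)^*$ for all $x\in\mathbb{R}^n$. Assume that $a,b\in\mathbb{R}^n$ are two hyperbolic equilibria of $\dot{x}=f(x)$ with $\dim W^{\mathrm{s}}(a)=n$ and $\dim W^{\mathrm{u}}(b)=1$, and that $h(t)$ is a solution of $\dot{x}=f(x)$ such that $h(0)\in W^{\mathrm{u}}(b)\cap W^{\mathrm{s}}(a)$ and $W^{\mathrm{u}}(b)$ and $W^{\mathrm{s}}(a)$ intersect transversely at $h(0)$. Consider the system $$\dot{u}=-f(u)+v,\qquad \dot{v}=f_u(u)^*v,\qquad (u,v)\in\mathbb{R}^n\times\mathbb{R}^n,$$ which is Hamiltonian with conserved Hamiltonian $H(u,v)=\tfrac12|v|^2-\langle f(u),v\rangle$. Then $(u_1,v_1)=(a,0)$ and $(u_2,v_2)=(b,0)$ are hyperbolic saddle equilibria of this system with unstable and stable dimension equal to $n$, and the solution $(u_*,v_* )(t):=(h(-t),0)$ of this system satisfies $(u_*,v_* )(0)\in W^{\mathrm{u}}(a,0)\cap W^{\mathrm{s}}(b,0)$, with $W^{\mathrm{u}}(a,0)$ and $W^{\mathrm{s}}(b,0)$ intersecting transversely at $(u_*,v_* )(0)$ inside the level set $H^{-1}(0)$.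
   Context: Notation: $f_x$ or $f_u$ denotes the Jacobian matrix of $f$ and $^*$ denotes the transpose. $W^{\mathrm{s}}(e)$ and $W^{\mathrm{u}}(e)$ denote the stable and unstable manifolds of an equilibrium $e$ of $\dot{x}=f(x)$; $W^{\mathrm{s}}(e,0)$ and $W^{\mathrm{u}}(e,0)$ denote those of the equilibrium $(e,0)$ of the $(u,v)$-system. The level set $H^{-1}(0)$ contains $W^{\mathrm{u}}(a,0)$ and $W^{\mathrm{s}}(b,0)$ and is a $(2n-1)$-dimensional manifold near each point of the orbit $(h(-t),0)$; transversality inside $H^{-1}(0)$ at a point $p$ of this orbit means that the tangent spaces satisfy $T_pW^{\mathrm{u}}(a,0)+T_pW^{\mathrm{s}}(b,0)=T_pH^{-1}(0)$. *)

(* Defs.v *)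
(* MathComp / MathComp-Analysis.  R^n is 'rV[R]_n, with the library convention
   for the Jacobian on row vectors: 'd f x w = w *m 'J f x.  Thus 'J f x is the
   transpose of the matrix f_x = (d f_i / d x_j), and the action of f_x^* on
   the vector v is v *m ('J f x)^T. *)
From HB Require Import structures.
From mathcomp Require Export all_boot all_order all_algebra.
From mathcomp Require Export all_classical all_reals all_analysis.
From mathcomp Require Export complex.
Set Implicit Arguments.
Unset Strict Implicit.
Unset Printing Implicit Defensive.
Import Order.TTheory GRing.Theory Num.Theory.
Import numFieldNormedType.Exports.
Local Open Scope classical_set_scope.
Local Open Scope ring_scope.

Fixpoint Ck (R : realType) (V W : normedModType R) (k : nat) (f : V -> W) :
    Prop :=
  if k is k'.+1 then
    (forall x, differentiable f x) /\ (forall w, Ck k' ('D_w f))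
  else continuous f.

Definition smooth (R : realType) (V W : normedModType R) (f : V -> W) : Prop :=
  forall k, Ck k f.

(* [D] is meant to be an interval: [phi] is continuous on [D] and satisfies
   phi' = F(phi) in the interior of [D]. *)
Definition solution (R : realType) (N : nat) (F : 'rV[R]_N -> 'rV[R]_N)
    (D : set R) (phi : R -> 'rV[R]_N) : Prop :=
  {within D, continuous phi} /\
  forall t : R, interior D t -> is_derive t (1 : R) phi (F (phi t)).

Section Spectrum.
Variables (R : realType) (N : nat).
Implicit Types (A : 'M[R]_N) (F : 'rV[R]_N -> 'rV[R]_N) (e : 'rV[R]_N).

Definition complexify A : 'M[R[i]]_N := map_mx (real_complex R) A.

Definition hyperbolic_equilibrium F e : Prop :=
  F e = 0 /\
  forall z : R[i], eigenvalue (complexify ('J F e)) z -> complex.Re z != 0.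

Definition hyperbolic_saddle F e : Prop :=
  [/\ hyperbolic_equilibrium F e,
      exists2 z : R[i], eigenvalue (complexify ('J F e)) z & complex.Re z < 0 &
      exists2 z : R[i], eigenvalue (complexify ('J F e)) z & 0 < complex.Re z].

(* Number of complex eigenvalues with the property [P], counted with algebraic
   multiplicity. *)
Definition spectral_dim (P : pred R[i]) A (k : nat) : Prop :=
  exists2 s : seq R[i],
    char_poly (complexify A) = \prod_(z <- s) ('X - z%:P) & count P s = k.

Definition stable_spectral_dim F e : nat -> Prop :=
  spectral_dim (fun z => complex.Re z < 0) ('J F e).

Definition unstable_spectral_dim F e : nat -> Prop :=
  spectral_dim (fun z => 0 < complex.Re z) ('J F e).

End Spectrum.

Section InvariantManifolds.
Variables (R : realType) (N : nat).
Implicit Types (F : 'rV[R]_N -> 'rV[R]_N) (e p : 'rV[R]_N) (k : nat).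

Definition stable_orbit F e (phi : R -> 'rV[R]_N) : Prop :=
  solution F `[0, +oo[%classic phi /\ phi t @[t --> +oo] --> e.

Definition Ws F e : set 'rV[R]_N :=
  [set x | exists2 phi, stable_orbit F e phi & phi 0 = x].

(* Neighbourhoods of [p] for the manifold topology of [Ws F e].  The stable
   manifold is an injectively immersed manifold, the union of the preimages
   under the flow of a local stable manifold, and its own topology may be finer
   than the one induced by R^N.  It is the topology of uniform convergence of
   the forward orbits: the distance of [q] to [p] is
   sup_(t >= 0) |phi_t q - phi_t p|. *)
Definition Ws_nbhs F e p : set_system 'rV[R]_N :=
  [set A : set 'rV[R]_N | exists2 eps : R, 0 < eps &
     forall phi psi : R -> 'rV[R]_N,
       stable_orbit F e phi -> phi 0 = p -> stable_orbit F e psi ->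
       (forall t, 0 <= t -> `|psi t - phi t| < eps) -> A (psi 0)].

(* The unstable manifold is the stable one for the reversed time: phi solves
   x' = F x on ]-oo, 0] iff t |-> phi (- t) solves x' = - F x on [0, +oo[. *)
Definition Wu F e : set 'rV[R]_N := Ws (fun x => - F x) e.

Definition Wu_nbhs F e p : set_system 'rV[R]_N := Ws_nbhs (fun x => - F x) e p.

(* Velocities at [p] of the curves through [p] drawn on a submanifold, where
   [nb] consists of the neighbourhoods of [p] in this submanifold; convergence
   to [nb] says that the curve lies on the submanifold near time 0 and is
   continuous at 0 for its topology. *)
Definition tangent_space (nb : set_system 'rV[R]_N) p : set 'rV[R]_N :=
  [set w | exists gamma : R -> 'rV[R]_N,
     [/\ gamma 0 = p, gamma s @[s --> (0 : R)] --> nb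
       & is_derive (0 : R) (1 : R) gamma w]].

Definition TWs F e p := tangent_space (Ws_nbhs F e p) p.
Definition TWu F e p := tangent_space (Wu_nbhs F e p) p.

(* Tangent space of an embedded submanifold, with the induced topology. *)
Definition Tset (S : set 'rV[R]_N) p :=
  tangent_space (within S (nbhs p)) p.

Definition subspace_of_dim (T : set 'rV[R]_N) k : Prop :=
  exists2 U : {vspace 'rV[R]_N}, T = [set w | w \in U] & \dim U = k.

Definition dim_Ws F e k : Prop :=
  forall p, Ws F e p -> subspace_of_dim (TWs F e p) k.
Definition dim_Wu F e k : Prop :=
  forall p, Wu F e p -> subspace_of_dim (TWu F e p) k.

Definition sum_set (T1 T2 : set 'rV[R]_N) : set 'rV[R]_N :=
  [set w1 + w2 | w1 in T1 & w2 in T2].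

End InvariantManifolds.

Section HamiltonianSystem.
Variables (R : realType) (n : nat).

Definition dot (x y : 'rV[R]_n) : R := (x *m y^T) 0 0.

(* Phase space R^n x R^n, with z = (u, v) encoded as [row_mx u v]. *)
Implicit Types z w : 'rV[R]_(n + n).

Definition uv_system (f : 'rV[R]_n -> 'rV[R]_n) z : 'rV[R]_(n + n) :=
  let u := lsubmx z in let v := rsubmx z in
  row_mx (- f u + v) (v *m ('J f u)^T).

Definition Ham (f : 'rV[R]_n -> 'rV[R]_n) z : R :=
  let u := lsubmx z in let v := rsubmx z in
  2^-1 * dot v v - dot (f u) v.

(* The canonical symplectic form du /\ dv; [hamiltonian_field X H] amounts to
   u' = dH/dv, v' = - dH/du. *)
Definition omega z w : R :=
  dot (lsubmx z) (rsubmx w) - dot (rsubmx z) (lsubmx w).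

Definition hamiltonian_field (X : 'rV[R]_(n + n) -> 'rV[R]_(n + n))
    (H : 'rV[R]_(n + n) -> R) : Prop :=
  forall z, differentiable H z /\ forall w, 'd H z w = omega (X z) w.

End HamiltonianSystem.

Definition conserved (R : realType) (N : nat) (X : 'rV[R]_N -> 'rV[R]_N)
    (H : 'rV[R]_N -> R) : Prop :=
  forall (I : interval R) (phi : R -> 'rV[R]_N),
    solution X [set` I] phi ->
    forall s t : R, s \in I -> t \in I -> H (phi s) = H (phi t).

(* Main.v *)
(* The core is a stable manifold theorem at an arbitrary point of the manifold: if an
   orbit phi of x' = F x converges to an equilibrium whose linearisation is
   diagonalisable over R without zero eigenvalue, then the tangent space of the stable
   manifold at phi 0 is the space of initial values of the bounded solutions of the
   equation linearised along phi, and its dimension is the number of negative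
   eigenvalues.  It follows from a Lyapunov-Perron argument along the whole orbit.  In
   eigencoordinates the deviation x from phi solves x' = x D + g(t, x), where g has a
   small Lipschitz constant for t >= T only.  Prescribing the stable coordinates at time
   T and requiring boundedness is nevertheless a contraction on [0, +oo[, for a norm
   with weight exp (K (T - t)) on [0, T] and K large.

   Since A = f_x(e) is symmetric, it is diagonalisable over R, and so is the
   linearisation of the (u, v)-system at (e, 0), with the eigenvalues of A and of - A.
   The manifold W^u(a, 0) contains W^s(a) x 0, so its tangent space at (h(0), 0) is
   R^n x 0.  If (w, 0) is tangent to W^s(b, 0), the second component of the
   corresponding variational solution vanishes identically, so that w is tangent to the
   line T W^u(b).  Hence the two tangent spaces meet in dimension at most 1, and their
   sum fills the (2n-1)-dimensional space T H^-1(0). *)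
Require Import Defs.
From mathcomp Require Import ring lra.
Set Implicit Arguments.
Unset Strict Implicit.
Unset Printing Implicit Defensive.
Import Order.TTheory GRing.Theory Num.Theory.
Import numFieldNormedType.Exports.
Local Open Scope classical_set_scope.
Local Open Scope ring_scope.

(** * Linear differential equations on a half-line *)

Section ScalarComparison.
Variable R : realType.
Implicit Types (u du q g : R -> R) (d a b : R).

(** No completeness of the flow is assumed, and the tangent spaces are defined through curves
    continuous for uniform convergence of forward orbits. Hence no local manifold is transported by
    a flow and no smoothness of the manifold is established. Both inclusions for the tangent space
    rest on one comparison: an orbit near phi and the bounded variational solution with the same
    stable coordinates at T differ by o(r), where r bounds these coordinates. One inclusion applies
    it to the orbits with stable coordinates proportional to s, the other to the orbit through a
    given point of a curve; Gronwall estimates on [0, T] pass from time 0 to T. Diagonal form makes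
    the sup norm effective: each coordinate obeys a scalar equation, integrated from T if its
    eigenvalue is negative and fixed by boundedness at infinity if positive. The requirements alpha
    + 2 eps <= |d_i| and |d_i| + 2 L <= K are what makes the contraction factor 1/2. Unstable
    manifolds are stable ones of the opposite field, so a single theorem serves f, - f and the (u,
    v)-system in both time directions. *)

Lemma ge0_derive_le u du a b : continuous u -> a <= b ->
  (forall t, a < t < b -> is_derive t (1 : R) u (du t)) ->
  (forall t, a < t < b -> 0 <= du t) -> u a <= u b.
Proof.
move=> cu ab Du du0.
apply: (@ger0_derive1_le_cc _ u a b) => //.
- by move=> t; rewrite in_itv /= => /Du [].
- move=> t; rewrite in_itv /= => tab; rewrite derive1E.
  by have [_ ->] := Du _ tab; exact: du0.
- exact: continuous_subspaceT.
- by rewrite in_itv /= lexx.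
- by rewrite in_itv /= lexx andbT.
Qed.

Lemma derive_expR_scale d t0 t :
  is_derive t (1 : R) (fun s => expR (d * (s - t0))) (d * expR (d * (t - t0))).
Proof.
apply: is_derive_eq.
by rewrite /GRing.scale /=; ring.
Qed.

Lemma continuous_expR_scale d t0 : continuous (fun s : R => expR (d * (s - t0))).
Proof.
move=> t; apply: differentiable_continuous; apply/derivable1_diffP.
by have [] := derive_expR_scale d t0 t.
Qed.

Lemma exp_growth u du d a b : continuous u -> a <= b ->
  (forall t, a < t < b -> is_derive t (1 : R) u (du t)) ->
  (forall t, a < t < b -> d * u t <= du t) -> u a * expR (d * (b - a)) <= u b.
Proof.
move=> cu ab Du Hdu.
pose w t := u t * expR (- d * (t - b)).
have: w a <= w b.
  apply: (@ge0_derive_le w (fun t => (du t - d * u t) * expR (- d * (t - b)))) => //.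
  - by move=> t; apply: cvgM; [exact: cu|exact: continuous_expR_scale].
  - move=> t tab; have Dt := Du _ tab; have De := derive_expR_scale (- d) b t.
    apply: is_derive_eq; rewrite /GRing.scale /=; ring.
  - by move=> t /Hdu h; rewrite mulr_ge0 ?expR_ge0// subr_ge0.
rewrite /w subrr mulr0 expR0 mulr1; congr (_ * expR _ <= _); ring.
Qed.

Lemma comparison_forward u du d a b : continuous u -> a <= b ->
  (forall t, a < t < b -> is_derive t (1 : R) u (du t)) ->
  (forall t, a < t < b -> d * u t <= du t) -> 0 <= u a -> 0 <= u b.
Proof.
move=> cu ab Du Hdu ua; apply: le_trans (exp_growth cu ab Du Hdu).
by rewrite mulr_ge0 ?expR_ge0.
Qed.

Lemma comparison_backward u du d a b : continuous u -> a <= b ->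
  (forall t, a < t < b -> is_derive t (1 : R) u (du t)) ->
  (forall t, a < t < b -> du t <= d * u t) -> 0 <= u b -> 0 <= u a.
Proof.
move=> cu ab Du Hdu ub.
have cu' : continuous (fun t => - u t) by move=> t; apply: continuousN; exact: cu.
have : - u a * expR (d * (b - a)) <= - u b.
  apply: (@exp_growth (fun t => - u t) (fun t => - du t)) => // s sab.
    by have Ds := Du _ sab; apply: is_deriveN.
  by rewrite mulrN lerN2 Hdu.
rewrite mulNr lerN2 => H.
by rewrite -(pmulr_lge0 _ (expR_gt0 (d * (b - a)))) (le_trans ub).
Qed.

(** A negative value at [a] would be amplified at rate [d], against the lower bound. This replaces
    an initial condition for the expanding coordinates. *)
Lemma comparison_bounded u du d a M : continuous u -> 0 < d ->
  (forall t, a < t -> is_derive t (1 : R) u (du t)) ->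
  (forall t, a < t -> du t <= d * u t) -> (forall t, a <= t -> - M <= u t) ->
  0 <= u a.
Proof.
move=> cu d0 Du Hdu uM; rewrite leNgt; apply/negP => ua.
have ua0 : 0 < - u a by rewrite oppr_gt0.
(* At this time [expR x >= 1 + x] already gives [- u t >= - u a + M > M]. *)
pose t := a + (M / - u a) / d.
have [Mle0|M0] := leP M 0.
  have := uM a (lexx _); have : 0 <= - M by rewrite oppr_ge0.
  by lra.
have at_ : a <= t by rewrite lerDl !divr_ge0// ltW.
have cu' : continuous (fun t => - u t) by move=> s; apply: continuousN; exact: cu.
have H : - u a * expR (d * (t - a)) <= - u t.
  apply: (@exp_growth (fun t => - u t) (fun t => - du t)) => // s /andP[as_ _].
    by have Ds := Du _ as_; apply: is_deriveN.
  by rewrite mulrN lerN2 Hdu.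
have {H} : - u a * (1 + d * (t - a)) <= M.
  apply: le_trans (ler_wpM2l (ltW ua0) (expR_ge1Dx _)) _.
  by apply: le_trans H _; rewrite lerNl uM.
rewrite /t addrAC subrr add0r [d * _]mulrC divfK ?gt_eqF// mulrDr mulr1.
by rewrite [_ * (M / _)]mulrC divfK ?gt_eqF//; lra.
Qed.

End ScalarComparison.

(** * Scalar linear equations: bounded solutions and prescribed values *)

Section ScalarODE.
Variable R : realType.
Implicit Types (q g : R -> R) (d t s B T xi : R).

Lemma derive1_is_derive q t l :
  derivable q t 1 -> (q^`())%classic t = l -> is_derive t (1 : R) q l.
Proof. by move=> Dq <-; rewrite derive1E; exact: derivableP. Qed.


(** Integrating from -1 makes 0 an interior point, so the derivative at 0 is two-sided. *)
Lemma antiderivative_exists g : continuous g ->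
  exists P : R -> R, forall t : R, -1 < t -> is_derive t (1 : R) P (g t).
Proof.
move=> cg.
exists (fun x => (\int[lebesgue_measure]_(t in [set` `[(-1)%R, x]]) g t)%R) => t t1.
have int : lebesgue_measure.-integrable `[(-1)%R, (t + 1)] (EFin \o g).
  apply: continuous_compact_integrable; first exact: segment_compact.
  exact: continuous_subspaceT.
have tt1 : t < t + 1 by rewrite ltrDl.
have [D1 D2] := continuous_FTC1_closed tt1 int t1 (cg t).
exact: (derive1_is_derive D1 D2).
Qed.

(** For [d > 0] the bounded solution is [expR (d * t) * (P t - l)], where [P] is an antiderivative
    of [expR (- d * t) * g t] and [l] its limit at infinity. *)
Lemma linear_ode_bounded d g B : 0 < d -> continuous g ->
  (forall t, 0 <= t -> `|g t| <= B) ->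
  exists2 q, forall t : R, -1 < t -> is_derive t (1 : R) q (d * q t + g t) &
    forall t, 0 <= t -> `|q t| <= B / d.
Proof.
move=> d0 cg gB.
pose e (t : R) := expR (- d * (t - 0)).
have De t : is_derive t (1 : R) e (- d * e t) by exact: derive_expR_scale.
have ce : continuous e by exact: continuous_expR_scale.
have [P DP] : exists P : R -> R, forall t : R,
  -1 < t -> is_derive t (1 : R) P (e t * g t).
  by apply: antiderivative_exists => t; apply: cvgM; [exact: ce|exact: cg].
have cP t : -1 < t -> {for t, continuous P}.
  by move=> /DP [+ _] => /derivable1_diffP; exact: differentiable_continuous.
have ee t : e t * expR (d * t) = 1.
  by rewrite /e -expRD subr0 mulNr addNr expR0.
(* [P + B / d * e] is nonincreasing and [P - B / d * e] is nondecreasing, so any two of the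
   intervals with these endpoints meet. This yields the limit of [P] together with the rate of
   convergence, without an improper integral. *)
have mono s t : 0 <= s -> s <= t ->
    P t - B / d * e t <= P s + B / d * e s /\ P s - B / d * e s <= P t + B / d * e t.
  move=> s0 st.
  have Dbe r k : is_derive r (1 : R) (fun r => k / d * e r) (- k * e r).
    have Dr := De r; apply: is_derive_eq.
    by rewrite /GRing.scale /=; field; rewrite gt_eqF.
  have cc k : {within `[s, t], continuous (fun r => P r + k / d * e r)}.
    apply: continuous_in_subspaceT => r; rewrite inE /= in_itv /= => /andP[sr _].
    apply: cvgD; first by apply: cP; lra.
    by apply: cvgM; [exact: cvg_cst|exact: ce].
  have Dk k r : r \in `]s, t[ ->
      is_derive r (1 : R) (fun r => P r + k / d * e r) (e r * (g r - k)).
    rewrite in_itv /= => /andP[sr rt].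
    have D1 := DP r; have {D1} D1 := D1 ltac:(lra); have D2 := Dbe r k.
    by apply: is_derive_eq; ring.
  have ePos r : 0 <= B / d * e r.
    rewrite mulr_ge0 ?expR_ge0// divr_ge0 ?(ltW d0)//.
    by apply: le_trans (gB s s0).
  have [c1 c1st E1] := MVT_segment st (Dk B) (cc B).
  have [c2 c2st E2] := MVT_segment st (Dk (- B)) (cc (- B)).
  have gc c : c \in `[s, t] -> `|g c| <= B.
    by rewrite in_itv /= => /andP[? _]; apply: gB; lra.
  have := gc _ c1st; have := gc _ c2st; rewrite !ler_norml => /andP[g2 g2'] /andP[g1 g1'].
  have := ePos s; have := ePos t => et es.
  have K1 : e c1 * (g c1 - B) * (t - s) <= 0.
    by rewrite mulr_le0_ge0 ?subr_ge0// mulr_ge0_le0 ?expR_ge0// subr_le0.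
  have K2 : 0 <= e c2 * (g c2 - - B) * (t - s).
    by rewrite mulr_ge0 ?subr_ge0// mulr_ge0 ?expR_ge0//; lra.
  move: K1 K2; rewrite -E1 -E2 !mulNr => K1 K2; split; lra.
(* The supremum of [S] is the limit of [P] at +oo. *)
pose S := [set P t - B / d * e t | t in [set t | 0 <= t]].
have Sub s : 0 <= s -> ubound S (P s + B / d * e s).
  move=> s0 _ [t /= t0 <-].
  by case: (leP s t) => st; [have [] := mono s t s0 st|have [] := mono t s t0 (ltW st)].
have S0 : S !=set0 by exists (P 0 - B / d * e 0); exists 0 => //=.
have hS : has_sup S by split => //; eexists; exact: (Sub 0 (lexx _)).
pose l := sup S.
exists (fun t => expR (d * (t - 0)) * (P t - l)).
  move=> t t1; have D1 := DP t t1; have D2 := derive_expR_scale d 0 t.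
  apply: is_derive_eq; rewrite /GRing.scale /=.
  have := ee t; rewrite -[X in expR (d * X)](subr0 t) => E.
  rewrite (_ : expR (d * (t - 0)) * (e t * g t - 0)
    = (e t * expR (d * (t - 0))) * g t); last by ring.
  by rewrite E; ring.
move=> t t0.
have h1 : P t - B / d * e t <= l by apply: ub_le_sup; [case: hS|exists t].
have h2 : l <= P t + B / d * e t by apply: ge_sup => //; exact: Sub.
rewrite normrM ger0_norm ?expR_ge0// subr0.
have : `|P t - l| <= B / d * e t by rewrite ler_norml; apply/andP; split; lra.
move=> /(ler_wpM2l (expR_ge0 (d * t))) /le_trans; apply.
by rewrite mulrCA [_ * e t]mulrC ee mulr1.
Qed.

Lemma linear_ode_initial d g T xi : continuous g ->
  exists2 q, forall t : R, -1 < t -> is_derive t (1 : R) q (d * q t + g t) & q T = xi.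
Proof.
move=> cg.
pose e (t : R) := expR (- d * (t - 0)).
have ce : continuous e by exact: continuous_expR_scale.
have [P DP] : exists P : R -> R, forall t : R,
  -1 < t -> is_derive t (1 : R) P (e t * g t).
  by apply: antiderivative_exists => t; apply: cvgM; [exact: ce|exact: cg].
have ee t : e t * expR (d * (t - 0)) = 1.
  by rewrite /e -expRD subr0 mulNr addNr expR0.
exists (fun t => expR (d * (t - 0)) * (P t + (xi * e T - P T))).
  move=> t t1; have D1 := DP t t1; have D2 := derive_expR_scale d 0 t.
  apply: is_derive_eq; rewrite /GRing.scale /=.
  rewrite (_ : expR (d * (t - 0)) * (e t * g t + 0)
    = (e t * expR (d * (t - 0))) * g t); last by ring.
  by rewrite ee; ring.
by rewrite (addrC (P T)) subrK mulrC -mulrA ee mulr1.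
Qed.

End ScalarODE.

(** * The Lyapunov-Perron method *)

Section RowVectors.
Variables (R : realType).

Lemma coord_le_norm N (v : 'rV[R]_N) i : `|v 0 i| <= `|v|.
Proof. by rewrite [leRHS]/Num.Def.normr/= mx_normrE; exact: (le_bigmax _ _ (0, i)). Qed.

Lemma norm_le_coord N (v : 'rV[R]_N) (c : R) :
  0 <= c -> (forall i, `|v 0 i| <= c) -> `|v| <= c.
Proof.
move=> c0 vc; rewrite [leLHS]/Num.Def.normr/= mx_normrE (bigmax_le _ c0)//.
by move=> -[i j] _ /=; rewrite ord1.
Qed.

Lemma is_derive_coordP (V : normedModType R) N (x : V -> 'rV[R]_N) (t w : V) v :
  is_derive t w x v <-> forall i, is_derive t w (fun s => x s 0 i) (v 0 i).
Proof.
split=> [[Dx xv] i|H].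
  have Dxi := (derivable_mxP x t w).1 Dx 0 i.
  by apply: DeriveDef => //; rewrite -xv derive_mx// mxE.
have Dx : derivable x t w.
  by apply/derivable_mxP => i j; rewrite ord1; have [] := H j.
apply: DeriveDef => //; rewrite derive_mx//.
by apply/rowP => i; rewrite mxE; have [] := H i.
Qed.

Lemma is_derive_mulmxr N M (x : R -> 'rV[R]_N) (Q : 'M[R]_(N, M)) (t : R) v :
  is_derive t (1 : R) x v -> is_derive t (1 : R) (fun s => x s *m Q) (v *m Q).
Proof.
move=> /is_derive_coordP Dx; apply/is_derive_coordP => j.
have -> : (fun s => (x s *m Q) 0 j) = \sum_k (fun s => Q k j * x s 0 k).
  by apply/funext => s; rewrite fct_sumE mxE; apply: eq_bigr => k _; rewrite mulrC.
have H k : is_derive t (1 : R) (fun s => Q k j * x s 0 k) (Q k j * v 0 k).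
  by have D := Dx k; apply: is_derive_eq; rewrite /GRing.scale.
apply: is_derive_eq.
by rewrite mxE; apply: eq_bigr => k _; rewrite mulrC.
Qed.

Lemma continuous_coordP (T : topologicalType) N (x : T -> 'rV[R]_N) :
  (forall i, continuous (fun s => x s 0 i)) -> continuous x.
Proof.
move=> H t; apply/cvgrPdist_le => e e0; near=> s.
apply: norm_le_coord; first exact: ltW.
move=> i; rewrite !mxE; move: i; near: s; apply: filter_forall => i.
by have /cvgrPdist_le := H i t; apply.
Unshelve. all: by end_near. Qed.

Lemma continuous_coord (T : topologicalType) N (x : T -> 'rV[R]_N) i :
  continuous x -> continuous (fun s => x s 0 i).
Proof.
move=> cx s; apply: (@continuous_comp _ _ _ x (fun v : 'rV_N => v 0 i) s (cx s)).
exact: coord_continuous.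
Qed.

Lemma cvg_sumr (T : Type) (F : set_system T) (FF : Filter F)
    (V : normedModType R) (I : Type) (s : seq I) (f : I -> T -> V) (a : I -> V) :
  (forall i, f i x @[x --> F] --> a i) ->
  (\sum_(i <- s) f i x) @[x --> F] --> \sum_(i <- s) a i.
Proof.
move=> fa; elim: s => [|i s IH].
  by rewrite big_nil; under eq_fun do rewrite big_nil; exact: cvg_cst.
by rewrite big_cons; under eq_fun do rewrite big_cons; exact: cvgD.
Qed.

Lemma norm_mulmxr N M (Q : 'M[R]_(N, M)) :
  exists2 c : R, 0 < c & forall x : 'rV[R]_N, `|x *m Q| <= c * `|x|.
Proof.
exists (1 + \sum_i \sum_j `|Q i j|).
  by rewrite ltr_pwDl//; apply: sumr_ge0 => i _; apply: sumr_ge0.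
move=> x; apply: norm_le_coord.
  by rewrite mulr_ge0// addr_ge0//; apply: sumr_ge0 => i _; apply: sumr_ge0.
move=> j; rewrite mxE (le_trans (ler_norm_sum _ _ _))//.
rewrite mulrDl mul1r mulr_suml ler_wpDl//; apply: ler_sum => i _.
rewrite normrM mulrC ler_pM// ?coord_le_norm//.
by rewrite (bigD1 j)//= lerDl sumr_ge0.
Qed.

Lemma continuous_mulmxr N M (Q : 'M[R]_(N, M)) :
  continuous (fun x : 'rV[R]_N => x *m Q).
Proof.
apply: continuous_coordP => j x.
have -> : (fun y : 'rV_N => (y *m Q) 0 j) = (fun y => \sum_k y 0 k * Q k j).
  by apply/funext => y; rewrite mxE.
apply: (@cvg_sumr _ (nbhs x) (nbhs_filter x)) => k; apply: cvgM; last exact: cvg_cst.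
exact: coord_continuous.
Qed.

End RowVectors.

(* Backward from T, growth of rate K is allowed: there the perturbation is not small,
   but integrating it against this weight gains a factor 1 / K.  After T the weight
   is bounded (alpha = 0) or forces exponential decay. *)
Definition lp_weight (R : realType) (K alpha T t : R) : R :=
  expR (if t <= T then K * (T - t) else alpha * (T - t)).

(** * The weighted estimate behind the contraction *)

Section LyapunovPerronEstimate.
Variable R : realType.
Implicit Types (K alpha T L eps C r t : R).

Lemma lp_weight_left K alpha T t :
  t <= T -> lp_weight K alpha T t = expR (- K * (t - T)).
Proof. by rewrite /lp_weight => ->; congr expR; ring. Qed.

Lemma lp_weight_right K alpha T t :
  T <= t -> lp_weight K alpha T t = expR (- alpha * (t - T)).
Proof.
rewrite /lp_weight le_eqVlt => /predU1P[->|Tt].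
  by rewrite lexx subrr !mulr0.
by rewrite leNgt Tt; congr expR; ring.
Qed.

Lemma lp_weight_gt0 K alpha T t : 0 < lp_weight K alpha T t.
Proof. exact: expR_gt0. Qed.

Lemma lp_weight_le K alpha T t : 0 <= K -> 0 <= alpha -> 0 <= T -> 0 <= t ->
  lp_weight K alpha T t <= expR (K * T).
Proof.
move=> K0 a0 T0 t0; rewrite /lp_weight ler_expR; case: (leP t T) => tT.
  by rewrite ler_wpM2l// gerBl.
by apply: (le_trans _ (mulr_ge0 K0 T0)); rewrite mulr_ge0_le0// subr_le0 ltW.
Qed.

(** Along the barrier [(r + C / 2) * lp_weight K alpha T t], the linear part and the slope of the
    weight differ by a relative rate of at least [|d| - alpha >= 2 * eps] after [T] and
    [K - |d| >= 2 * L] before it. Multiplied by [C / 2], this absorbs the forcing [eps * C] or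
    [L * C]. Only half of [C] survives, which is the contraction factor. *)
Lemma lp_estimate_coord (d : R) K alpha T L eps C r (q g : R -> R) :
  0 <= T -> 0 <= L -> 0 < eps -> 0 <= alpha -> 0 <= C -> 0 <= r ->
  alpha + 2 * eps <= `|d| -> `|d| + 2 * L <= K ->
  continuous q ->
  (forall t, 0 < t -> is_derive t (1 : R) q (d * q t + g t)) ->
  (forall t, 0 < t < T -> `|g t| <= L * (C * lp_weight K alpha T t)) ->
  (forall t, T < t -> `|g t| <= eps * (C * lp_weight K alpha T t)) ->
  (d < 0 -> `|q T| <= r) ->
  (0 < d -> exists M, forall t, 0 <= t -> `|q t| <= M) ->
  forall t, 0 <= t -> `|q t| <= (r + C / 2) * lp_weight K alpha T t.
Proof.
move=> T0 L0 e0 a0 C0 r0 ad dK cq Dq gL gE qT qM.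
(* The signs [s = 1] and [s = -1] give the upper and the lower bound by one argument. *)
suff H (s : R) : `|s| = 1 -> forall t, 0 <= t ->
    s * q t <= (r + C / 2) * lp_weight K alpha T t.
  move=> t t0; rewrite ler_norml lerNl -mulN1r H ?normrN ?normr1//.
  by rewrite -[q t]mul1r H ?normr1.
move=> s1.
have sabs (y : R) : s * y <= `|y| by rewrite (le_trans (ler_norm _))// normrM s1 mul1r.
have rC0 : 0 <= r + C / 2 by rewrite addr_ge0// divr_ge0.
pose u k t := (r + C / 2) * expR (- k * (t - T)) - s * q t.
have cu k : continuous (u k).
  move=> t; apply: cvgB; apply: cvgM; try exact: cvg_cst; last exact: cq.
  exact: continuous_expR_scale.
pose du k t := (r + C / 2) * (- k * expR (- k * (t - T))) - s * (d * q t + g t).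
have Du k t : 0 < t -> is_derive t (1 : R) (u k) (du k t).
  move=> t0; have D1 := Dq _ t0; have D2 := derive_expR_scale (- k) T t.
  by apply: is_derive_eq; rewrite /du /GRing.scale /=; ring.
have right t : T <= t -> s * q t <= (r + C / 2) * lp_weight K alpha T t.
  move=> Tt; rewrite lp_weight_right// -subr_ge0 -/(u alpha t).
  have gE' z : T < z -> s * g z <= eps * (C * expR (- alpha * (z - T))).
    by move=> Tz; rewrite (le_trans (sabs _))// (le_trans (gE _ Tz))//
      lp_weight_right// ltW.
  have gE'' z : T < z -> - (s * g z) <= eps * (C * expR (- alpha * (z - T))).
    move=> Tz; rewrite -mulrN (le_trans (sabs _))// normrN (le_trans (gE _ Tz))//.
    by rewrite lp_weight_right// ltW.
  have [d0|d0] := ltP d 0.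
    rewrite ltr0_norm// in ad.
    apply: (@comparison_forward _ (u alpha) (du alpha) d T t (cu alpha) Tt) =>
      [z /andP[Tz _]|z /andP[Tz _]|].
    - by apply: Du; apply: le_lt_trans Tz.
    - have := gE' _ Tz; rewrite /u /du;
      move: (expR _) (expR_gt0 (- alpha * (z - T))) => E E0 h.
      have : 0 <= (- d - alpha - 2 * eps) * ((r + C / 2) * E).
        by rewrite mulr_ge0//; [lra|rewrite mulr_ge0// ltW].
      have : 0 <= eps * (r * E) by rewrite !mulr_ge0// ltW.
      lra.
    - rewrite /u subrr mulr0 expR0 mulr1 subr_ge0 (le_trans (sabs _))//.
      by rewrite (le_trans (qT d0))// lerDl divr_ge0.
  have {}d0 : 0 < d.
    by rewrite lt_neqAle d0 andbT; apply/eqP => d0'; move: ad; rewrite -d0' normr0; lra.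
  rewrite gtr0_norm// in ad.
  have [M {}qM] := qM d0.
  apply: (@comparison_bounded _ (u alpha) (du alpha) d t M (cu alpha) d0) =>
    [z tz|z tz|z tz].
  - by apply: Du; lra.
  - have := gE'' z ltac:(lra).
    rewrite /u /du; move: (expR _) (expR_gt0 (- alpha * (z - T))) => E E0 h.
    have : 0 <= (d - alpha - 2 * eps) * ((r + C / 2) * E).
      by rewrite mulr_ge0//; [lra|rewrite mulr_ge0// ltW].
    have : 0 <= eps * (r * E) by rewrite !mulr_ge0// ltW.
    have : 0 <= alpha * ((r + C / 2) * E) by rewrite !mulr_ge0// ltW.
    lra.
  - rewrite lerBrDr addrC -lerBrDr opprK.
    rewrite (le_trans (sabs _))// (le_trans (qM z _)) ?lerDr ?mulr_ge0 ?expR_ge0//.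
    by lra.
(* Before [T] every coordinate is integrated backward from [T], whatever the sign of [d], since [K]
   dominates [|d|]. *)
move=> t t0; have [|tT] := leP T t; first exact: right.
rewrite lp_weight_left ?(ltW tT)// -subr_ge0 -/(u K t).
have dK' : - d + 2 * L <= K by apply: le_trans dK; rewrite lerD2r -normrN ler_norm.
apply: (@comparison_backward _ (u K) (du K) d t T (cu K) (ltW tT)) =>
  [z /andP[tz zT]|z /andP[tz zT]|].
- by apply: Du; lra.
- have : - (s * g z) <= L * (C * expR (- K * (z - T))).
    rewrite -mulrN (le_trans (sabs _))// normrN (le_trans (gL z _))//.
      by rewrite zT andbT; lra.
    by rewrite lp_weight_left// ltW.
  rewrite /u /du; move: (expR _) (expR_gt0 (- K * (z - T))) => E E0 h.
  have : 0 <= (K + d - 2 * L) * ((r + C / 2) * E).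
    by rewrite mulr_ge0//; [lra|rewrite mulr_ge0// ltW].
  have : 0 <= L * (r * E) by rewrite !mulr_ge0// ltW.
  lra.
- have := right T (lexx _); rewrite /u lp_weight_right// !subrr !mulr0 expR0 => ?.
  by rewrite subr_ge0.
Qed.

Lemma lp_estimate N (d : 'rV[R]_N) K alpha T L eps C r (x g : R -> 'rV[R]_N) :
  0 <= T -> 0 <= L -> 0 < eps -> 0 <= alpha -> 0 <= C -> 0 <= r ->
  (forall i, alpha + 2 * eps <= `|d 0 i|) -> (forall i, `|d 0 i| + 2 * L <= K) ->
  continuous x ->
  (forall t, 0 < t -> is_derive t (1 : R) x (x t *m diag_mx d + g t)) ->
  (forall t, 0 < t < T -> `|g t| <= L * (C * lp_weight K alpha T t)) ->
  (forall t, T < t -> `|g t| <= eps * (C * lp_weight K alpha T t)) ->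
  (forall i, d 0 i < 0 -> `|x T 0 i| <= r) ->
  (forall i, 0 < d 0 i -> exists M, forall t, 0 <= t -> `|x t 0 i| <= M) ->
  forall t, 0 <= t -> `|x t| <= (r + C / 2) * lp_weight K alpha T t.
Proof.
move=> T0 L0 e0 a0 C0 r0 ad dK cx Dx gL gE xT xM t t0.
apply: norm_le_coord => [|i].
  by rewrite mulr_ge0// ?addr_ge0 ?divr_ge0// ltW// lp_weight_gt0.
apply: (@lp_estimate_coord (d 0 i) K alpha T L eps C r (fun t => x t 0 i) (fun t =>
  g t 0 i)) => //.
- exact: continuous_coord.
- move=> s s0; have /is_derive_coordP/(_ i) := Dx s s0.
  by rewrite mul_mx_diag !mxE mulrC.
- by move=> s /gL; apply: le_trans; exact: coord_le_norm.
- by move=> s /gE; apply: le_trans; exact: coord_le_norm.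
- exact: xT.
- exact: xM.
Qed.

End LyapunovPerronEstimate.

(** * Limits of sequences with geometrically decreasing increments *)

Section GeometricLimit.
Variable R : realType.

Lemma geometric_small (c e : R) : 0 < e -> exists k : nat, c * 2^-1 ^+ k < e.
Proof.
move=> e0; have h1 : `|2^-1 : R| < 1 by rewrite ger0_norm; lra.
have /cvgrPdist_lt/(_ e e0) : (c * 2^-1 ^+ k) @[k --> \oo] --> (0 : R).
  rewrite -[X in _ --> X](mulr0 c); apply: cvgM; first exact: cvg_cst.
  exact: cvg_expr.
move=> [k _ /(_ k (leqnn k))] /=; rewrite sub0r normrN => h.
by exists k; apply: le_lt_trans h; exact: ler_norm.
Qed.

Lemma geometric_eq0 (z c : R) : (forall k : nat, `|z| <= c * 2^-1 ^+ k) -> z = 0.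
Proof.
move=> H; apply/eqP; rewrite -normr_le0; apply/ler_addgt0Pr => e e0; rewrite add0r.
have [k ke] := geometric_small c e0.
exact: le_trans (H k) (ltW ke).
Qed.

(** The radius [2 * c * 2^-1 ^+ k] is the tail of the geometric series. The intervals of these radii
    around the [v k] meet pairwise, so the supremum of their left endpoints lies in all of them. *)
Lemma geometric_limit (v : nat -> R) (c : R) :
  (forall k, `|v k.+1 - v k| <= c * 2^-1 ^+ k) ->
  exists l, forall k, `|v k - l| <= 2 * c * 2^-1 ^+ k.
Proof.
move=> H.
have c0 : 0 <= c by have := H 0%N; rewrite expr0 mulr1; apply: le_trans.
have D j m : `|v (j + m)%N - v j| <= 2 * c * (2^-1 ^+ j - 2^-1 ^+ (j + m)).
  elim: m => [|m IH]; first by rewrite addn0 !subrr normr0 mulr0.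
  rewrite addnS -(subrKA (v (j + m)%N)) (le_trans (ler_normD _ _))//.
  apply: le_trans (lerD (H _) IH) _.
  by rewrite exprS; lra.
have D' j k : v j - 2 * c * 2^-1 ^+ j <= v k + 2 * c * 2^-1 ^+ k.
  have ep (m : nat) : 0 <= 2 * c * (2^-1 : R) ^+ m.
    by rewrite !mulr_ge0// exprn_ge0.
  have := ep j; have := ep k.
  have [jk|/ltnW kj] := leqP j k.
    by have := D j (k - j)%N; rewrite subnKC// ler_norml => /andP[h1 h2]; lra.
  by have := D k (j - k)%N; rewrite subnKC// ler_norml => /andP[h1 h2]; lra.
pose S := range (fun k => v k - 2 * c * 2^-1 ^+ k).
have Sub k : ubound S (v k + 2 * c * 2^-1 ^+ k) by move=> _ [j _ <-].
have S0 : S !=set0 by exists (v 0%N - 2 * c * 2^-1 ^+ 0); exists 0%N.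
exists (sup S) => k; rewrite ler_norml.
have h1 : sup S <= v k + 2 * c * 2^-1 ^+ k by apply: ge_sup => //; exact: Sub.
have h2 : v k - 2 * c * 2^-1 ^+ k <= sup S.
  by apply: ub_le_sup; [exists (v 0%N + 2 * c * 2^-1 ^+ 0); exact: Sub|exists k].
by apply/andP; split; lra.
Qed.

Lemma geometric_limit_rV N (v : nat -> 'rV[R]_N) (c : R) :
  (forall k, `|v k.+1 - v k| <= c * 2^-1 ^+ k) ->
  exists l, forall k, `|v k - l| <= 2 * c * 2^-1 ^+ k.
Proof.
move=> H.
have c0 : 0 <= c by have := H 0%N; rewrite expr0 mulr1; apply: le_trans.
have /choice[l lP] : forall i, exists l : R, forall k,
  `|v k 0 i - l| <= 2 * c * 2^-1 ^+ k.
  move=> i; apply: geometric_limit => k.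
  by apply: le_trans (H k); have := coord_le_norm (v k.+1 - v k) i; rewrite !mxE.
exists (\row_i l i) => k; apply: norm_le_coord => [|i].
  by rewrite !mulr_ge0// exprn_ge0.
by rewrite !mxE.
Qed.

Lemma continuous_unif_limit (T : topologicalType) N (u : nat -> T -> 'rV[R]_N)
    (x : T -> 'rV[R]_N) (c : R) :
  (forall k, continuous (u k)) ->
  (forall k t, `|u k t - x t| <= c * 2^-1 ^+ k) -> continuous x.
Proof.
move=> cu ux t; apply/cvgrPdist_lt => e e0.
have e30 : 0 < e / 3 by lra.
have [k ke] := geometric_small c e30.
near=> s.
have h1 := ux k t; have h2 := ux k s.
have h3 : `|u k t - u k s| < e / 3.
  by near: s; have /cvgrPdist_lt := cu k t; apply; lra.
have -> : x t - x s = - (u k t - x t) + (u k t - u k s) + (u k s - x s).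
  by rewrite opprB !subrKA.
rewrite (le_lt_trans (ler_normD _ _))//.
have := ler_normD (- (u k t - x t)) (u k t - u k s); rewrite normrN => h4.
lra.
Unshelve. all: by end_near. Qed.

End GeometricLimit.

Section PosPart.
Variable R : realType.
Implicit Types t : R.

(* Composition with [pos] extends a function on [0, +oo[ to R, constantly for t <= 0,
   so that one-sided regularity at 0 never has to be considered. *)
Definition pos t : R := Num.max t 0.

Lemma pos_ge0 t : 0 <= pos t. Proof. by rewrite le_max lexx orbT. Qed.

Lemma pos_id t : 0 <= t -> pos t = t. Proof. by move=> t0; apply/max_idPl. Qed.

Lemma continuous_pos : continuous pos.
Proof.
move=> t; apply: (@continuous_max _ _ id (cst 0)); first exact: cvg_id.
exact: cvg_cst.
Qed.

Lemma is_derive_pos (V : normedModType R) (x : R -> V) t v : 0 < t ->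
  is_derive t (1 : R) (x \o pos) v <-> is_derive t (1 : R) x v.
Proof.
move=> t0.
have E : \near t, x t = (x \o pos) t.
  near=> s => /=; rewrite pos_id//.
  by near: s; exact: lt_le_nbhsr.
have E' : \near t, (x \o pos) t = x t by near do apply/esym.
split=> D.
  by have := near_eq_is_derive E' D.
by have := near_eq_is_derive E D.
Unshelve. all: by end_near. Qed.

End PosPart.

(** * The contraction and its fixed point *)

Section LyapunovPerronExistence.
Variables (R : realType) (N : nat) (d : 'rV[R]_N).
Variables (K alpha T L eps delta : R).
Hypotheses (T0 : 0 <= T) (L0 : 0 <= L) (e0 : 0 < eps) (a0 : 0 <= alpha).
Hypothesis hd : forall i, alpha + 2 * eps <= `|d 0 i|.
Hypothesis hK : forall i, `|d 0 i| + 2 * L <= K.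
Hypothesis K0 : 0 <= K.
Local Notation w := (lp_weight K alpha T).

(** The value at [T] is prescribed for the nonpositive entries of [d]; for the positive ones
    boundedness singles out the solution. The scalar solutions are controlled only on []-1, +oo[],
    hence the composition with [pos]. *)
Lemma linear_system_exists (g : R -> 'rV[R]_N) (B : R) (xi : 'rV[R]_N) :
  continuous g -> (forall t : R, 0 <= t -> `|g t| <= B) ->
  exists x : R -> 'rV[R]_N,
    [/\ continuous x,
        forall t : R, 0 < t -> is_derive t (1 : R) x (x t *m diag_mx d + g t),
        forall i, d 0 i < 0 -> x T 0 i = xi 0 i &
        forall i, 0 < d 0 i -> exists M, forall t : R, 0 <= t -> `|x t 0 i| <= M].
Proof.
move=> cg gB.
have /choice[q qP] : forall i, exists q : R -> R,
  [/\ forall t : R, -1 < t -> is_derive t (1 : R) q (d 0 i * q t + g t 0 i),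
    d 0 i < 0 -> q T = xi 0 i &
    0 < d 0 i -> exists M, forall t : R, 0 <= t -> `|q t| <= M].
  move=> i; have cgi : continuous (fun t => g t 0 i) by exact: continuous_coord.
  have [di|di] := ltP 0 (d 0 i).
    have gBi t : 0 <= t -> `|g t 0 i| <= B.
      by move=> /gB; apply: le_trans; exact: coord_le_norm.
    have [q Dq qB] := linear_ode_bounded di cgi gBi.
    exists q; split=> // [dn|_]; first by move: (lt_trans di dn); rewrite ltxx.
    by exists (B / d 0 i).
  have [q Dq qT] := linear_ode_initial (d 0 i) T (xi 0 i) cgi.
  by exists q; split=> // dp; move: (lt_le_trans dp di); rewrite ltxx.
exists (fun t => \row_i q i (pos t)); split.
- apply: continuous_coordP => i t.
  have -> : (fun s => (\row_j q j (pos s)) 0 i) = q i \o @pos R.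
    by apply/funext => s; rewrite mxE.
  apply: continuous_comp; first exact: continuous_pos.
  apply: differentiable_continuous; apply/derivable1_diffP.
  have [Dq _ _] := qP i.
  by have [] := Dq (pos t) (lt_le_trans (ltrN10 _) (pos_ge0 t)).
- move=> t t0; apply/is_derive_coordP => i.
  have -> : (fun s => (\row_j q j (pos s)) 0 i) = q i \o @pos R.
    by apply/funext => s; rewrite mxE.
  apply/(is_derive_pos _ _ t0).
  rewrite mul_mx_diag !mxE pos_id ?(ltW t0)// mulrC.
  by have [Dq _ _] := qP i; apply: Dq; apply: lt_trans t0; exact: ltrN10.
- by move=> i di; rewrite mxE pos_id//; have [_ + _] := qP i; apply.
- move=> i di; have [_ _ /(_ di)[M qM]] := qP i.
  by exists M => t t0; rewrite mxE pos_id// qM.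
Qed.

Variables (g : R -> 'rV[R]_N -> 'rV[R]_N) (xi : 'rV[R]_N).
Hypothesis cg : forall x, continuous x -> continuous (fun t => g t (x t)).
Hypothesis g0 : forall t : R, 0 <= t -> g t 0 = 0.
Hypothesis gL : forall t x y, 0 <= t <= T -> `|x| <= delta -> `|y| <= delta ->
  `|g t x - g t y| <= L * `|x - y|.
Hypothesis gE : forall t x y, T <= t -> `|x| <= delta -> `|y| <= delta ->
  `|g t x - g t y| <= eps * `|x - y|.
Hypothesis xi_small : 2 * `|xi| * expR (K * T) <= delta.

(** The constant [2 * |xi|] is the fixed point of [C |-> |xi| + C / 2], the map given by the
    weighted estimate. With [xi_small], admissible curves stay in the ball of radius [delta] where
    [gL] and [gE] hold. *)
Let admissible (y : R -> 'rV[R]_N) :=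
  continuous y /\ forall t : R, 0 <= t -> `|y t| <= 2 * `|xi| * w t.

Let step (y x : R -> 'rV[R]_N) :=
  [/\ continuous x,
      forall t : R, 0 < t -> is_derive t (1 : R) x (x t *m diag_mx d + g t (y t)),
      forall i, d 0 i < 0 -> x T 0 i = xi 0 i &
      forall i, 0 < d 0 i -> exists M, forall t : R, 0 <= t -> `|x t 0 i| <= M].

Let admissible_small y t : admissible y -> 0 <= t -> `|y t| <= delta.
Proof.
move=> [_ yx] t0; apply: le_trans xi_small; apply: le_trans (yx t t0) _.
by rewrite ler_wpM2l ?mulr_ge0// lp_weight_le.
Qed.

Let step_exists y : admissible y -> exists x, step y x.
Proof.
move=> ay; have [cy _] := ay.
have d00 : `|0 : 'rV[R]_N| <= delta
  by rewrite normr0 (le_trans _ (admissible_small ay (lexx _))).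
have [x [cx Dx xT xM]] : exists x : R -> 'rV[R]_N,
    [/\ continuous x,
        forall t : R, 0 < t ->
          is_derive t (1 : R) x (x t *m diag_mx d + g (pos t) (y (pos t))),
        forall i, d 0 i < 0 -> x T 0 i = xi 0 i &
        forall i, 0 < d 0 i -> exists M, forall t : R, 0 <= t -> `|x t 0 i| <= M].
  apply: (@linear_system_exists (fun t => g (pos t) (y (pos t))) ((L + eps) * delta)).
    move=> t; apply: (@continuous_comp _ _ _ (@pos R) (fun s => g s (y s))).
      exact: continuous_pos.
    exact: cg.
  move=> t t0; rewrite pos_id// -[g t (y t)]subr0 -(g0 t0).
  have yd := admissible_small ay t0; have e0' := ltW e0.
  have [tT|Tt] := leP t T.
    have := gL _ yd d00; rewrite subr0 => /(_ t); rewrite t0 => /(_ tT) h.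
    by apply: le_trans h _; rewrite ler_pM// lerDl.
  have := gE (ltW Tt) yd d00; rewrite subr0 => h.
  by apply: le_trans h _; rewrite ler_pM// lerDr.
exists x; split=> // t t0; have := Dx t t0; by rewrite pos_id// ltW.
Qed.

Let step_admissible y x : admissible y -> step y x -> admissible x.
Proof.
move=> ay [cx Dx xT xM]; split=> // t t0; have [_ yw] := ay.
have -> : 2 * `|xi| = `|xi| + (2 * `|xi|) / 2 by lra.
have d00 : `|0 : 'rV[R]_N| <= delta
  by rewrite normr0 (le_trans _ (admissible_small ay (lexx _))).
apply: (@lp_estimate _ _ d K alpha T L eps _ _ x (fun t => g t (y t))) => //.
- move=> s /andP[s0 sT]; rewrite -[g s (y s)]subr0 -(g0 (ltW s0)).
  have yd := admissible_small ay (ltW s0).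
  have := gL _ yd d00; rewrite subr0 => /(_ s); rewrite (ltW s0) (ltW sT) => /(_ isT) h.
  by apply: le_trans h _; rewrite ler_wpM2l// yw// ltW.
- move=> s Ts; have s0 : 0 <= s by apply: le_trans T0 (ltW Ts).
  rewrite -[g s (y s)]subr0 -(g0 s0).
  have := gE (ltW Ts) (admissible_small ay s0) d00; rewrite subr0 => h.
  by apply: le_trans h _; rewrite ler_wpM2l ?(ltW e0)// yw.
- by move=> i di; rewrite xT// coord_le_norm.
Qed.

(** The stable coordinates of [x1] and [x2] at [T] coincide, so the weighted estimate applies to the
    difference with [r = 0]. *)
Let step_contract y1 y2 x1 x2 C : 0 <= C -> admissible y1 -> admissible y2 ->
  step y1 x1 -> step y2 x2 ->
  (forall t : R, 0 <= t -> `|y1 t - y2 t| <= C * w t) ->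
  forall t : R, 0 <= t -> `|x1 t - x2 t| <= C / 2 * w t.
Proof.
move=> C0 a1 a2 [c1 D1 T1 M1] [c2 D2 T2 M2] yC t t0; rewrite -[C / 2]add0r.
apply: (@lp_estimate _ _ d K alpha T L eps C 0 (fun t => x1 t - x2 t)
   (fun t => g t (y1 t) - g t (y2 t))) => //.
- by move=> s; apply: cvgB; [exact: c1|exact: c2].
- move=> s s0; have E1 := D1 s s0; have E2 := D2 s s0.
  by apply: is_derive_eq; rewrite mulmxBl opprD addrACA.
- move=> s /andP[s0 sT].
  have h1 := admissible_small a1 (ltW s0); have h2 := admissible_small a2 (ltW s0).
  apply: le_trans (gL _ h1 h2) _; first by rewrite !ltW.
  by rewrite ler_wpM2l// yC// ltW.
- move=> s Ts; have s0 : 0 <= s by apply: le_trans T0 (ltW Ts).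
  apply: le_trans (gE (ltW Ts) (admissible_small a1 s0) (admissible_small a2 s0)) _.
  by rewrite ler_wpM2l ?(ltW e0)// yC.
- by move=> i di; rewrite !mxE T1// T2// subrr normr0.
- move=> i di; have [m1 h1] := M1 i di; have [m2 h2] := M2 i di.
  exists (m1 + m2) => s s0; rewrite !mxE.
  by apply: le_trans (ler_normB _ _) _; rewrite lerD ?h1 ?h2.
Qed.

Lemma lp_exists : exists x : R -> 'rV[R]_N,
  [/\ continuous x,
      forall t : R, 0 < t -> is_derive t (1 : R) x (x t *m diag_mx d + g t (x t)),
      forall i, d 0 i < 0 -> x T 0 i = xi 0 i &
      forall t : R, 0 <= t -> `|x t| <= 2 * `|xi| * w t].
Proof.
have xi0 : 0 <= 2 * `|xi| by rewrite mulr_ge0.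
have /choice[f fP] : forall y, exists x, admissible y -> step y x.
  move=> y; have [ay|nay] := pselect (admissible y); last by exists y.
  by have [x xP] := step_exists ay; exists x.
pose u k := iter k f (cst 0).
have au k : admissible (u k).
  elim: k => [|k IH]; last exact: (step_admissible IH (fP _ IH)).
  split; first by move=> t; exact: cvg_cst.
  by move=> t t0; rewrite /u /= normr0 mulr_ge0// ltW// lp_weight_gt0.
have uu k t : 0 <= t -> `|u k.+1 t - u k t| <= 2 * `|xi| * 2^-1 ^+ k * w t.
  elim: k t => [|k IH] t t0.
    by rewrite expr0 mulr1 [u 0%N t]/= subr0; have [_] := au 1%N; apply.
  rewrite exprSr [_ * (_ * _)]mulrA.
  by apply: (@step_contract (u k.+1) (u k)) => //; [exact: fP|exact: fP].
have /choice[x xP] : forall t, exists l,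
    forall k, `|u k (pos t) - l| <= 2 * (2 * `|xi| * w (pos t)) * 2^-1 ^+ k.
  move=> t; apply: geometric_limit_rV => k.
  by apply: le_trans (uu k _ (pos_ge0 t)) _; rewrite mulrAC.
have cx : continuous x.
  apply: (@continuous_unif_limit _ _ _ (fun k t => u k (pos t)) x
    (2 * (2 * `|xi| * expR (K * T)))).
    move=> k t; apply: (@continuous_comp _ _ _ (@pos R) (u k)).
      exact: continuous_pos.
    by have [+ _] := au k; apply.
  move=> k t; apply: le_trans (xP t k) _.
  rewrite ler_wpM2r ?exprn_ge0// ler_wpM2l// ler_wpM2l//.
  by rewrite lp_weight_le// pos_ge0.
have xu t k : 0 <= t -> `|x t - u k t| <= 2 * (2 * `|xi| * w t) * 2^-1 ^+ k.
  by move=> t0; have := xP t k; rewrite pos_id// distrC.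
have ax : admissible x.
  split=> // t t0; rewrite -subr_le0.
  set z := _ - _; have [//|z0] := leP z 0.
  suff zE : z = 0 by rewrite zE ltxx in z0.
  apply: (@geometric_eq0 _ _ (2 * (2 * `|xi| * w t))) => k.
  rewrite gtr0_norm// /z.
  have [_ /(_ t t0) h] := au k; have := xu t k t0.
  have := ler_normD (x t - u k t) (u k t); rewrite subrK => h1 h2; lra.
have sx := fP _ ax.
(* [f x] and [x] are both within a multiple of [2^-1 ^+ k] of the iterate [u k.+1]: the first by
   contraction from [u k], the second by the rate of convergence. *)
have fx t : 0 <= t -> f x t = x t.
  move=> t0; apply/rowP => i; apply/eqP; rewrite -subr_eq0; apply/eqP.
  apply: (@geometric_eq0 _ _ (2 * (2 * `|xi| * w t))) => k.
  have := coord_le_norm (f x t - x t) i; rewrite !mxE => /le_trans; apply.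
  have h1 := xu t k.+1 t0.
  have C0 : 0 <= 4 * `|xi| * 2^-1 ^+ k by rewrite !mulr_ge0// exprn_ge0.
  have h2 : `|f x t - u k.+1 t| <= 4 * `|xi| * 2^-1 ^+ k / 2 * w t.
    apply: (@step_contract x (u k)) => //; first exact: fP.
    by move=> s s0; apply: le_trans (xu s k s0) _; lra.
  rewrite -(subrKA (u k.+1 t)) (le_trans (ler_normD _ _))//.
  rewrite [`|u k.+1 t - _|]distrC; move: h1; rewrite exprS => h1.
  have := lp_weight_gt0 K alpha T t; lra.
have [cfx Dfx fxT _] := sx.
(* The limit [x] is known only pointwise, whereas [f x] satisfies a differential equation by
   construction; since the two agree for [t >= 0], it is the desired one. *)
exists (f x); split=> //.
  by move=> t t0; have := Dfx t t0; rewrite -(fx t (ltW t0)).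
by move=> t t0; rewrite fx//; have [_] := ax; apply.
Qed.

End LyapunovPerronExistence.

(** * A Gronwall bound in the sup norm *)

Section Gronwall.
Variable R : realType.

(** The sup norm is not differentiable, so the growth is measured by the sum of squares [V], with
    [|x| ^+ 2 <= V <= N * |x| ^+ 2]. The summand 1 in the constant spares a square root:
    [y <= (1 + y) ^+ 2] for [y >= 0]. *)
Lemma gronwall_bound N (c T : R) : 0 <= c -> exists2 C : R, 0 < C &
  forall (x v : R -> 'rV[R]_N), 0 <= T -> continuous x ->
    (forall t : R, 0 < t < T -> is_derive t (1 : R) x (v t)) ->
    (forall t : R, 0 < t < T -> `|v t| <= c * `|x t|) -> `|x T| <= C * `|x 0|.
Proof.
move=> c0; pose k := 2 * (N%:R * c).
exists (1 + N%:R * expR (k * (T - 0))).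
  by rewrite ltr_pwDl// mulr_ge0// expR_ge0.
move=> x v T0 cx Dx vx.
pose V t := \sum_i x t 0 i ^+ 2.
have xV t : `|x t| ^+ 2 <= V t.
  have V0 : 0 <= V t by apply: sumr_ge0 => i _; exact: sqr_ge0.
  rewrite -[V t]sqr_sqrtr// lerXn2r ?nnegrE ?sqrtr_ge0//.
  apply: norm_le_coord => [|i]; first exact: sqrtr_ge0.
  rewrite -sqrtr_sqr ler_wsqrtr// /V (bigD1 i)//= lerDl.
  by apply: sumr_ge0 => j _; exact: sqr_ge0.
have VT : - V 0 * expR (k * (T - 0)) <= - V T.
  apply: (@exp_growth _ (fun t => - V t)
    (fun t => - \sum_i (2 * x t 0 i * v t 0 i)) k 0 T) => //.
  - move=> t; apply: cvgN; apply: (@cvg_sumr _ _ (nbhs t) (nbhs_filter t)) => i.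
    by apply: cvgM; exact: continuous_coord.
  - move=> t tT; have /is_derive_coordP Dxt := Dx t tT.
    have -> : (fun t => - V t) = - \sum_i (fun t => x t 0 i ^+ 2).
      by apply/funext => s; rewrite /V [RHS]/GRing.opp/= fct_sumE.
    have H i : is_derive t (1 : R) (fun t => x t 0 i ^+ 2) (2 * x t 0 i * v t 0 i).
      by have D := Dxt i; apply: is_derive_eq; rewrite /GRing.scale /=; ring.
    by apply: is_deriveN.
  - move=> t tT; rewrite mulrN lerN2.
    apply: (@le_trans _ _ (\sum_(i < N) (2 * c * `|x t| ^+ 2))).
      apply: ler_sum => i _; apply: le_trans (ler_norm _) _.
      rewrite !normrM ger0_norm// -!mulrA ler_wpM2l// mulrC.
      rewrite expr2 mulrA ler_pM// ?coord_le_norm//.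
      by apply: le_trans (vx t tT); exact: coord_le_norm.
    rewrite sumr_const card_ord -[X in X <= _]mulr_natl /k.
    have : 0 <= 2 * c * N%:R by rewrite !mulr_ge0.
    by move=> /ler_wpM2l/(_ _ _ (xV t)); lra.
have V0 : V 0 <= N%:R * `|x 0| ^+ 2.
  apply: (@le_trans _ _ (\sum_(i < N) `|x 0| ^+ 2)); last first.
    by rewrite sumr_const card_ord -[X in X <= _]mulr_natl.
  by apply: ler_sum => i _; rewrite -(real_normK (num_real (x 0 0 i))) lerXn2r
    ?nnegrE// coord_le_norm.
move: VT; rewrite mulNr lerN2; move: (expR _) (expR_gt0 (k * (T - 0))) => E E0 VT.
have NE0 : 0 <= N%:R * E by rewrite mulr_ge0// ltW.
rewrite -ler_sqr ?nnegrE// ?mulr_ge0// ?addr_ge0//.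
apply: le_trans (xV T) _; apply: le_trans VT _.
have /le_trans -> // : V 0 * E <= N%:R * E * `|x 0| ^+ 2.
  by rewrite mulrAC ler_wpM2r// ltW.
rewrite exprMn ler_wpM2r ?sqr_ge0//; nra.
Qed.

End Gronwall.

(** * A priori bounds for bounded solutions *)

Section LyapunovPerronUniqueness.
Variable R : realType.

(** Since the weight is at least 1, boundedness gives a finite best constant [S] in [|x| <= S * w].
    The weighted estimate improves it to [r + (S + c) / 2], so that [S <= 2 * r + c]. *)
Lemma lp_bound N (d : 'rV[R]_N) (K T L eps c r : R) (x g : R -> 'rV[R]_N) :
  0 <= T -> 0 <= L -> 0 < eps -> 0 <= K -> 0 <= c -> 0 <= r ->
  (forall i, 2 * eps <= `|d 0 i|) -> (forall i, `|d 0 i| + 2 * L <= K) ->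
  continuous x ->
  (forall t : R, 0 < t -> is_derive t (1 : R) x (x t *m diag_mx d + g t)) ->
  (forall t : R, 0 < t < T -> `|g t| <= L * (`|x t| + c * lp_weight K 0 T t)) ->
  (forall t : R, T < t -> `|g t| <= eps * (`|x t| + c * lp_weight K 0 T t)) ->
  (forall i, d 0 i < 0 -> `|x T 0 i| <= r) ->
  (exists M, forall t : R, 0 <= t -> `|x t| <= M) ->
  forall t : R, 0 <= t -> `|x t| <= (2 * r + c) * lp_weight K 0 T t.
Proof.
move=> T0 L0 e0 K0 c0 r0 hd hK cx Dx gL gE xT [M xM].
have w0 t := lp_weight_gt0 K 0 T t.
have w1 t : 1 <= lp_weight K 0 T t.
  rewrite -expR0 ler_expR; case: (leP t T) => tT; last by rewrite mul0r.
  by rewrite mulr_ge0// subr_ge0.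
pose S := [set `|x t| / lp_weight K 0 T t | t in [set t : R | 0 <= t]].
have SM : ubound S M.
  move=> _ [t /= t0 <-]; rewrite ler_pdivrMr//.
  by rewrite (le_trans (xM t t0))// ler_peMr// (le_trans _ (xM t t0)).
have S0 : S !=set0 by exists (`|x 0| / lp_weight K 0 T 0); exists 0 => /=.
have xC t : 0 <= t -> `|x t| <= sup S * lp_weight K 0 T t.
  move=> t0; rewrite -ler_pdivrMr//; apply: ub_le_sup; first by exists M.
  by exists t.
have C0 : 0 <= sup S.
  by rewrite -(pmulr_lge0 _ (w0 0)) (le_trans _ (xC 0 (lexx _))).
have H t : 0 <= t -> `|x t| <= (r + (sup S + c) / 2) * lp_weight K 0 T t.
  apply: (@lp_estimate _ _ d K 0 T L eps (sup S + c) r x g) => //.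
  - by rewrite addr_ge0.
  - by move=> i; rewrite add0r.
  - move=> s /andP[s0 sT]; apply: le_trans (gL s _) _; first by rewrite s0.
    by rewrite ler_wpM2l// mulrDl lerD2r xC// ltW.
  - move=> s Ts; apply: le_trans (gE s Ts) _.
    by rewrite ler_wpM2l ?(ltW e0)// mulrDl lerD2r xC// (le_trans T0)// ltW.
  - by move=> i _; exists M => s s0; apply: le_trans (coord_le_norm _ _) (xM s s0).
have SC : sup S <= r + (sup S + c) / 2.
  by apply: ge_sup => // _ [t /= t0 <-]; rewrite ler_pdivrMr// H.
move=> t t0; apply: le_trans (H t t0) _; rewrite ler_wpM2r ?(ltW (w0 _))//.
lra.
Qed.

End LyapunovPerronUniqueness.

(** * Continuously differentiable vector fields and their forward orbits *)

Section ContinuouslyDifferentiable.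
Variable R : realType.

Lemma smooth_differentiable (V W : normedModType R) (f : V -> W) x :
  smooth f -> differentiable f x.
Proof. by move=> /(_ 1%N) [+ _]; apply. Qed.

Lemma smooth_derive (V W : normedModType R) (f : V -> W) w :
  smooth f -> smooth ('D_w f).
Proof. by move=> sf k; have [_ +] := sf k.+1; apply. Qed.

Lemma is_derive_chain (V W : normedModType R) (F : V -> W) (y : R -> V) t v :
  is_derive t (1 : R) y v -> differentiable F (y t) ->
  is_derive t (1 : R) (F \o y) ('d F (y t) v).
Proof.
move=> [Dy yv] dF; have dy : differentiable y t by apply/derivable1_diffP.
have dFy : differentiable (F \o y) t by exact: differentiable_comp.
apply: DeriveDef; first by apply/derivable1_diffP.
by rewrite deriveE// diff_comp//= -yv deriveE.
Qed.

Variables (N : nat).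
Implicit Types (F : 'rV[R]_N -> 'rV[R]_N).

Lemma jacobianE M (F : 'rV[R]_N -> 'rV[R]_M) x i j : differentiable F x ->
  'J F x i j = ('D_(delta_mx 0 i) F x) 0 j.
Proof. by move=> dF; rewrite deriveEjacobian// -rowE [RHS]mxE. Qed.

Lemma is_derive_comp_rV M (F : 'rV[R]_N -> 'rV[R]_M) (y : R -> 'rV[R]_N) t v :
  is_derive t (1 : R) y v -> differentiable F (y t) ->
  is_derive t (1 : R) (F \o y) (v *m 'J F (y t)).
Proof. by move=> Dy dF; rewrite /jacobian mul_rV_lin1; exact: is_derive_chain. Qed.

Definition C1 F := (forall x, differentiable F x) /\ forall w, continuous ('D_w F).

Lemma smooth_C1 F : smooth F -> C1 F.
Proof. by move=> /(_ 1%N). Qed.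

Lemma norm_mulmx_entries M (A : 'M[R]_(N, M)) (c : R) (x : 'rV[R]_N) :
  0 <= c -> (forall i j, `|A i j| <= c) -> `|x *m A| <= N%:R * c * `|x|.
Proof.
move=> c0 Ac; apply: norm_le_coord; first by rewrite !mulr_ge0.
move=> j; rewrite mxE (le_trans (ler_norm_sum _ _ _))//.
apply: (@le_trans _ _ (\sum_(i < N) c * `|x|)).
  by apply: ler_sum => i _; rewrite normrM mulrC ler_pM// coord_le_norm.
by rewrite sumr_const card_ord -[X in X <= _]mulr_natl mulrA.
Qed.

Lemma compact_closed_ball0 (rho : R) : compact [set x : 'rV[R]_N | `|x| <= rho].
Proof.
apply: bounded_closed_compact.
  exists rho; split; first exact: num_real.
  by move=> r rr x /= xr; apply: le_trans xr (ltW rr).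
have -> : [set x : 'rV[R]_N | `|x| <= rho] = (fun x =>
  `|x|) @^-1` [set r | r <= rho] by [].
by apply: closed_comp; [move=> x _; exact: norm_continuous|exact: closed_le].
Qed.

Variable F : 'rV[R]_N -> 'rV[R]_N.
Hypothesis F1 : C1 F.

Lemma jacobian_continuous i j : continuous (fun x => 'J F x i j).
Proof.
have [dF cF] := F1.
have -> : (fun x => 'J F x i j) = (fun x => ('D_(delta_mx 0 i) F x) 0 j).
  by apply/funext => x; exact: jacobianE.
exact/continuous_coord/cF.
Qed.

Lemma dist_le_half (p q r e : R) :
  `|p - r| <= e / 2 -> `|q - r| <= e / 2 -> `|p - q| <= e.
Proof. by rewrite !ler_norml => /andP[? ?] /andP[? ?]; apply/andP; split; lra. Qed.

Lemma norm_le_dist (p q s e : R) : `|p - q| <= e -> `|q| <= s -> `|p| <= e + s.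
Proof. by rewrite !ler_norml => /andP[? ?] /andP[? ?]; apply/andP; split; lra. Qed.

Lemma near_dist_lt (x : 'rV[R]_N) (r : R) : 0 < r -> nbhs x [set y | `|y - x| < r].
Proof.
move=> r0; apply/(@nbhs_normP _ _ x (fun y => `|y - x| < r)).
by exists r => //= y /=; rewrite distrC.
Qed.

Lemma jacobian_near x (eta : R) : 0 < eta -> exists2 r : R, 0 < r &
  forall y, `|y - x| < r -> forall i j, `|'J F y i j - 'J F x i j| <= eta.
Proof.
move=> eta0.
have : \forall y \near x, forall ij : 'I_N * 'I_N,
    `|'J F y ij.1 ij.2 - 'J F x ij.1 ij.2| <= eta.
  apply: (@filter_forall _ _ (fun (ij : 'I_N * 'I_N) y =>
    `|'J F y ij.1 ij.2 - 'J F x ij.1 ij.2| <= eta) _ (nbhs_filter x)) => -[i j] /=.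
  have /(@cvgrPdistC_le _ _ _ _ (nbhs_filter x))/(_ _ eta0) := @jacobian_continuous i j x.
  exact.
move=> /nbhs_normP[r /= r0 H]; exists r => // y yr i j.
by apply: (H y _ (i, j)); rewrite /= distrC.
Qed.

(** The point [y] may leave the ball, so uniform continuity on the ball alone does not suffice. The
    covering argument halves each radius: one half for the centre [x'], one for the increment
    [y - x']. *)
Lemma jacobian_unif (rho eta : R) : 0 < eta -> exists2 delta : R, 0 < delta &
  forall x y : 'rV[R]_N, `|x| <= rho -> `|y - x| <= delta ->
    forall i j, `|'J F y i j - 'J F x i j| <= eta.
Proof.
move=> eta0.
have /compact_near_coveringP cK := @compact_closed_ball0 rho.
have := cK R (0 : R)^'+
  (fun (delta : R) x => forall y, `|y - x| <= delta ->
     forall i j, `|'J F y i j - 'J F x i j| <= eta) _.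
case=> [x _|delta /= delta0 H].
  have eta2 : 0 < eta / 2 by lra.
  have [r r0 rP] := jacobian_near x eta2.
  have r2 : 0 < r / 2 by lra.
  exists ([set x' | `|x' - x| < r / 2], [set delta | delta < r / 2]).
    split=> /=; last exact: nbhs_right_lt.
    exact: near_dist_lt.
  move=> [x' delta] [/= xx' dr] y yx' i j.
  have h1 : `|y - x| < r.
    rewrite -(subrKA x'); apply: le_lt_trans (ler_normD _ _) _; lra.
  have h2 : `|x' - x| < r by lra.
  exact: dist_le_half (rP _ h1 i j) (rP _ h2 i j).
have d2 : 0 < delta / 2 by lra.
exists (delta / 2) => // x y xr yx i j.
apply: (H (delta / 2)) => //=.
by rewrite sub0r normrN gtr0_norm//; lra.
Qed.

Lemma jacobian_bounded (rho : R) : exists2 M : R, 0 < M &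
  forall x, `|x| <= rho -> forall i j, `|'J F x i j| <= M.
Proof.
have /compact_near_coveringP cK := @compact_closed_ball0 rho.
have := cK R +oo
  (fun (M : R) x => forall i j, `|'J F x i j| <= M) _.
case=> [x _|M [Mreal H]].
  have [r r0 rP] := jacobian_near x ltr01.
  pose B := 1 + \sum_i \sum_j `|'J F x i j|.
  exists ([set x' | `|x' - x| < r], [set M | B < M]).
    split=> /=; last by apply: nbhs_pinfty_gt; exact: num_real.
    exact: near_dist_lt.
  move=> [x' M] [/= xx' BM] i j; apply: le_trans (ltW BM).
  have h : `|'J F x i j| <= \sum_i \sum_j `|'J F x i j|.
    rewrite (bigD1 i)//= (bigD1 j)//= -addrA lerDl addr_ge0//.
      by apply: sumr_ge0.
    by apply: sumr_ge0 => k _; apply: sumr_ge0.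
  exact: norm_le_dist (rP _ xx' i j) h.
exists (Num.max M 0 + 1); first by rewrite ltr_pwDr// le_max lexx orbT.
move=> x xr i j; apply: (H (Num.max M 0 + 1)) => //.
by rewrite ltr_pwDr// le_max lexx.
Qed.

(** The intermediate point depends on the coordinate [j], as no common one exists for vector-valued
    maps; the later estimates are therefore made coordinate by coordinate. *)
Lemma mean_value x y j : exists2 z, `|z - x| <= `|y - x| &
  (F y - F x) 0 j = ((y - x) *m 'J F z) 0 j.
Proof.
have [dF _] := F1.
pose l (s : R) := x + s *: (y - x).
have Dl s : is_derive s (1 : R) l (y - x).
  apply/is_derive_coordP => i.
  have -> : (fun r => l r 0 i) = (fun r => x 0 i + r * (y - x) 0 i).
    by apply/funext => r; rewrite /l mxE [in X in _ + X]mxE.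
  by apply: is_derive_eq; rewrite /GRing.scale /=; ring.
have DFl s : is_derive s (1 : R) (F \o l) ((y - x) *m 'J F (l s)).
  exact: (is_derive_comp_rV (Dl s) (dF _)).
have Dj (s : R) : s \in `]0, 1[ ->
    is_derive s (1 : R) (fun s => F (l s) 0 j) (((y - x) *m 'J F (l s)) 0 j).
  by move=> _; have /is_derive_coordP := DFl s; apply.
have [|c c01] := MVT ltr01 Dj.
  apply: continuous_subspaceT => s; apply: (@continuous_coord _ _ _ (F \o l)) => r.
  apply: differentiable_continuous; apply/derivable1_diffP.
  by have [] := DFl r.
rewrite /l scale1r scale0r addr0 [x + (y - x)]addrC subrK subr0 mulr1 => E.
exists (l c); last by rewrite !mxE in E *; rewrite E.
rewrite /l addrAC subrr add0r normrZ ler_piMl//.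
by move: c01; rewrite in_itv /= => /andP[? ?]; rewrite ger0_norm ltW.
Qed.

Lemma remainder_lipschitz (rho eta : R) : 0 < eta ->
  exists2 delta : R, 0 < delta & forall x y1 y2 : 'rV[R]_N, `|x| <= rho ->
    `|y1| <= delta -> `|y2| <= delta ->
    `|F (x + y1) - F (x + y2) - (y1 - y2) *m 'J F x| <= eta * `|y1 - y2|.
Proof.
move=> eta0; pose c := eta / (N%:R + 1).
have N1 : 0 < N%:R + 1 :> R by rewrite ltr_wpDl.
have c0 : 0 < c by rewrite divr_gt0.
have [delta delta0 dP] := jacobian_unif rho c0.
have d3 : 0 < delta / 3 by lra.
exists (delta / 3) => // x y1 y2 xr y1d y2d.
apply: norm_le_coord; first by rewrite mulr_ge0// ltW.
move=> j; have [z zx E] := mean_value (x + y2) (x + y1) j.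
have yy : x + y1 - (x + y2) = y1 - y2 by rewrite opprD addrACA subrr add0r.
rewrite yy in zx E.
have -> : (F (x + y1) - F (x + y2) - (y1 - y2) *m 'J F x) 0 j
    = ((y1 - y2) *m ('J F z - 'J F x)) 0 j.
  by rewrite mulmxBr [LHS]mxE E [RHS]mxE.
apply: le_trans (coord_le_norm _ _) _.
have zd : `|z - x| <= delta.
  have zE : z - (x + y2) + y2 = z - x by rewrite opprD addrA subrK.
  have := ler_normD (z - (x + y2)) y2; rewrite zE.
  have := ler_normB y1 y2; lra.
have H i k : `|('J F z - 'J F x) i k| <= c.
  by have := dP _ _ xr zd i k; rewrite [in X in _ -> `|X|
    <= _]mxE [X in _ -> `|_ + X| <= _]mxE.
apply: le_trans (norm_mulmx_entries _ (ltW c0) H) _.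
by rewrite ler_wpM2r// /c mulrA ler_pdivrMr// mulrDr mulr1 [N%:R * _]mulrC lerDl ltW.
Qed.

Lemma jacobian_bound (rho : R) : exists2 M : R, 0 < M &
  forall x y : 'rV[R]_N, `|x| <= rho -> `|y *m 'J F x| <= M * `|y|.
Proof.
have [M M0 MP] := jacobian_bounded rho.
exists (N%:R * M + 1); first by rewrite ltr_wpDl// mulr_ge0// ltW.
move=> x y xr; apply: le_trans (norm_mulmx_entries _ (ltW M0) (MP x xr)) _.
by rewrite ler_wpM2r// lerDl.
Qed.

Lemma jacobian_close e (eta : R) : 0 < eta -> exists2 delta : R, 0 < delta &
  forall x y : 'rV[R]_N, `|x - e| <= delta -> `|y *m ('J F x - 'J F e)| <= eta * `|y|.
Proof.
move=> eta0; pose c := eta / (N%:R + 1).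
have N1 : 0 < N%:R + 1 :> R by rewrite ltr_wpDl.
have c0 : 0 < c by rewrite divr_gt0.
have [delta delta0 dP] := jacobian_unif `|e| c0.
exists delta => // x y xe.
have H i j : `|('J F x - 'J F e) i j| <= c.
  by have := dP e x (lexx _) xe i j;
    rewrite [in X in _ -> `|X| <= _]mxE [X in _ -> `|_ + X| <= _]mxE.
apply: le_trans (norm_mulmx_entries _ (ltW c0) H) _.
by rewrite ler_wpM2r// /c mulrA ler_pdivrMr// mulrDr mulr1 [N%:R * _]mulrC lerDl ltW.
Qed.

Lemma local_lipschitz (rho : R) : exists2 L : R, 0 < L &
  forall x y : 'rV[R]_N, `|x| <= rho -> `|y| <= rho -> `|F x - F y| <= L * `|x - y|.
Proof.
(* The intermediate point lies within [|x - y| <= 2 * rho] of [y], hence in the ball of radius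
   [3 * rho]. *)
have [M M0 MP] := jacobian_bound (3 * rho).
exists M => // x y xr yr; apply: norm_le_coord.
  by rewrite mulr_ge0// ltW.
move=> j; have [z zx ->] := mean_value y x j.
apply: le_trans (coord_le_norm _ _) _; apply: MP.
have := ler_normD (z - y) y; rewrite subrK.
have := ler_normB x y; lra.
Qed.

End ContinuouslyDifferentiable.

(** * Forward orbits on the closed half-line and their uniqueness *)

Section ForwardSolutions.
Variables (R : realType) (N : nat).
Implicit Types (F : 'rV[R]_N -> 'rV[R]_N) (e p : 'rV[R]_N).
Implicit Types (phi psi : R -> 'rV[R]_N).

Lemma interior_ray (t : R) : interior (`[0, +oo[%classic : set R) t <-> 0 < t.
Proof. by rewrite interior_itv_bndy /= in_itv /= andbT. Qed.

Lemma continuous_posP phi :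
  {within (`[0, +oo[%classic : set R), continuous phi} <-> continuous (phi \o @pos R).
Proof.
split=> [/subspace_continuousP cphi t|cphi].
  have A : (`[0, +oo[%classic : set R) (pos t) by rewrite /= in_itv /= andbT pos_ge0.
  have PA : pos s @[s --> t] --> within (`[0, +oo[%classic : set R) (nbhs (pos t)).
    move=> U HU.
    have HU' : \forall s \near t, (`[0, +oo[%classic : set R) (pos s) -> U (pos s).
      exact: (@continuous_pos R t _ HU).
    change (\forall s \near t, U (pos s)); near=> s.
    by apply: (near HU' s) => //; rewrite /= in_itv /= andbT pos_ge0.
  by have := cvg_comp _ _ PA (cphi _ A).
apply/subspace_continuousP => t; rewrite /= in_itv /= andbT => t0.
have := cphi t; rewrite /continuous_at /= pos_id// => H.
have : phi (pos s) @[s --> within (`[0, +oo[%classic : set R) (nbhs t)] --> phi t.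
  by apply: cvg_trans H; apply: cvg_app; exact: cvg_within.
apply: cvg_trans; apply: near_eq_cvg.
rewrite near_withinE; near=> s => /=; rewrite in_itv /= andbT => s0.
by rewrite pos_id.
Unshelve. all: by end_near. Qed.

Lemma solution_posP F phi : solution F `[0, +oo[ phi <->
  continuous (phi \o @pos R) /\
  forall t : R, 0 < t -> is_derive t (1 : R) (phi \o @pos R) (F ((phi \o @pos R) t)).
Proof.
rewrite /solution continuous_posP; split=> -[c D]; split=> // t.
  move=> t0; apply/is_derive_pos => //=; rewrite pos_id ?(ltW t0)//.
  by apply: D; apply/interior_ray.
move=> /interior_ray t0; have := D t t0 => /=; rewrite pos_id ?(ltW t0)//.
by move=> ?; apply/is_derive_pos.
Qed.

Lemma cvg_posP phi e :
  phi t @[t --> +oo] --> e <-> (phi \o @pos R) t @[t --> +oo] --> e.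
Proof.
split; apply: cvg_trans; apply: near_eq_cvg; near=> t; rewrite /= pos_id//;
  by near: t; exact: nbhs_pinfty_ge.
Unshelve. all: by end_near. Qed.

Lemma continuous_bounded_segment phi (T : R) : continuous phi ->
  exists M, forall t, 0 <= t <= T -> `|phi t| <= M.
Proof.
move=> cphi; have [T0|T0] := leP 0 T; last first.
  by exists 0 => t /andP[t0 tT]; move: (lt_le_trans T0 (le_trans t0 tT)); rewrite ltxx.
have cn : {within `[0, T], continuous (fun t => `|phi t|)}.
  apply: continuous_subspaceT => t; apply: continuous_comp; first exact: cphi.
  exact: norm_continuous.
have [c _ cP] := EVT_max T0 cn.
by exists `|phi c| => t tT; apply: cP; rewrite in_itv.
Qed.

Lemma continuous_cvg_bounded phi e : continuous phi -> phi t @[t --> +oo] --> e ->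
  exists M, forall t, 0 <= t -> `|phi t| <= M.
Proof.
move=> cphi /cvgrPdist_le/(_ 1 ltr01)[T [_ HT]].
have [M MP] := continuous_bounded_segment T cphi.
exists (Num.max M (1 + `|e|)) => t t0; rewrite le_max.
have [tT|Tt] := leP t T; first by rewrite MP// t0.
have := HT t Tt; have := ler_normB e (e - phi t); rewrite opprB addrC subrK /=.
by move=> h1 h2; apply/orP; right; lra.
Qed.

Lemma forward_unique F phi psi : C1 F ->
  solution F `[0, +oo[ phi -> solution F `[0, +oo[ psi -> phi 0 = psi 0 ->
  forall t, 0 <= t -> phi t = psi t.
Proof.
move=> F1 /solution_posP[c1 D1] /solution_posP[c2 D2] E T T0.
have [M1 b1] := continuous_bounded_segment T c1.
have [M2 b2] := continuous_bounded_segment T c2.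
have [L L0 FL] := local_lipschitz F1 (Num.max M1 M2).
have [C C0 CP] := gronwall_bound N T (ltW L0).
pose x t := (phi \o @pos R) t - (psi \o @pos R) t.
have := CP x (fun t => F ((phi \o @pos R) t) - F ((psi \o @pos R) t)) T0.
have cx : continuous x by move=> t; apply: cvgB; [exact: c1|exact: c2].
move=> /(_ cx); rewrite /x /= !pos_id// E subrr normr0 mulr0 => H.
apply/eqP; rewrite -subr_eq0 -normr_le0; apply: H => t /andP[t0 tT].
  have E1 := D1 t t0; have E2 := D2 t t0.
  exact: is_deriveB.
have tT' : 0 <= t <= T by rewrite !ltW.
by apply: FL; rewrite le_max ?(b1 t tT') ?(b2 t tT') ?orbT.
Qed.

Lemma is_derive_dist_le (V : normedModType R) (x : R -> V) (t : R) v :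
  is_derive t (1 : R) x v <-> forall eta : R, 0 < eta -> exists2 delta : R, 0 < delta &
    forall s, `|s| < delta -> `|x (t + s) - x t - s *: v| <= eta * `|s|.
Proof.
split=> [[Dx xv] eta eta0|H].
  have : (fun s => s^-1 *: (x (s *: 1 + t) - x t)) @ 0^' --> v.
    by rewrite -xv; exact: Dx.
  move=> /cvgrPdist_le/(_ _ eta0)/nbhs_ballP[delta /= delta0 dP].
  exists delta => // s sd; have [->|s0] := eqVneq s 0.
    by rewrite addr0 subrr scale0r subr0 !normr0 mulr0.
  have := dP s; rewrite /ball /= sub0r normrN => /(_ sd s0) h.
  rewrite (_ : _ - _ - _ = (- s) *: (v - s^-1 *: (x (s *: 1 + t) - x t))).
    by rewrite normrZ normrN mulrC ler_wpM2r.
  rewrite scalerBr scalerA mulNr mulfV// scaleN1r scaleNr opprK addrC [s *: 1]mulr1.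
  by rewrite [s + t]addrC addrC.
have D : (fun s => s^-1 *: (x (s *: 1 + t) - x t)) @ 0^' --> v.
  apply/cvgrPdist_le => eta eta0; have [delta delta0 dP] := H _ eta0.
  apply/nbhs_ballP; exists delta => //= s; rewrite /ball /= sub0r normrN => sd s0.
  have := dP s sd; rewrite [s *: 1]mulr1 [s + t]addrC => h.
  rewrite (_ : v - _ = - (s^-1 *: (x (t + s) - x t - s *: v))).
    by rewrite normrN normrZ normfV ler_pdivrMl ?normr_gt0// mulrC.
  by rewrite [in RHS]scalerBr scalerA mulVf// scale1r opprB.
by apply: DeriveDef; [apply/cvg_ex; exists v|exact: cvg_lim].
Qed.

End ForwardSolutions.

(** * The stable manifold theorem along an orbit *)

Section NonautonomousDichotomy.
Variables (R : realType) (N : nat) (d : 'rV[R]_N).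
Variables (B : R -> 'M[R]_N) (g : R -> 'rV[R]_N -> 'rV[R]_N).
Variables (T L0 eps : R).
Hypotheses (T0 : 0 <= T) (L00 : 0 <= L0) (eps0 : 0 < eps).
Hypothesis d_eps : forall i, 4 * eps <= `|d 0 i|.
Hypothesis B_bound : forall (t : R) (x : 'rV[R]_N), 0 <= t -> `|x *m B t| <= L0 * `|x|.
Hypothesis B_small : forall (t : R) (x : 'rV[R]_N),
  T <= t -> `|x *m B t| <= eps / 2 * `|x|.
Hypothesis B_cont : forall x : R -> 'rV[R]_N, continuous x ->
  continuous (fun t => x t *m B t).
Hypothesis g_cont : forall x : R -> 'rV[R]_N, continuous x ->
  continuous (fun t => g t (x t)).
Hypothesis g0 : forall t : R, 0 <= t -> g t 0 = 0.
Hypothesis g_rem : forall eta : R, 0 < eta -> exists2 delta : R, 0 < delta &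
  forall (t : R) (x y : 'rV[R]_N), 0 <= t -> `|x| <= delta -> `|y| <= delta ->
    `|g t x - g t y - (x - y) *m B t| <= eta * `|x - y|.

Definition linear_solution (x : R -> 'rV[R]_N) :=
  [/\ continuous x,
      forall t : R, 0 < t -> is_derive t (1 : R) x (x t *m diag_mx d + x t *m B t) &
      exists M, forall t : R, 0 <= t -> `|x t| <= M].

Definition nonlinear_solution (x : R -> 'rV[R]_N) :=
  continuous x /\
  forall t : R, 0 < t -> is_derive t (1 : R) x (x t *m diag_mx d + g t (x t)).

(** Lipschitz constant of [g] before [T]: [L0] from its linear part [B], [eps / 2] from the
    remainder. After [T] both parts take [eps / 2] each. The bound [4 * eps] on the eigenvalues
    leaves room for the decay rate [alpha = 2 * eps]. *)
Let L := L0 + eps / 2.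
Let K := \sum_i `|d 0 i| + 2 * L.

Let L_ge0 : 0 <= L. Proof. by rewrite /L addr_ge0// ltW// divr_gt0. Qed.

Let d_K i : `|d 0 i| + 2 * L <= K.
Proof. by rewrite /K lerD2r (bigD1 i)//= lerDl sumr_ge0. Qed.

Let K_ge0 : 0 <= K.
Proof. by rewrite /K addr_ge0 ?mulr_ge0// sumr_ge0. Qed.

Let eps_half : 0 <= eps / 2. Proof. by rewrite ltW// divr_gt0. Qed.

Definition dichotomy_const := expR (K * T).

Lemma dichotomy_const_gt0 : 0 < dichotomy_const. Proof. exact: expR_gt0. Qed.

Lemma linear_exists (xi : 'rV[R]_N) : exists2 x : R -> 'rV[R]_N,
  linear_solution x & forall i, d 0 i < 0 -> x T 0 i = xi 0 i.
Proof.
have e0 := eps0.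
have [] := @lp_exists R N d K 0 T L eps (2 * `|xi| * expR (K * T))
    T0 L_ge0 eps0 (lexx _) _ d_K K_ge0 (fun t x => x *m B t) xi B_cont.
- by move=> i; rewrite add0r; apply: (le_trans _ (d_eps i)); lra.
- by move=> t _; rewrite mul0mx.
- move=> t x y /andP[t0 _] _ _; rewrite -mulmxBl; apply: le_trans (B_bound _ t0) _.
  by rewrite ler_wpM2r// /L lerDl.
- move=> t x y Tt _ _; rewrite -mulmxBl; apply: le_trans (B_small _ Tt) _.
  by rewrite ler_wpM2r//; lra.
- by [].
move=> x [cx Dx xT xw]; exists x => //; split=> //.
exists (2 * `|xi| * expR (K * T)) => t t0; apply: le_trans (xw t t0) _.
by rewrite ler_wpM2l ?mulr_ge0// lp_weight_le.
Qed.

Lemma linear_unique (x : R -> 'rV[R]_N) : linear_solution x ->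
  (forall i, d 0 i < 0 -> x T 0 i = 0) -> forall t : R, 0 <= t -> x t = 0.
Proof.
have e0 := eps0.
move=> [cx Dx xM] xT t t0.
apply/eqP; rewrite -normr_le0 -(mul0r (lp_weight K 0 T t)) -[X in X * _](mulr0 2) -[X
  in X * _]addr0.
apply: (@lp_bound _ _ d K T L eps 0 0 x (fun t => x t *m B t)) => //.
- by move=> i; apply: (le_trans _ (d_eps i)); lra.
- move=> s /andP[s0 sT]; rewrite mul0r addr0; apply: le_trans (B_bound _ (ltW s0)) _.
  by rewrite ler_wpM2r// /L lerDl.
- move=> s Ts; rewrite mul0r addr0; apply: le_trans (B_small _ (ltW Ts)) _.
  by rewrite ler_wpM2r//; lra.
- by move=> i /xT ->; rewrite normr0.
Qed.

Lemma linear_solution_sum k (c : 'I_k -> R) (x : 'I_k -> R -> 'rV[R]_N) :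
  (forall a, linear_solution (x a)) ->
  linear_solution (fun t => \sum_a c a *: x a t).
Proof.
move=> xs; split.
- move=> t; apply: (@cvg_sumr _ _ _ (nbhs_filter t)) => a.
  by apply: cvgZ; [exact: cvg_cst|have [+ _ _] := xs a; apply].
- move=> t t0.
  have -> : (fun s => \sum_a c a *: x a s) = \sum_a (fun s => c a *: x a s).
    by apply/funext => s; rewrite fct_sumE.
  have H a : is_derive t (1 : R) (fun s => c a *: x a s)
      (c a *: (x a t *m diag_mx d + x a t *m B t)).
    by have [_ /(_ t t0) D _] := xs a; exact: is_deriveZ.
  apply: is_derive_eq.
  rewrite !mulmx_suml -big_split/=; apply: eq_bigr => a _.
  by rewrite scalerDr !scalemxAl.
- have /choice[M MP] : forall a, exists M, forall t : R, 0 <= t -> `|x a t| <= M.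
    by move=> a; have [] := xs a.
  exists (\sum_a `|c a| * M a) => t t0.
  apply: le_trans (ler_norm_sum _ _ _) _; apply: ler_sum => a _.
  by rewrite normrZ ler_wpM2l// MP.
Qed.

(** Here [alpha = 2 * eps]: the weight then decays exponentially after [T], so the solution tends to
    0 and yields an orbit on the stable manifold. The linear equation needs boundedness only and
    uses [alpha = 0]. *)
Lemma nonlinear_exists : exists2 s : R, 0 < s & forall xi : 'rV[R]_N, `|xi| <= s ->
  exists x : R -> 'rV[R]_N,
  [/\ nonlinear_solution x,
      forall i, d 0 i < 0 -> x T 0 i = xi 0 i,
      forall t : R, 0 <= t -> `|x t| <= 2 * `|xi| * dichotomy_const &
      x t @[t --> +oo] --> (0 : 'rV[R]_N)].
Proof.
have e0 := eps0.
have e20 : 0 < eps / 2 by rewrite divr_gt0.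
have [delta delta0 dP] := g_rem e20.
have gL l t x y : `|(x - y) *m B t| <= l * `|x - y| ->
    `|g t x - g t y - (x - y) *m B t| <= eps / 2 * `|x - y| ->
    `|g t x - g t y| <= (l + eps / 2) * `|x - y|.
  move=> h1 h2; rewrite -[g t x - g t y](subrK ((x - y) *m B t)).
  by apply: le_trans (ler_normD _ _) _; rewrite addrC mulrDl lerD.
have W0 := dichotomy_const_gt0.
exists (delta / 2 / dichotomy_const); first by rewrite !divr_gt0.
move=> xi xis.
have xid : 2 * `|xi| * expR (K * T) <= delta.
  by move: xis; rewrite ler_pdivlMr// ler_pdivlMr// /dichotomy_const; lra.
have [] := @lp_exists R N d K (2 * eps) T L eps delta
    T0 L_ge0 eps0 _ _ d_K K_ge0 g xi g_cont g0 _ _ xid.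
- by rewrite mulr_ge0// ltW.
- by move=> i; apply: (le_trans _ (d_eps i)); lra.
- move=> t x y /andP[t0 _] xd yd; apply: gL; first exact: B_bound.
  exact: dP.
- move=> t x y Tt xd yd; rewrite [X in X * _](splitr eps); apply: gL;
  first exact: B_small.
  by apply: dP => //; exact: le_trans T0 Tt.
move=> x [cx Dx xT xw]; exists x; split=> //.
  move=> t t0; apply: le_trans (xw t t0) _.
  by rewrite ler_wpM2l ?mulr_ge0// lp_weight_le// mulr_ge0// ltW.
apply/cvgr0Pnorm_lt => eta eta0.
pose c := 2 * `|xi| + 1.
have c0 : 0 < c by rewrite ltr_wpDl// mulr_ge0.
near=> t.
have tT : T <= t by near: t; apply: nbhs_pinfty_ge; exact: num_real.
apply: le_lt_trans (xw t (le_trans T0 tT)) _.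
rewrite lp_weight_right//.
apply: (@le_lt_trans _ _ (c * expR (- (2 * eps) * (t - T)))).
  by rewrite ler_wpM2r ?expR_ge0// /c lerDl.
rewrite mulNr expRN -ltr_pdivlMl// invf_plt ?posrE ?expR_gt0 ?mulr_gt0 ?invr_gt0//.
apply: lt_le_trans (expR_ge1Dx _).
suff : (c^-1 * eta)^-1 / (2 * eps) < t - T.
  by rewrite ltr_pdivrMr ?mulr_gt0// => h; lra.
rewrite ltrBrDr; near: t; apply: nbhs_pinfty_gt; exact: num_real.
Unshelve. all: by end_near. Qed.

(** As [tau] is arbitrary, the error is o(r): this expresses that the solution depends
    differentiably, at 0, on its stable coordinates at [T], with the linear solutions as
    derivative. *)
Lemma nonlinear_compare (tau : R) : 0 < tau -> exists2 s : R, 0 < s &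
  forall (x y : R -> 'rV[R]_N) (r : R), nonlinear_solution x ->
    (forall t : R, 0 <= t -> `|x t| <= s) ->
    (forall i, d 0 i < 0 -> `|x T 0 i| <= r) -> 0 <= r ->
    linear_solution y -> (forall i, d 0 i < 0 -> y T 0 i = x T 0 i) ->
    forall t : R, 0 <= t -> `|x t - y t| <= tau * r * dichotomy_const.
Proof.
have e0 := eps0.
(* The first bound keeps the total Lipschitz constants at [L] and [eps], so that [|x| <= 2 * r * w].
   With the second, the remainder is at most [eps / 2 * (tau * r * w)], an admissible forcing for
   the difference [x - y]. *)
move=> tau0; pose eta := Num.min (eps / 2) (tau * eps / 4).
have eta0 : 0 < eta by rewrite lt_min !divr_gt0// mulr_gt0.
have eta1 : eta <= eps / 2 by rewrite ge_min lexx.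
have eta2 : eta <= tau * eps / 4 by rewrite ge_min lexx orbT.
have [delta delta0 dP] := g_rem eta0.
exists delta => // x y r [cx Dx] xd xT r0 [cy Dy yM] yT.
have gB t : 0 <= t -> `|g t (x t) - x t *m B t| <= eta * `|x t|.
  move=> t0; have := dP t (x t) 0 t0 (xd t t0).
  by rewrite normr0 g0// !subr0; apply; exact: ltW.
have gx t : 0 <= t -> `|g t (x t)| <= `|x t *m B t| + eps / 2 * `|x t|.
  move=> t0; have := ler_normD (g t (x t) - x t *m B t) (x t *m B t).
  rewrite subrK => h; apply: le_trans h _; rewrite addrC lerD2l.
  by apply: le_trans (gB t t0) _; rewrite ler_wpM2r.
have hd i : 2 * eps <= `|d 0 i| by apply: (le_trans _ (d_eps i)); lra.
have xw t : 0 <= t -> `|x t| <= 2 * r * lp_weight K 0 T t.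
  rewrite -[X in _ <= X * _]addr0.
  apply: (@lp_bound _ _ d K T L eps 0 r x (fun t => g t (x t))) => //.
  - move=> s /andP[s0 sT]; rewrite mul0r addr0; apply: le_trans (gx s (ltW s0)) _.
    by rewrite /L mulrDl lerD2r B_bound// ltW.
  - move=> s Ts; rewrite mul0r addr0.
    apply: le_trans (gx s (le_trans T0 (ltW Ts))) _.
    by rewrite [X in _ <= X * _](splitr eps) mulrDl lerD2r B_small// ltW.
  - by exists delta.
have w0 t := lp_weight_gt0 K 0 T t.
have tr0 : 0 <= tau * r by rewrite mulr_ge0// ltW.
have split_rhs t : (x t *m diag_mx d + g t (x t)) - (y t *m diag_mx d + y t *m B t) =
    (x t - y t) *m diag_mx d + ((x t - y t) *m B t + (g t (x t) - x t *m B t)).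
  rewrite !mulmxBl opprD addrACA; congr (_ + _).
  by rewrite [RHS]addrC addrA subrK.
have rem t : 0 <= t -> `|g t (x t) - x t *m B t|
  <= eps / 2 * (tau * r * lp_weight K 0 T t).
  move=> t0; apply: le_trans (gB t t0) _;
    apply: le_trans (ler_wpM2l (ltW eta0) (xw t t0)) _.
  have : 0 <= (tau * eps / 4 - eta) * (2 * r * lp_weight K 0 T t).
    by rewrite mulr_ge0 ?subr_ge0// mulr_ge0 ?mulr_ge0// ltW.
  lra.
have H t : 0 <= t -> `|x t - y t| <= (2 * 0 + tau * r) * lp_weight K 0 T t.
  apply: (@lp_bound _ _ d K T L eps (tau * r) 0 (fun t => x t - y t)
    (fun t => (x t - y t) *m B t + (g t (x t) - x t *m B t))) => //.
  - by move=> s; apply: cvgB; [exact: cx|exact: cy].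
  - by move=> s s0; have D1 := Dx s s0; have D2 := Dy s s0; rewrite -split_rhs;
    exact: is_deriveB.
  - move=> s /andP[s0 sT]; apply: le_trans (ler_normD _ _) _; rewrite mulrDr lerD//.
      apply: le_trans (B_bound _ (ltW s0)) _.
      by rewrite ler_wpM2r// /L lerDl.
    apply: le_trans (rem s (ltW s0)) _; rewrite ler_wpM2r ?mulr_ge0 ?(ltW (w0 _))//.
      by rewrite ltW.
    by rewrite /L lerDr.
  - move=> s Ts; have s0 := le_trans T0 (ltW Ts).
    apply: le_trans (ler_normD _ _) _; rewrite mulrDr lerD//.
      by apply: le_trans (B_small _ (ltW Ts)) _; rewrite ler_wpM2r//; lra.
    apply: le_trans (rem s s0) _; rewrite ler_wpM2r ?mulr_ge0 ?(ltW (w0 _))//;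
      last by lra.
    by rewrite ltW.
  - by move=> i di; rewrite !mxE yT// subrr normr0.
  - have [M MP] := yM; exists (delta + M) => s s0.
    by apply: le_trans (ler_normB _ _) _; rewrite lerD ?xd ?MP.
move=> t t0; apply: le_trans (H t t0) _.
by rewrite mulr0 add0r ler_wpM2l// lp_weight_le.
Qed.

(** Stable coordinates are prescribed at [T], tangent vectors are read off at time 0; this estimate
    links the two times. *)
Lemma linear_forward_bound : exists2 C : R, 0 < C &
  forall x, linear_solution x -> `|x T| <= C * `|x 0|.
Proof.
have S0 : 0 <= \sum_i `|d 0 i| by apply: sumr_ge0.
have c0 : 0 <= N%:R * (\sum_i `|d 0 i|) + L0 by rewrite addr_ge0// mulr_ge0.
have [C C0 CP] := gronwall_bound N T c0.
exists C => // x [cx Dx _].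
apply: (CP x (fun t => x t *m diag_mx d + x t *m B t)) => // t /andP[t0 tT].
  exact: Dx.
apply: le_trans (ler_normD _ _) _; rewrite mulrDl lerD ?B_bound ?(ltW t0)//.
apply: norm_mulmx_entries => // i j; rewrite mxE; case: eqP => [->|_].
  by rewrite mulr1n (bigD1 j)//= lerDl sumr_ge0.
by rewrite mulr0n normr0.
Qed.

Lemma nonlinear_forward_bound : exists C s : R, [/\ 0 < C, 0 < s &
  forall x, nonlinear_solution x -> (forall t : R, 0 <= t -> `|x t| <= s) ->
    `|x T| <= C * `|x 0|].
Proof.
have [delta delta0 dP] := g_rem ltr01.
have S0 : 0 <= \sum_i `|d 0 i| by apply: sumr_ge0.
have c0 : 0 <= N%:R * (\sum_i `|d 0 i|) + (L0 + 1)
  by rewrite addr_ge0 ?mulr_ge0// addr_ge0.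
have [C C0 CP] := gronwall_bound N T c0.
exists C, delta; split=> // x [cx Dx] xd.
apply: (CP x (fun t => x t *m diag_mx d + g t (x t))) => // t /andP[t0 tT].
  exact: Dx.
apply: le_trans (ler_normD _ _) _; rewrite mulrDl lerD//; last first.
  rewrite -[g t (x t)](subrK (x t *m B t)); apply: le_trans (ler_normD _ _) _.
  rewrite addrC mulrDl lerD ?B_bound ?(ltW t0)//.
  have := dP t (x t) 0 (ltW t0) (xd t (ltW t0)).
  by rewrite normr0 g0 ?(ltW t0)// !subr0; apply; exact: ltW.
apply: norm_mulmx_entries => // i j; rewrite mxE; case: eqP => [->|_].
  by rewrite mulr1n (bigD1 j)//= lerDl sumr_ge0.
by rewrite mulr0n normr0.
Qed.

End NonautonomousDichotomy.

(** * Tangent space of the stable manifold at the start of an orbit *)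

Section StableManifold.
Variables (R : realType) (N : nat).

Definition variational_solution (F : 'rV[R]_N -> 'rV[R]_N) (phi W : R -> 'rV[R]_N) :=
  [/\ continuous W,
      forall t : R, 0 < t -> is_derive t (1 : R) W (W t *m 'J F (phi t)) &
      exists M, forall t : R, 0 <= t -> `|W t| <= M].

Definition variational_space F phi : set 'rV[R]_N :=
  [set w | exists2 W, variational_solution F phi W & W 0 = w].

Lemma subspace_of_rows k (M : 'M[R]_(k, N)) :
  (forall z : 'rV_k, z *m M = 0 -> z = 0) ->
  subspace_of_dim [set w | exists z : 'rV_k, w = z *m M] k.
Proof.
move=> Mfree; exists (limg (linfun (mulmxr M : 'rV_k -> 'rV_N))).
  apply/seteqP; split=> [w /= [z ->]|w /= /memv_imgP[z _ ->]].
    by apply/memv_imgP; exists z; rewrite ?memvf// lfunE.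
  by exists z; rewrite lfunE.
have := limg_ker_dim (linfun (mulmxr M : 'rV_k -> 'rV_N)) fullv.
suff -> : lker (linfun (mulmxr M : 'rV_k -> 'rV_N)) = 0%VS.
  by rewrite capv0 dimv0 add0n dimvf /dim/= mul1n.
apply/eqP; rewrite -subv0; apply/subvP => z.
by rewrite memv_ker lfunE /= memv0 => /eqP/Mfree ->.
Qed.

(** The sum of the inverses takes the place of a minimum over the coordinates, and covers [N = 0] as
    well. *)
Lemma min_norm_gt0 (d : 'rV[R]_N) : (forall i, d 0 i != 0) ->
  exists2 eps : R, 0 < eps & forall i, 4 * eps <= `|d 0 i|.
Proof.
move=> d0; pose S := 1 + \sum_i `|d 0 i|^-1.
have S0 : 0 < S by rewrite ltr_pwDl// sumr_ge0// => i _; rewrite invr_ge0.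
exists (4 * S)^-1; first by rewrite invr_gt0 mulr_gt0.
move=> i; rewrite invfM mulrA mulfV ?mul1r//.
rewrite -[leRHS]invrK lef_pV2 ?posrE ?invr_gt0 ?normr_gt0//.
by rewrite /S (bigD1 i)//= addrCA lerDl addr_ge0// sumr_ge0// => j _; rewrite invr_ge0.
Qed.

Variables (F : 'rV[R]_N -> 'rV[R]_N) (e : 'rV[R]_N) (Q : 'M[R]_N) (d : 'rV[R]_N).
Hypotheses (F1 : C1 F) (Qu : Q \in unitmx).
Hypothesis FQ : 'J F e *m Q = Q *m diag_mx d.
Hypothesis d0 : forall i, d 0 i != 0.
Variable phi0 : R -> 'rV[R]_N.
Hypothesis phi0_stable : stable_orbit F e phi0.

Let phi := phi0 \o @pos R.
Let J t := 'J F (phi t).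
(** In the coordinates [x = (psi - phi) *m Q], the equation reads [x' = x *m diag_mx d + g t x], and
    [B t] is the derivative of [g t] at 0. It tends to 0, because [J t] tends to the diagonalised
    Jacobian at [e]. *)
Let B t := invmx Q *m J t *m Q - diag_mx d.
Let g t x := (F (phi t + x *m invmx Q) - F (phi t)) *m Q - x *m diag_mx d.

Let phi_cont : continuous phi.
Proof. by have [/solution_posP[]] := phi0_stable. Qed.

Let phi_der (t : R) : 0 < t -> is_derive t (1 : R) phi (F (phi t)).
Proof. by have [/solution_posP[_ D] _] := phi0_stable; exact: D. Qed.

Let phi_cvg : phi t @[t --> +oo] --> e.
Proof. by have [_ /cvg_posP] := phi0_stable. Qed.

Let phi_pos t : 0 <= t -> phi t = phi0 t.
Proof. by move=> t0; rewrite /phi /= pos_id. Qed.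

Let F_cont : continuous F.
Proof. have [dF _] := F1; move=> x; apply: differentiable_continuous; exact: dF. Qed.

Let continuous_mulJ (y : R -> 'rV[R]_N) : continuous y -> continuous (fun t =>
  y t *m J t).
Proof.
move=> cy; apply: continuous_coordP => j t.
have -> : (fun s => (y s *m J s) 0 j) = (fun s => \sum_i y s 0 i * J s i j).
  by apply/funext => s; rewrite mxE.
apply: (@cvg_sumr _ _ _ (nbhs_filter t)) => i; apply: cvgM.
  exact: continuous_coord.
apply: (@continuous_comp _ _ _ phi (fun x => 'J F x i j)); first exact: phi_cont.
exact: jacobian_continuous.
Qed.

Let continuous_mul k (M : 'M[R]_(N, k)) (y : R -> 'rV[R]_N) :
  continuous y -> continuous (fun t => y t *m M).
Proof.
move=> cy t; apply: (@continuous_comp _ _ _ y (fun x => x *m M)); first exact: cy.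
exact: continuous_mulmxr.
Qed.

Let mulB (x : 'rV[R]_N) t : x *m B t = x *m invmx Q *m J t *m Q - x *m diag_mx d.
Proof. by rewrite /B mulmxBr !mulmxA. Qed.

Let B_cont (x : R -> 'rV[R]_N) : continuous x -> continuous (fun t => x t *m B t).
Proof.
move=> cx.
have -> : (fun t => x t *m B t) = (fun t =>
  x t *m invmx Q *m J t *m Q - x t *m diag_mx d).
  by apply/funext => t; exact: mulB.
move=> t.
apply: cvgB; last exact: continuous_mul.
by apply: (continuous_mul (continuous_mulJ (continuous_mul cx))).
Qed.

Let g_cont (x : R -> 'rV[R]_N) : continuous x -> continuous (fun t => g t (x t)).
Proof.
move=> cx t; apply: cvgB; last exact: continuous_mul.
apply: (@continuous_mul _ _ (fun t => F (phi t + x t *m invmx Q) - F (phi t))) => s.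
apply: cvgB.
  apply: (@continuous_comp _ _ _ (fun s => phi s + x s *m invmx Q) F).
    by apply: cvgD; [exact: phi_cont|exact: continuous_mul].
  exact: F_cont.
by apply: (@continuous_comp _ _ _ phi F); [exact: phi_cont|exact: F_cont].
Qed.

Let g0 t : 0 <= t -> g t 0 = 0.
Proof. by move=> _; rewrite /g !mul0mx addr0 subrr mul0mx subr0. Qed.

Let phi_bounded : exists rho, forall t, 0 <= t -> `|phi t| <= rho.
Proof. exact: continuous_cvg_bounded phi_cvg. Qed.

Let g_rem (eta : R) : 0 < eta -> exists2 delta : R, 0 < delta &
  forall t (x y : 'rV[R]_N), 0 <= t -> `|x| <= delta -> `|y| <= delta ->
    `|g t x - g t y - (x - y) *m B t| <= eta * `|x - y|.
Proof.
move=> eta0; have [rho rhoP] := phi_bounded.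
have [cQ cQ0 cQP] := norm_mulmxr Q.
have [cI cI0 cIP] := norm_mulmxr (invmx Q).
have [|delta delta0 dP] := @remainder_lipschitz _ _ F F1 rho (eta / (cQ * cI)).
  by rewrite divr_gt0// mulr_gt0.
exists (delta / cI); first by rewrite divr_gt0.
move=> t x y t0; rewrite !ler_pdivlMr// => xd yd.
have -> : g t x - g t y - (x - y) *m B t =
  (F (phi t + x *m invmx Q) - F (phi t + y *m invmx Q)
    - (x *m invmx Q - y *m invmx Q) *m J t) *m Q.
  rewrite mulB /g !mulmxBl.
  set a1 := _ *m Q; set a2 := _ *m Q; set a3 := _ *m Q; set a4 := _ *m Q;
    set a5 := _ *m Q.
  set b1 := _ *m diag_mx d; set b2 := _ *m diag_mx d.
  apply/rowP => i; rewrite !mxE; ring.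
apply: le_trans (cQP _) _.
have := dP (phi t) (x *m invmx Q) (y *m invmx Q) (rhoP t t0).
rewrite mulrC in xd; rewrite mulrC in yd.
move=> /(_ (le_trans (cIP _) xd) (le_trans (cIP _) yd)).
rewrite -mulmxBl => h.
apply: le_trans (ler_wpM2l (ltW cQ0) h) _.
apply: le_trans (_ : cQ * (eta / (cQ * cI) * (cI * `|x - y|)) <= _).
  by rewrite ler_wpM2l ?(ltW cQ0)// ler_wpM2l ?cIP// divr_ge0 ?mulr_ge0 ?ltW.
rewrite le_eqVlt; apply/orP; left; apply/eqP; field.
by rewrite !gt_eqF.
Qed.

Let B_bounds (eps : R) : 0 < eps -> exists T L0 : R, [/\ 0 <= T, 0 <= L0,
  forall t (x : 'rV[R]_N), 0 <= t -> `|x *m B t| <= L0 * `|x| &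
  forall t (x : 'rV[R]_N), T <= t -> `|x *m B t| <= eps / 2 * `|x|].
Proof.
move=> eps0; have [rho rhoP] := phi_bounded.
have [cQ cQ0 cQP] := norm_mulmxr Q.
have [cI cI0 cIP] := norm_mulmxr (invmx Q).
have BE t (x : 'rV[R]_N) : x *m B t = x *m invmx Q *m (J t - 'J F e) *m Q.
  rewrite mulB mulmxBr mulmxBl; congr (_ - _).
  by rewrite -(mulmxA (x *m invmx Q) ('J F e) Q) FQ mulmxA mulmxKV.
have [M M0 MP] := jacobian_bound F1 (Num.max rho `|e|).
have [|delta delta0 dP] := @jacobian_close _ _ F F1 e (eps / 2 / (cQ * cI)).
  by rewrite !divr_gt0// mulr_gt0.
have /cvgrPdist_le/(_ _ delta0)[T0 [_ HT]] := phi_cvg.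
exists (Num.max T0 0 + 1), (cQ * (2 * M) * cI); split.
- by rewrite addr_ge0// le_max lexx orbT.
- by rewrite !mulr_ge0// ltW.
- move=> t x t0; rewrite BE; apply: le_trans (cQP _) _;
  rewrite -!mulrA ler_wpM2l ?(ltW cQ0)//.
  have h1 : `|phi t| <= Num.max rho `|e| by rewrite le_max rhoP.
  have h2 : `|e| <= Num.max rho `|e| by rewrite le_max lexx orbT.
  rewrite mulmxBr; apply: le_trans (ler_normB _ _) _.
  apply: le_trans (lerD (MP _ (x *m invmx Q) h1) (MP _ (x *m invmx Q) h2)) _.
  by rewrite -mulr2n mulr_natl lerMn2r/= ler_wpM2l// ltW.
- move=> t x Tt; rewrite BE; apply: le_trans (cQP _) _.
  have h := dP (phi t) (x *m invmx Q) _.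
  apply: le_trans (ler_wpM2l (ltW cQ0) (h _)) _.
    rewrite distrC; apply: HT; apply: lt_le_trans Tt.
    by rewrite ltr_pwDr// le_max lexx.
  apply: le_trans (_ : cQ * (eps / 2 / (cQ * cI) * (cI * `|x|)) <= _).
    by rewrite ler_wpM2l ?(ltW cQ0)// ler_wpM2l ?cIP// !divr_ge0 ?mulr_ge0 ?ltW.
  rewrite le_eqVlt; apply/orP; left; apply/eqP; field.
  by rewrite !gt_eqF.
Qed.

Let linear_variational (x : R -> 'rV[R]_N) : linear_solution d B x ->
  variational_solution F phi0 (fun t => x t *m invmx Q).
Proof.
move=> [cx Dx [M MP]]; split; first exact: continuous_mul.
  move=> t t0; have D := is_derive_mulmxr (invmx Q) (Dx t t0).
  have <- : (x t *m diag_mx d + x t *m B t) *m invmx Q = x t *m invmx Q *m 'J F (phi0 t).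
    by rewrite (mulB (x t) t) addrC subrK (mulmxK Qu) /J phi_pos// ltW.
  exact: D.
have [c c0 cP] := norm_mulmxr (invmx Q).
by exists (c * M) => t t0; apply: le_trans (cP _) _; rewrite ler_wpM2l ?(ltW c0) ?MP.
Qed.

Let variational_linear (W : R -> 'rV[R]_N) : variational_solution F phi0 W ->
  linear_solution d B (fun t => W t *m Q).
Proof.
move=> [cW DW [M MP]]; split; first exact: continuous_mul.
  move=> t t0; have D := is_derive_mulmxr Q (DW t t0).
  have -> : W t *m Q *m diag_mx d + W t *m Q *m B t = W t *m 'J F (phi0 t) *m Q.
    by rewrite (mulB (W t *m Q) t) addrC subrK (mulmxK Qu) /J phi_pos// ltW.
  exact: D.
have [c c0 cP] := norm_mulmxr Q.
by exists (c * M) => t t0; apply: le_trans (cP _) _; rewrite ler_wpM2l ?(ltW c0) ?MP.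
Qed.

Let orbit_nonlinear (psi : R -> 'rV[R]_N) : solution F `[0, +oo[ psi ->
  nonlinear_solution d g (fun t => ((psi \o @pos R) t - phi t) *m Q).
Proof.
move=> /solution_posP[cpsi Dpsi]; split.
  apply: (@continuous_mul _ _ (fun t => (psi \o @pos R) t - phi t)) => t.
  by apply: cvgB; [exact: cpsi|exact: phi_cont].
move=> t t0; have D1 := Dpsi t t0; have D2 := phi_der t0.
have D := is_derive_mulmxr Q (is_deriveB D1 D2).
set z := _ *m diag_mx d + _.
have -> : z = (F ((psi \o @pos R) t) - F (phi t)) *m Q.
  by rewrite /z /g (mulmxK Qu) [phi t + _]addrC subrK addrC subrK.
exact: D.
Qed.

Let nonlinear_orbit (x : R -> 'rV[R]_N) : nonlinear_solution d g x ->
  x t @[t --> +oo] --> (0 : 'rV[R]_N) ->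
  stable_orbit F e (fun t => (phi t + x t *m invmx Q)).
Proof.
move=> [cx Dx] x0.
have cpsi : continuous (fun t => phi t + x t *m invmx Q).
  by move=> t; apply: cvgD; [exact: phi_cont|exact: continuous_mul].
split; last first.
  rewrite -[e]addr0; apply: cvgD; first exact: phi_cvg.
  rewrite -(mul0mx _ (invmx Q)).
  exact: (continuous_cvg _ (@continuous_mulmxr _ _ _ (invmx Q) 0) x0).
apply/solution_posP; split.
  move=> t; apply: (@continuous_comp _ _ _ (@pos R) (fun t => phi t + x t *m invmx Q)).
    exact: continuous_pos.
  exact: cpsi.
move=> t t0; apply/is_derive_pos => //=; rewrite pos_id ?(ltW t0)//.
have D1 := phi_der t0; have D2 := Dx t t0.
have D := is_deriveD D1 (is_derive_mulmxr (invmx Q) D2).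
have -> : F (phi t + x t *m invmx Q)
    = F (phi t) + (x t *m diag_mx d + g t (x t)) *m invmx Q.
  by rewrite /g [x t *m diag_mx d + _]addrC subrK (mulmxK Qu) [F (phi t) + _]addrC subrK.
exact: D.
Qed.


Theorem stable_manifold :
  TWs F e (phi0 0) = variational_space F phi0 /\
  subspace_of_dim (variational_space F phi0) #|[pred i | d 0 i < 0]|.
Proof.
have [eps eps0 d_eps] := min_norm_gt0 d0.
have [T [L0 [T0 L00 B_bound B_small]]] := B_bounds eps0.
have lin_ex := linear_exists T0 L00 eps0 d_eps B_bound B_small B_cont.
have lin_un := linear_unique T0 L00 eps0 d_eps B_bound B_small.
have [CT CT0 CTP] := @linear_forward_bound _ _ d _ _ _ T0 L00 B_bound.
pose A := [pred i | d 0 i < 0]; pose k := #|A|.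
have iota_neg (a : 'I_k) : d 0 (enum_val a) < 0 by have := enum_valP a.
(* Bounded solutions whose stable coordinates at [T] are the unit vectors; their values at 0 become
   the rows of [M0]. *)
have /choice[X XP] : forall a : 'I_k, exists x, linear_solution d B x /\
    forall i, d 0 i < 0 -> x T 0 i = (enum_val a == i)%:R.
  move=> a; have [x xs xT] := lin_ex (delta_mx 0 (enum_val a)).
  by exists x; split=> // i /xT ->; rewrite mxE eqxx eq_sym.
have Xs a : linear_solution d B (X a) by have [] := XP a.
pose M0 := \matrix_a X a 0.
pose M1 := M0 *m invmx Q.
pose Y (z : 'rV_k) (t : R) := \sum_a z 0 a *: X a t.
have Ys z : linear_solution d B (Y z) by exact: linear_solution_sum.
have Y0 z : Y z (0 : R) = z *m M0.
  by rewrite mulmx_sum_row; apply: eq_bigr => a _; rewrite rowK.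
have YT z a : Y z T 0 (enum_val a) = z 0 a.
  rewrite /Y summxE (bigD1 a)//= mxE; have [_ ->//] := XP a.
  rewrite eqxx mulr1 big1 ?addr0// => b ba; rewrite mxE; have [_ ->//] := XP b.
  by rewrite (inj_eq enum_val_inj) (negPf ba) mulr0.
(* A combination vanishing at 0 vanishes at [T] by Gronwall, where its stable coordinates are those
   of [z]. *)
have M0_free (z : 'rV_k) : z *m M0 = 0 -> z = 0.
  move=> zM; have z0 : Y z 0 = 0 by exact: etrans (Y0 z) zM.
  have := CTP _ (Ys z); rewrite z0 normr0 mulr0 normr_le0 => /eqP YT0.
  by apply/rowP => a; rewrite -YT YT0 !mxE.
have span x : linear_solution d B x -> exists z : 'rV_k, x 0 = z *m M0.
  move=> xs; pose z : 'rV_k := \row_a x T 0 (enum_val a); exists z.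
  (* The difference [x - Y z] as a two-term combination, to which [linear_solution_sum] applies. Its
     stable coordinates at [T] are 0, so it vanishes by uniqueness. *)
  pose c (j : 'I_2) : R := if j == 0 then 1 else -1.
  pose xx (j : 'I_2) := if j == 0 then x else Y z.
  have xxs j : linear_solution d B (xx j) by rewrite /xx; case: ifP.
  have E t : \sum_j c j *: xx j t = x t - Y z t.
    by rewrite !big_ord_recl big_ord0 /c /xx /= scale1r scaleN1r addr0.
  apply/eqP; rewrite -subr_eq0 -Y0 -E; apply/eqP.
  apply: (lin_un _ (linear_solution_sum c xxs)) => // i di.
  have iA : i \in A by [].
  by rewrite E mxE [X in _ + X]mxE -(enum_rankK_in iA iA) YT mxE subrr.
have spaceE : variational_space F phi0 = [set w | exists z : 'rV_k, w = z *m M1].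
  apply/seteqP; split=> [w /= [W Ws <-]|w /= [z ->]].
    have [z zE] := span _ (variational_linear Ws).
    by exists z; rewrite /M1 mulmxA -zE (mulmxK Qu).
  exists (fun t => Y z t *m invmx Q); first exact: linear_variational.
  by rewrite Y0 mulmxA.
split; last first.
  rewrite spaceE; apply: subspace_of_rows => z; rewrite /M1 mulmxA => H.
  by apply: M0_free; rewrite -(mulmxKV Qu (z *m M0)) H mul0mx.
have W0 := dichotomy_const_gt0 d T L0 eps.
have nl_cmp := nonlinear_compare T0 L00 eps0 d_eps B_bound B_small g0 g_rem.
have [cQ cQ0 cQP] := norm_mulmxr Q.
have [cI cI0 cIP] := norm_mulmxr (invmx Q).
apply/seteqP; split=> w /=; last first.
  (* The velocity at s = 0 of the stable orbits with stable coordinates s x0(T) at T. *)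
  move=> [W Ws <-].
  have [s1 s10 ex] := nonlinear_exists T0 L00 eps0 d_eps B_bound B_small g_cont g0 g_rem.
  pose x0 t := W t *m Q.
  have x0s : linear_solution d B x0 by exact: variational_linear.
  (* The summand 1 keeps [r] positive even if [x0 T = 0], since [r] occurs as a divisor below. *)
  pose r := `|x0 T| + 1.
  have r0 : 0 < r by rewrite ltr_pwDr.
  have /choice[x xP] : forall s : R, exists x : R -> 'rV[R]_N, `|s| * r <= s1 ->
      [/\ nonlinear_solution d g x, forall i, d 0 i < 0 -> x T 0 i = (s *: x0 T) 0 i,
        forall t : R, 0 <= t -> `|x t| <= 2 * (`|s| * r) * dichotomy_const d T L0 eps &
        x t @[t --> +oo] --> (0 : 'rV[R]_N)].
    move=> s; have [ss|_] := boolP (`|s| * r <= s1); last by exists (fun=> 0).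
    have h : `|s *: x0 T| <= `|s| * r by rewrite normrZ ler_wpM2l// lerDl.
    have [x [xs xT xb xl]] := ex _ (le_trans h ss).
    exists x => _; split=> // t t0; apply: le_trans (xb t t0) _.
    by rewrite ler_wpM2r ?(ltW W0)// ler_wpM2l.
  pose psi s t := phi t + x s t *m invmx Q.
  pose small := s1 / r.
  have small0 : 0 < small by rewrite divr_gt0.
  have smallP (s : R) : `|s| < small -> `|s| * r <= s1 by rewrite ltr_pdivlMr// => /ltW.
  have psi_close (s t : R) : `|s| < small -> 0 <= t ->
      `|psi s t - phi t| <= cI * (2 * (`|s| * r) * dichotomy_const d T L0 eps).
    move=> /smallP ss t0; rewrite /psi addrAC subrr add0r; apply: le_trans (cIP _) _.
    by rewrite ler_wpM2l ?(ltW cI0)//; have [_ _ + _] := xP s ss; apply.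
  have psi_stable (s : R) : `|s| < small -> stable_orbit F e (psi s).
    by move=> /smallP ss; apply: nonlinear_orbit; have [] := xP s ss.
  (* The curve for [s = 0] comes from the same choice as the others; its bound, proportional to
     [|s|], forces the deviation to vanish. *)
  have psi00 : psi 0 0 = phi0 0.
    apply/eqP; rewrite -(phi_pos (lexx _)) -subr_eq0 -normr_le0.
    have := psi_close 0 0; rewrite !normr0 => /(_ small0 (lexx _)).
    by rewrite mul0r mulr0 mul0r mulr0.
  exists (fun s => psi s 0); split=> //.
    move=> U [eta eta0 UP].
    have eta' : 0 < eta / (cI * (2 * r * dichotomy_const d T L0 eps)).
      by rewrite divr_gt0// !mulr_gt0.
    apply/nbhs_ballP; exists (Num.min small (eta / (cI * (2 * r * dichotomy_const d T
      L0 eps)))).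
      by rewrite /= lt_min small0.
    move=> s; rewrite /ball /= sub0r normrN lt_min => /andP[ss se].
    apply: (UP phi0 (psi s) phi0_stable erefl (psi_stable s ss)) => t t0.
    rewrite -phi_pos//; apply: le_lt_trans (psi_close s t ss t0) _.
    by move: se; rewrite ltr_pdivlMr ?mulr_gt0//; lra.
  apply/is_derive_dist_le => eta eta0.
  pose tau := eta / (cI * r * dichotomy_const d T L0 eps).
  have tau0 : 0 < tau by rewrite divr_gt0// !mulr_gt0.
  have [s2 s20 cmp] := nl_cmp _ tau0.
  pose small2 := s2 / (2 * r * dichotomy_const d T L0 eps).
  have small20 : 0 < small2 by rewrite divr_gt0// !mulr_gt0.
  exists (Num.min small small2) => [|s]; first by rewrite lt_min small0.
  rewrite lt_min => /andP[ss ss2]; have ss' := smallP _ ss.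
  have [xs xT xb _] := xP s ss'.
  have ys : linear_solution d B (fun t => s *: x0 t).
    have := @linear_solution_sum _ _ d B 1 (fun=> s) (fun=> x0) (fun=> x0s).
    by under eq_fun do rewrite big_ord_recl big_ord0 addr0.
  have := cmp (x s) (fun t => s *: x0 t) (`|s| * r) xs _ _ _ ys.
  move=> /(_ _ _ _ _ 0 (lexx _)) H.
  have psiE : psi s 0 - phi0 0 = x s 0 *m invmx Q.
    by rewrite /psi -(phi_pos (lexx _)) addrAC subrr add0r.
  rewrite add0r psi00 psiE.
  have -> : x s 0 *m invmx Q - s *: W 0 = (x s 0 - s *: x0 0) *m invmx Q.
    by rewrite mulmxBl -scalemxAl /x0 (mulmxK Qu).
  apply: le_trans (cIP _) _.
  apply: (@le_trans _ _ (cI * (tau * (`|s| * r) * dichotomy_const d T L0 eps))).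
    rewrite ler_wpM2l ?(ltW cI0)//; apply: H.
    - move=> t t0; apply: le_trans (xb t t0) _.
      by move: ss2; rewrite ltr_pdivlMr ?mulr_gt0//; lra.
    - move=> i /xT ->; rewrite mxE normrM ler_wpM2l//.
      by apply: le_trans (coord_le_norm _ _) _; rewrite lerDl.
    - by rewrite mulr_ge0// ltW.
    - by move=> i /xT.
  rewrite le_eqVlt; apply/orP; left; apply/eqP; rewrite /tau; field.
  by rewrite !gt_eqF.
(* The orbit psi through gam s differs from phi + (linear solution with the same stable
   coordinates at T) by o(s), and [cokermx M0] annihilates the linear solutions at 0. *)
move=> [gam [gam0 gam_nb gam_der]].
rewrite spaceE /=.
suff : (w *m Q *m cokermx M0 == 0).
  rewrite -submxE => /submxP[z zE]; exists z.
  by rewrite /M1 mulmxA -zE (mulmxK Qu).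
have [cP cP0 cPP] := norm_mulmxr (cokermx M0).
have [C [sC [C0 sC0 CP]]] := @nonlinear_forward_bound _ _ d _ _ _ _ T0 L00 B_bound g0
  g_rem.
set v := w *m Q *m cokermx M0.
have key (tau : R) : 0 < tau ->
    `|v| <= tau * (cQ * cP + cP * dichotomy_const d T L0 eps * C * cQ * (`|w| + 1)).
  (* The bound by 1 gives [|gam s - phi0 0| <= s * (|w| + 1)], independently of [tau]. *)
  move=> tau0; pose tau1 := Num.min tau 1.
  have tau10 : 0 < tau1 by rewrite lt_min tau0 ltr01.
  have tau11 : tau1 <= 1 by rewrite ge_min lexx orbT.
  have tau1t : tau1 <= tau by rewrite ge_min lexx.
  have /is_derive_dist_le/(_ _ tau10)[del del0 delP] := gam_der.
  have [s2 s20 cmp] := nl_cmp _ tau0.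
  (* In eigencoordinates the deviation is then below both [s2], the range of the comparison, and
     [sC], the range of the Gronwall bound. *)
  pose rad := Num.min (s2 / cQ) (sC / cQ).
  have rad0 : 0 < rad by rewrite lt_min !divr_gt0.
  pose U := [set q | exists psi, [/\ stable_orbit F e psi, psi 0 = q &
    forall t, 0 <= t -> `|psi t - phi0 t| < rad]].
  have nbU : Ws_nbhs F e (phi0 0) U.
    exists rad => // phi' psi phi's phi'0 psis close; exists psi; split=> // t t0.
    (* [Ws_nbhs] admits any orbit [phi'] through the base point; uniqueness identifies it with
       [phi0]. *)
    rewrite -(@forward_unique _ _ F phi' phi0)//; first exact: close.
      by have [] := phi's.
    by have [] := phi0_stable.
  have : \forall s \near (0 : R), U (gam s) by exact: (gam_nb _ nbU).
  move=> /nbhs_ballP[del2 /= del20 del2P].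
  (* A single small positive parameter suffices: all estimates are proportional to [s], which
     cancels. *)
  pose s := Num.min del del2 / 2.
  have s0 : 0 < s by rewrite divr_gt0// lt_min del0.
  have sd : s < Num.min del del2
    by rewrite ltr_pdivrMr// mulr_natr mulr2n ltrDl lt_min del0.
  move: sd; rewrite lt_min => /andP[sd1 sd2].
  have [|psi [psis psi0 close]] := del2P s.
    by rewrite /ball /= sub0r normrN gtr0_norm.
  pose x t := ((psi \o @pos R) t - phi t) *m Q.
  have xs : nonlinear_solution d g x by apply: orbit_nonlinear; have [] := psis.
  have x_small t : 0 <= t -> `|x t| <= cQ * rad.
    move=> t0; apply: le_trans (cQP _) _; rewrite ler_wpM2l ?(ltW cQ0)//.
    by rewrite /= pos_id// phi_pos// ltW// close.
  have x_s2 t : 0 <= t -> `|x t| <= s2.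
    move=> t0; apply: le_trans (x_small t t0) _; rewrite mulrC -ler_pdivlMr//.
    by rewrite ge_min lexx.
  have x_sC t : 0 <= t -> `|x t| <= sC.
    move=> t0; apply: le_trans (x_small t t0) _; rewrite mulrC -ler_pdivlMr//.
    by rewrite ge_min lexx orbT.
  have xT := CP x xs x_sC.
  have [y ys yT] := lin_ex (x T).
  have [z zE] := span y ys.
  have xy := cmp x y `|x T| xs x_s2 (fun i _ =>
    coord_le_norm _ _) (normr_ge0 _) ys yT 0 (lexx _).
  have x0E : x 0 = (gam s - phi0 0) *m Q by rewrite /x /= phi_pos// pos_id// psi0.
  have := delP s; rewrite gtr0_norm// add0r gam0 => /(_ sd1) gs.
  have gs1 : `|gam s - phi0 0| <= s * (`|w| + 1).
    rewrite -[gam s - phi0 0](subrK (s *: w)); apply: le_trans (ler_normD _ _) _.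
    rewrite addrC normrZ gtr0_norm// mulrDr lerD2l mulr1; apply: le_trans gs _.
    by rewrite ler_piMl// ltW.
  have x0P : `|x 0 *m cokermx M0|
    <= cP * (tau * (C * (cQ * (s * (`|w| + 1)))) * dichotomy_const d T L0 eps).
    have -> : x 0 *m cokermx M0 = (x 0 - y 0) *m cokermx M0.
      by rewrite mulmxBl zE -(mulmxA z) mulmx_coker mulmx0 subr0.
    apply: le_trans (cPP _) _; rewrite ler_wpM2l ?(ltW cP0)//.
    apply: le_trans xy _; rewrite ler_wpM2r ?(ltW W0)// ler_wpM2l ?(ltW tau0)//.
    apply: le_trans xT _; rewrite ler_wpM2l ?(ltW C0)// x0E.
    by apply: le_trans (cQP _) _; rewrite ler_wpM2l ?(ltW cQ0).
  have rest : `|(gam s - phi0 0 - s *: w) *m Q *m cokermx M0| <= cP * (cQ * (tau * s)).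
    apply: le_trans (cPP _) _; rewrite ler_wpM2l ?(ltW cP0)//.
    apply: le_trans (cQP _) _; rewrite ler_wpM2l ?(ltW cQ0)//.
    by apply: le_trans gs _; rewrite ler_wpM2r ?(ltW s0).
  rewrite -(ler_pM2l s0).
  (* [s *: w] is [gam s - phi0 0] minus the differentiation error. The first part is killed by
     [cokermx M0] up to the comparison error, the second is at most [tau1 * s]. *)
  have -> : s * `|v| = `|x 0 *m cokermx M0 - (gam s - phi0 0 - s *: w) *m Q *m cokermx
    M0|.
    rewrite -[s in LHS]gtr0_norm// -normrZ x0E -!mulmxBl opprB addrC subrK.
    by rewrite -!scalemxAl.
  apply: le_trans (ler_normB _ _) _; apply: le_trans (lerD x0P rest) _.
  rewrite le_eqVlt; apply/orP; left; apply/eqP; ring.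
set Cst := cQ * cP + _ in key.
have Cst0 : 0 < Cst.
  by rewrite ltr_pwDl ?mulr_gt0// !mulr_ge0// ?ltW// addr_gt0// ltr_wpDl.
rewrite -normr_le0; apply/ler_addgt0Pr => eta eta0; rewrite add0r.
apply: le_trans (key (eta / Cst) _) _; first by rewrite divr_gt0.
by rewrite divfK// gt_eqF.
Qed.

End StableManifold.

(** * The (u, v)-system and its Hamiltonian *)

Section RealDiagonalization.
Variable R : realType.

(** The spectral theorem diagonalises the complexification with real eigenvalues, and real matrices
    similar over the complex numbers are similar over R by [real_similar]. *)
Lemma symmetric_diagonalizable n (A : 'M[R]_n) : A = A^T ->
  exists2 Q, Q \in unitmx & exists d : 'rV[R]_n, A *m Q = Q *m diag_mx d.
Proof.
move=> Asym.
have realmxE m1 m2 (M : 'M[R]_(m1, m2)) :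
    map_mx (real_complex R) M \is a (mxOver Num.real).
  by apply/mxOverP => i j; rewrite mxE complex_real.
have real_mx m1 m2 (M : 'M[R[i]]_(m1, m2)) : M \is a (mxOver Num.real) ->
    M = map_mx (real_complex R) (map_mx (@complex.Re R) M).
  by move=> /mxOverP Mr; apply/matrixP => i j; rewrite !mxE RRe_real.
have Ah : complexify A \is symmetricmx.
  apply/is_hermitianmxP; rewrite expr0 scale1r; apply/matrixP => i j.
  by rewrite !mxE /= [in LHS]Asym mxE.
have Aherm := realsym_hermsym Ah (realmxE _ _ A).
have /hermitian_normalmx/orthomx_spectralP AE := Aherm.
have Dreal := hermitian_spectral_diag_real Aherm.
move: AE Dreal; set P := spectralmx _; set D := spectral_diag _ => AE Dreal.
have Pu : P \in unitmx by exact: spectral_unit.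
have DE := real_mx _ _ _ Dreal; set D' := map_mx (@complex.Re R) D in DE.
have diagE : diag_mx D = complexify (diag_mx D').
  by rewrite DE /complexify map_diag_mx.
have [||P' /andP[/= P'real P'u]] :=
  @real_similar _ _ (complexify A) (diag_mx D) _ (realmxE _ _ A).
- exists P => //=; apply/similarP => //.
  by rewrite [in LHS]AE !mulmxA mulmxV// mul1mx.
- by rewrite diagE; exact: realmxE.
move=> /(similarP P'u) E.
pose P2 := map_mx (@complex.Re R) P'.
have P'E : P' = map_mx (real_complex R) P2 by exact: real_mx.
have P2u : P2 \in unitmx by move: P'u; rewrite P'E map_unitmx.
have {}E : P2 *m A = diag_mx D' *m P2.
  apply: (@map_mx_inj _ _ (real_complex R)).
  by rewrite !map_mxM/= -P'E -[map_mx _ (diag_mx _)]diagE.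
exists (invmx P2); first by rewrite unitmx_inv.
exists D'; rewrite -[LHS]mul1mx -[X in X *m _](mulVmx P2u) -mulmxA.
by rewrite [P2 *m (_ *m _)]mulmxA E -mulmxA mulmxV// mulmx1.
Qed.

Section DiagonalSpectrum.
Variables (N : nat) (J Q : 'M[R]_N) (d : 'rV[R]_N).
Hypotheses (Qu : Q \in unitmx) (JQ : J *m Q = Q *m diag_mx d).

Lemma char_poly_diagonalized :
  char_poly (complexify J) = \prod_(i < N) ('X - ((d 0 i)%:C%C)%:P).
Proof.
pose Qc := map_mx polyC (complexify Q).
have cQu : complexify Q \in unitmx by rewrite map_unitmx.
have E : char_poly_mx (complexify J) *m Qc = Qc *m char_poly_mx (complexify (diag_mx d)).
  rewrite /char_poly_mx mulmxBl mulmxBr /Qc -!map_mxM/= JQ; congr (_ - _).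
  by rewrite scalar_mxC.
have detQ : \det Qc != 0.
  by rewrite /Qc det_map_mx polyC_eq0 -unitfE -unitmxE.
have : char_poly (complexify J) = char_poly (complexify (diag_mx d)).
  by apply: (mulIf detQ); rewrite /char_poly -[LHS]det_mulmx E det_mulmx mulrC.
move=> ->; rewrite char_poly_trig; last first.
  by rewrite /complexify map_diag_mx diag_mx_is_trig.
by apply: eq_bigr => i _; rewrite !mxE eqxx mulr1n.
Qed.

Lemma eigenvalue_diagonalizedP (z : R[i]) :
  reflect (exists i, z = (d 0 i)%:C%C) (eigenvalue (complexify J) z).
Proof.
rewrite eigenvalue_root_char char_poly_diagonalized.
have -> : \prod_(i < N) ('X - ((d 0 i)%:C%C)%:P)
    = \prod_(x <- [seq (d 0 i)%:C%C | i <- enum 'I_N]) ('X - x%:P).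
  by rewrite big_map big_enum.
rewrite root_prod_XsubC.
apply: (iffP mapP) => [[i _ ->]|[i ->]]; first by exists i.
by exists i => //; rewrite mem_enum.
Qed.

Lemma spectral_dim_diagonalized (P : pred R[i]) :
  spectral_dim P J #|[pred i | P (d 0 i)%:C%C]|.
Proof.
exists [seq (d 0 i)%:C%C | i <- enum 'I_N].
  by rewrite char_poly_diagonalized big_map big_enum.
by rewrite count_map enumT -size_filter cardE.
Qed.

End DiagonalSpectrum.
End RealDiagonalization.

Section DerivativeRules.
Variable R : realType.

Lemma is_derive_linear_comp (U V W : normedModType R) (L : {linear U -> V})
    (g : V -> W) z w dg :
  is_derive (L z) (L w) g dg -> is_derive z w (g \o L) dg.
Proof.
have E : (fun h : R => h^-1 *: ((g \o L) (h *: w + z) - (g \o L) z))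
    = (fun h => h^-1 *: (g (h *: L w + L z) - g (L z))).
  by apply/funext => h /=; rewrite linearP.
by move=> [Dg gE]; apply: DeriveDef; rewrite /derivable /derive E.
Qed.

Lemma is_derive_diff (V W : normedModType R) (F : V -> W) x v :
  differentiable F x -> is_derive x v F ('D_v F x).
Proof. by move=> dF; apply: derivableP; exact: diff_derivable. Qed.

Lemma differentiable_coord_rV (V : normedModType R) m (F : V -> 'rV[R]_m) x :
  (forall j, differentiable (fun z => F z 0 j) x) -> differentiable F x.
Proof.
move=> H; have -> : F = \sum_j (fun z => F z 0 j *: (delta_mx 0 j : 'rV[R]_m)).
  by apply/funext => z; rewrite fct_sumE; exact: row_sum_delta.
apply: differentiable_sum => j; exact: differentiableZl.
Qed.

Lemma is_derive_sumr (V W : normedModType R) k (F : 'I_k -> V -> W)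
    (dF : 'I_k -> W) x v :
  (forall i, is_derive x v (F i) (dF i)) ->
  is_derive x v (fun z => \sum_i F i z) (\sum_i dF i).
Proof.
move=> H; have -> : (fun z => \sum_i F i z) = \sum_i F i.
  by apply/funext => z; rewrite fct_sumE.
exact: is_derive_sum.
Qed.

Lemma differentiable_sumr (V W : normedModType R) k (F : 'I_k -> V -> W) x :
  (forall i, differentiable (F i) x) -> differentiable (fun z => \sum_i F i z) x.
Proof.
move=> H; have -> : (fun z => \sum_i F i z) = \sum_i F i.
  by apply/funext => z; rewrite fct_sumE.
exact: differentiable_sum.
Qed.

End DerivativeRules.

(** * The vector field of the (u, v)-system and its derivative *)

Section UVSystem.
Variables (R : realType) (n : nat) (f : 'rV[R]_n -> 'rV[R]_n).
Hypothesis f_smooth : smooth f.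
Implicit Types (u : 'rV[R]_n) (z w : 'rV[R]_(n + n)).
Local Notation X := (uv_system f).
Local Notation L := (@lsubmx R 1 n n).
Local Notation Rt := (@rsubmx R 1 n n).
Let Df j : 'rV[R]_n -> 'rV[R]_n := 'D_(delta_mx 0 j) f.

Let f_diff u : differentiable f u. Proof. exact: smooth_differentiable. Qed.

Let Df_smooth j : smooth (Df j). Proof. exact: smooth_derive. Qed.

Lemma uv_coordr z j : rsubmx (X z) 0 j = \sum_i rsubmx z 0 i * Df j (lsubmx z) 0 i.
Proof.
rewrite /uv_system row_mxKr mxE; apply: eq_bigr => i _.
by rewrite [X in _ * X]mxE jacobianE.
Qed.

Lemma uv_coordl z j : lsubmx (X z) 0 j = - f (lsubmx z) 0 j + rsubmx z 0 j.
Proof. by rewrite /uv_system row_mxKl !mxE. Qed.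

Lemma is_derive_lsub (g : 'rV[R]_n -> 'rV[R]_n) z w j : differentiable g (lsubmx z) ->
  is_derive z w (fun z => g (lsubmx z) 0 j) (('D_(lsubmx w) g (lsubmx z)) 0 j).
Proof.
move=> dg; have D := @is_derive_linear_comp _ _ _ _ (lsubmx : {linear _ -> _}) g z w _
  (is_derive_diff (lsubmx w) dg).
by have /is_derive_coordP := D; apply.
Qed.

Lemma is_derive_rsub z w j : is_derive z w (fun z => rsubmx z 0 j) (rsubmx w 0 j).
Proof.
have D := @is_derive_linear_comp _ _ _ _ (rsubmx : {linear _ -> _}) id z w _
  (is_derive_id (rsubmx z) (rsubmx w)).
by have /is_derive_coordP := D; apply.
Qed.

Lemma differentiable_lsub (g : 'rV[R]_n -> 'rV[R]_n) z j : differentiable g (lsubmx z) ->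
  differentiable (fun z => g (lsubmx z) 0 j) z.
Proof.
move=> dg; apply: (@differentiable_comp _ _ _ _ (fun z => g (lsubmx z)) (fun v => v 0 j)).
  by apply: (@differentiable_comp _ _ _ _ L g); [exact: differentiable_lsubmx|].
exact: differentiable_coord.
Qed.

Lemma differentiable_rsub z j : differentiable (fun z => rsubmx z 0 j) z.
Proof.
apply: (@differentiable_comp _ _ _ _ Rt (fun v => v 0 j)).
  exact: differentiable_rsubmx.
exact: differentiable_coord.
Qed.

(** Second derivatives of [f] enter through ['D_(lsubmx w) (Df j)]; the continuity of this
    expression in [z] is what makes the field C1. *)
Definition uv_derive z w : 'rV[R]_(n + n) :=
  row_mx (- 'D_(lsubmx w) f (lsubmx z) + rsubmx w)
    (\row_j \sum_i (rsubmx z 0 i * ('D_(lsubmx w) (Df j) (lsubmx z)) 0 i +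
                    rsubmx w 0 i * Df j (lsubmx z) 0 i)).

Lemma is_derive_uv z w : is_derive z w X (uv_derive z w).
Proof.
apply/is_derive_coordP => k; case: (split_ordP k) => j ->.
  have -> : (fun z => X z 0 (lshift n j)) = (fun z => - f (lsubmx z) 0 j + rsubmx z 0 j).
    by apply/funext => y; rewrite -uv_coordl [RHS]mxE.
  have -> : uv_derive z w 0 (lshift n j) =
      - ('D_(lsubmx w) f (lsubmx z)) 0 j + rsubmx w 0 j.
    by rewrite /uv_derive row_mxEl mxE [X in X + _]mxE.
  have D1 := is_derive_lsub w j (f_diff (lsubmx z)); have D2 := is_derive_rsub z w j.
  have D3 := is_deriveN D1.
  exact: is_deriveD.
have -> : (fun z => X z 0 (rshift n j))
    = (fun z => \sum_i rsubmx z 0 i * Df j (lsubmx z) 0 i).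
  by apply/funext => y; rewrite -uv_coordr [RHS]mxE.
rewrite /uv_derive row_mxEr mxE.
apply: is_derive_sumr => i.
have D1 := is_derive_lsub w i (smooth_differentiable (lsubmx z) (Df_smooth j)).
have D2 := is_derive_rsub z w i.
apply: is_derive_eq; rewrite /GRing.scale /=; congr (_ + _); exact: mulrC.
Qed.

Lemma uv_differentiable z : differentiable X z.
Proof.
apply: differentiable_coord_rV => k; case: (split_ordP k) => j ->.
  have -> : (fun z => X z 0 (lshift n j)) = (fun z => - f (lsubmx z) 0 j + rsubmx z 0 j).
    by apply/funext => y; rewrite -uv_coordl [RHS]mxE.
  apply: differentiableD; last exact: differentiable_rsub.
  by apply: differentiableN; exact: differentiable_lsub.
have -> : (fun z => X z 0 (rshift n j))
    = (fun z => \sum_i rsubmx z 0 i * Df j (lsubmx z) 0 i).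
  by apply/funext => y; rewrite -uv_coordr [RHS]mxE.
apply: differentiable_sumr => i; apply: differentiableM; first exact: differentiable_rsub.
by apply: differentiable_lsub; exact: smooth_differentiable.
Qed.

Lemma uv_C1 : C1 X.
Proof.
split; first exact: uv_differentiable.
move=> w.
have -> : 'D_w X = uv_derive ^~ w.
  by apply/funext => z; have [_ ->] := is_derive_uv z w.
have cl (g : 'rV[R]_n -> 'rV[R]_n) i : smooth g ->
    continuous (fun z : 'rV[R]_(n + n) => g (lsubmx z) 0 i).
  move=> sg z; apply: differentiable_continuous.
  by apply: differentiable_lsub; exact: smooth_differentiable.
have cr i : continuous (fun z : 'rV[R]_(n + n) => rsubmx z 0 i).
  by move=> z; apply: differentiable_continuous; exact: differentiable_rsub.
apply: continuous_coordP => k z; case: (split_ordP k) => j ->.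
  have -> : (fun z => uv_derive z w 0 (lshift n j))
      = (fun z => - ('D_(lsubmx w) f (lsubmx z)) 0 j + rsubmx w 0 j).
    by apply/funext => y; rewrite /uv_derive row_mxEl mxE [X in X + _]mxE.
  apply: (@cvgD _ _ _ (nbhs z) (nbhs_filter z)); last exact: cvg_cst.
  apply: (@cvgN _ _ _ (nbhs z) (nbhs_filter z)).
  exact: (cl _ j (smooth_derive (lsubmx w) f_smooth) z).
have -> : (fun z => uv_derive z w 0 (rshift n j)) =
    (fun z => \sum_i (rsubmx z 0 i * ('D_(lsubmx w) (Df j) (lsubmx z)) 0 i +
                    rsubmx w 0 i * Df j (lsubmx z) 0 i)).
  by apply/funext => y; rewrite /uv_derive row_mxEr mxE.
apply: (@cvg_sumr _ _ _ (nbhs_filter z)) => i.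
apply: (@cvgD _ _ _ (nbhs z) (nbhs_filter z)).
  apply: (@cvgM _ _ (nbhs z) (nbhs_filter z)); first exact: cr.
  exact: (cl _ i (smooth_derive (lsubmx w) (Df_smooth j)) z).
apply: (@cvgM _ _ (nbhs z) (nbhs_filter z)); first exact: cvg_cst.
exact: (cl (Df j) i (Df_smooth j) z).
Qed.

(** The second derivatives of [f] occur multiplied by [v], hence drop out on [v = 0]. *)
Lemma uv_jacobian0 u : 'J X (row_mx u 0) = block_mx (- 'J f u) 0 1%:M ('J f u)^T.
Proof.
apply/row_matrixP => k; rewrite !rowE -deriveEjacobian; last exact: uv_differentiable.
have [_ ->] := is_derive_uv (row_mx u 0) (delta_mx 0 k).
set w := delta_mx 0 k.
rewrite -[w in RHS]hsubmxK mul_row_block mulmx0 mulmx1 add0r /uv_derive row_mxKl row_mxKr.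
congr row_mx; first by rewrite deriveEjacobian// mulmxN.
apply/rowP => j; rewrite !mxE; apply: eq_bigr => i _.
by rewrite [X in X * _ + _]mxE mul0r add0r [X in _ = _ * X]mxE jacobianE.
Qed.

End UVSystem.

(** * The Hamiltonian and its differential *)

Section Hamiltonian.
Variables (R : realType) (n : nat) (f : 'rV[R]_n -> 'rV[R]_n).
Hypothesis f_smooth : smooth f.
Implicit Types (x y u : 'rV[R]_n) (z w : 'rV[R]_(n + n)).
Local Notation X := (uv_system f).
Local Notation H := (Ham f).

Lemma dotE x y : dot x y = \sum_i x 0 i * y 0 i.
Proof. by rewrite /dot mxE; apply: eq_bigr => i _; rewrite mxE. Qed.

Lemma dot0r x : dot x 0 = 0.
Proof. by rewrite dotE big1// => i _; rewrite mxE mulr0. Qed.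

Lemma dot_gt0 x : x != 0 -> 0 < dot x x.
Proof.
move=> x0; rewrite lt_neqAle dotE; apply/andP; split; last first.
  by apply: sumr_ge0 => i _; rewrite -expr2 sqr_ge0.
apply: contra x0 => /eqP/esym/psumr_eq0P E.
apply/eqP/rowP => i; rewrite mxE.
by apply/eqP; rewrite -sqrf_eq0 expr2 E// => j _; rewrite -expr2 sqr_ge0.
Qed.

Lemma HamE z : H z =
  \sum_i (2^-1 * (rsubmx z 0 i * rsubmx z 0 i) - f (lsubmx z) 0 i * rsubmx z 0 i).
Proof. by rewrite /Ham !dotE mulr_sumr -sumrB. Qed.

Lemma Ham_differentiable z : differentiable H z.
Proof.
have -> : H = fun z =>
  \sum_i (2^-1 * (rsubmx z 0 i * rsubmx z 0 i) - f (lsubmx z) 0 i * rsubmx z 0 i).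
  by apply/funext => y; exact: HamE.
have dr i := differentiable_rsub z i.
have dl i := differentiable_lsub i (smooth_differentiable (lsubmx z) f_smooth).
apply: differentiable_sumr => i; apply: differentiableB; apply: differentiableM => //.
exact: differentiableM.
Qed.

Lemma dHamE z w : 'd H z w = omega (X z) w.
Proof.
rewrite -deriveE; last exact: Ham_differentiable.
have D : is_derive z w H (\sum_i (rsubmx z 0 i * rsubmx w 0 i -
    (f (lsubmx z) 0 i * rsubmx w 0 i +
     rsubmx z 0 i * ('D_(lsubmx w) f (lsubmx z)) 0 i))).
  have -> : H = fun z =>
    \sum_i (2^-1 * (rsubmx z 0 i * rsubmx z 0 i) - f (lsubmx z) 0 i * rsubmx z 0 i).
    by apply/funext => y; exact: HamE.
  apply: is_derive_sumr => i.
  have D1 := is_derive_lsub w i (smooth_differentiable (lsubmx z) f_smooth).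
  have D2 := is_derive_rsub z w i.
  by apply: is_derive_eq; rewrite /GRing.scale /=; field.
have [_ ->] := D; rewrite /omega !dotE.
have -> : \sum_i rsubmx (X z) 0 i * lsubmx w 0 i =
    \sum_i rsubmx z 0 i * ('D_(lsubmx w) f (lsubmx z)) 0 i.
  have dfu := smooth_differentiable (lsubmx z) f_smooth.
  rewrite deriveEjacobian//.
  transitivity ((rsubmx z *m ('J f (lsubmx z))^T *m (lsubmx w)^T) 0 0).
    by rewrite /uv_system row_mxKr mxE; apply: eq_bigr => i _;
      rewrite [X in _ = _ * X]mxE.
  by rewrite -mulmxA -trmx_mul mxE; apply: eq_bigr => i _; rewrite [X in _ * X = _]mxE.
rewrite -sumrB; apply: eq_bigr => i _.
by rewrite /uv_system row_mxKl !mxE; ring.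
Qed.

Lemma Ham_hamiltonian : hamiltonian_field X H.
Proof. by move=> z; split=> [|w]; [exact: Ham_differentiable|exact: dHamE]. Qed.

Lemma omega_self z : omega z z = 0.
Proof. by rewrite /omega !dotE; apply/eqP; rewrite subr_eq0; apply/eqP;
  apply: eq_bigr => i _; rewrite mulrC. Qed.

Lemma Ham_row_mx0 u : H (row_mx u 0) = 0.
Proof. by rewrite /Ham row_mxKr !dot0r mulr0 subr0. Qed.

Lemma dHam_row_mx0 u w : 'd H (row_mx u 0) w = - dot (f u) (rsubmx w).
Proof.
rewrite dHamE /omega /uv_system row_mxKl row_mxKr !row_mxKl mul0mx addr0.
rewrite !dotE [X in _ - X]big1 ?subr0; last by move=> i _; rewrite row_mxKr mxE mul0r.
by rewrite -sumrN; apply: eq_bigr => i _; rewrite mxE mulNr.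
Qed.

End Hamiltonian.

Lemma conserved_first_integral (R : realType) (N : nat) (F : 'rV[R]_N -> 'rV[R]_N)
    (H : 'rV[R]_N -> R) :
  (forall z, differentiable H z) -> (forall z, 'd H z (F z) = 0) -> conserved F H.
Proof.
move=> dH dHF I phi [cphi Dphi].
suff P s t : s \in I -> t \in I -> s <= t -> H (phi s) = H (phi t).
  by move=> s t sI tI; have [/P->|/ltW/P->] := leP s t.
move=> sI tI st.
have sub : `[s, t] `<=` [set` I].
  move=> r; rewrite /= in_itv /= => srt.
  exact: (@interval_is_interval R I s t sI tI r srt).
have D r : r \in `]s, t[ -> is_derive r (1 : R) (H \o phi) 0.
  move=> rst; have Ir : (interior [set` I]) r.
    have : `]s, t[ `<=` interior [set` I]; last exact.
    rewrite -open_subsetE; last exact: interval_open.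
    by apply: subset_trans sub; exact: subset_itv_oo_cc.
  by rewrite -(dHF (phi r)); apply: is_derive_chain => //; exact: Dphi.
have c : {within `[s, t], continuous (H \o phi)}.
  apply: within_continuous_comp; last exact: continuous_subspaceW cphi.
  by move=> x _; exact: differentiable_continuous.
have [r _] := MVT_segment st D c.
by rewrite mul0r => /eqP; rewrite subr_eq0 => /eqP.
Qed.

(** * Tangent spaces under inclusions and linear embeddings *)

Section TangentSpaces.
Variable R : realType.

(** The uniform distance of two orbits dominates the distance of their initial points, so a curve
    continuous for the topology of the manifold is continuous for the induced one. *)
Lemma TWs_sub_Tset N (F : 'rV[R]_N -> 'rV[R]_N) e p (S : set 'rV[R]_N) :
  Ws F e `<=` S -> TWs F e p `<=` Tset S p.
Proof.
move=> WS w [gam [gam0 gam_nb gam_der]]; exists gam; split=> // U.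
rewrite /within /= => /nbhs_normP[r /= r0 rU].
have nbA : Ws_nbhs F e p [set q | S q /\ `|q - p| < r].
  exists r => // phi psi phis phi0 psis close; split; first by apply: WS; exists psi.
  by rewrite -phi0; exact: close.
have : \forall s \near (0 : R), S (gam s) /\ `|gam s - p| < r by exact: (gam_nb _ nbA).
by apply: filterS => s [Ss sr]; apply: rU => //=; rewrite distrC.
Qed.

Lemma stable_orbit_lift n m (M : 'M[R]_(n, m)) (F : 'rV[R]_n -> 'rV[R]_n)
    (G : 'rV[R]_m -> 'rV[R]_m) e phi :
  (forall u, G (u *m M) = F u *m M) -> stable_orbit F e phi ->
  stable_orbit G (e *m M) (fun t => phi t *m M).
Proof.
move=> GM [/solution_posP[cphi Dphi] phi_e]; split; last first.
  exact: (continuous_cvg _ (@continuous_mulmxr _ _ _ M e) phi_e).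
apply/solution_posP; split.
  move=> t; apply: (@continuous_comp _ _ _ (phi \o @pos R) (fun x => x *m M)).
    exact: cphi.
  exact: continuous_mulmxr.
move=> t t0; rewrite /= GM; exact: (is_derive_mulmxr M (Dphi t t0)).
Qed.

(** [M] maps orbits to orbits and enlarges their uniform distance by at most a constant factor, so
    it is continuous for the manifold topologies. *)
Lemma TWs_lift n m (M : 'M[R]_(n, m)) (F : 'rV[R]_n -> 'rV[R]_n)
    (G : 'rV[R]_m -> 'rV[R]_m) e p w :
  (forall u, G (u *m M) = F u *m M) -> Ws F e p -> TWs F e p w ->
  TWs G (e *m M) (p *m M) (w *m M).
Proof.
move=> GM [phi phis phi0] [gam [gam0 gam_nb gam_der]].
have [c c0 cP] := norm_mulmxr M.
exists (fun s => gam s *m M); split; [by rewrite gam0| |exact: is_derive_mulmxr].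
move=> U [eps eps0 UP].
have nbA : Ws_nbhs F e p [set q | U (q *m M)].
  exists (eps / c); first by rewrite divr_gt0.
  move=> phi' psi phi's phi'0 psis close.
  apply: (UP (fun t => phi' t *m M) (fun t => psi t *m M)).
  - exact: stable_orbit_lift phi's.
  - by rewrite phi'0.
  - exact: stable_orbit_lift psis.
  - move=> t t0; rewrite -mulmxBl; apply: le_lt_trans (cP _) _.
    by rewrite mulrC -ltr_pdivlMr// close.
exact: (gam_nb _ nbA).
Qed.

Lemma subspace_dim_unique N (S : set 'rV[R]_N) k l :
  subspace_of_dim S k -> subspace_of_dim S l -> k = l.
Proof.
move=> [U SU <-] [V SV <-]; congr (\dim _); apply/vspaceP => w.
by apply/idP/idP => h; [change ([set w | w \in V] w); rewrite -SV SU|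
  change ([set w | w \in U] w); rewrite -SU SV].
Qed.

Lemma full_subspace N (S : set 'rV[R]_N) : subspace_of_dim S N -> S = setT.
Proof.
move=> [U -> dU]; apply/seteqP; split=> // w _ /=.
have -> : U = fullv; last exact: memvf.
by apply/eqP; rewrite eqEdim subvf dU dimvf /dim /= mul1n leqnn.
Qed.

Lemma dot_kernel_dim n (c : 'rV[R]_n) : c != 0 ->
  subspace_of_dim [set w : 'rV[R]_(n + n) | dot c (rsubmx w) = 0] (2 * n).-1.
Proof.
move=> c0; pose C : 'M[R]_(n + n, 1) := col_mx 0 c^T.
have CE (w : 'rV[R]_(n + n)) : w *m C = (dot c (rsubmx w))%:M.
  rewrite -[w in LHS]hsubmxK /C mul_row_col mulmx0 add0r.
  apply/matrixP => i j; rewrite !ord1 [RHS]mxE eqxx mulr1n dotE mxE.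
  by apply: eq_bigr => k _; rewrite [X in _ * X]mxE mulrC.
pose L : 'Hom('rV[R]_(n + n), 'rV[R]_1) := linfun (mulmxr C).
exists (lker L).
  apply/seteqP; split=> w /=; rewrite memv_ker lfunE /= CE.
    by move=> ->; rewrite raddf0.
  move=> /eqP/matrixP/(_ 0 0); by rewrite [LHS]mxE [RHS]mxE eqxx mulr1n.
have := limg_ker_dim L fullv.
have -> : limg L = fullv.
  apply/eqP; rewrite eqEdim subvf /= dimvf /dim /= muln1 lt0n dimv_eq0.
  apply/eqP => L0; have : L (row_mx 0 c) \in 0%VS by rewrite -L0 memv_img// memvf.
  rewrite memv0 lfunE /= CE row_mxKr => /eqP/matrixP/(_ 0 0).
  rewrite [LHS]mxE eqxx mulr1n [RHS]mxE => H.
  by have := dot_gt0 c0; rewrite H ltxx.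
rewrite capfv !dimvf /dim /= muln1 mul1n addn1 => E.
have -> // : (2 * n)%N = (\dim (lker L)).+1.
by rewrite mul2n -addnn; exact: esym E.
Qed.

End TangentSpaces.

(** * Tangent space of the zero level of the Hamiltonian *)

Section ZeroLevel.
Variables (R : realType) (n : nat) (f : 'rV[R]_n -> 'rV[R]_n).
Hypothesis f_smooth : smooth f.
Local Notation H := (Ham f).
Variables (u : 'rV[R]_n).
Hypothesis fu : f u != 0.

Let is_derive_dot (x y : R -> 'rV[R]_n) (t : R) dx dy :
  is_derive t (1 : R) x dx -> is_derive t (1 : R) y dy ->
  is_derive t (1 : R) (fun s => dot (x s) (y s)) (dot dx (y t) + dot (x t) dy).
Proof.
move=> /is_derive_coordP Dx /is_derive_coordP Dy.
have -> : (fun s => dot (x s) (y s)) = (fun s => \sum_i x s 0 i * y s 0 i).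
  by apply/funext => s; rewrite dotE.
rewrite !dotE -big_split; apply: is_derive_sumr => i.
have D1 := Dx i; have D2 := Dy i.
by apply: is_derive_eq; rewrite /GRing.scale /=; ring.
Qed.

Let is_derive_affine (x y : 'rV[R]_n) (t : R) : is_derive t (1 : R) (fun s : R =>
  x + s *: y) y.
Proof.
apply/is_derive_coordP => i.
have -> : (fun s => (x + s *: y) 0 i) = (fun s => x 0 i + s * y 0 i).
  by apply/funext => s; rewrite mxE [in X in _ + X]mxE.
by apply: is_derive_eq; rewrite /GRing.scale /=; ring.
Qed.

(* [{v | Ham f (u, v) = 0}] is the sphere through 0 with centre [f u], and
   [sphere_point (f u) d] its second intersection with the line R d; for d = 0 the
   division by 0 yields the point 0, which lies on the sphere as well. *)
Let sphere_point (y d : 'rV[R]_n) : 'rV[R]_n := (2 * dot y d / dot d d) *: d.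

Let Ham_sphere_point (x d : 'rV[R]_n) : H (row_mx x (sphere_point (f x) d)) = 0.
Proof.
rewrite /Ham row_mxKl row_mxKr /sphere_point; set l := _ / _.
have -> : dot (l *: d) (l *: d) = l * (l * dot d d).
  by rewrite !dotE !mulr_sumr; apply: eq_bigr => i _; rewrite !mxE; ring.
have -> : dot (f x) (l *: d) = l * dot (f x) d.
  by rewrite !dotE !mulr_sumr; apply: eq_bigr => i _; rewrite !mxE; ring.
have [d0|d0] := eqVneq (dot d d) 0.
  by rewrite /l d0 invr0 !mulr0 !mul0r subr0.
by rewrite /l; field.
Qed.

Lemma Tset_Ham : Tset (H @^-1` [set 0]) (row_mx u 0) =
  [set w | dot (f u) (rsubmx w) = 0].
Proof.
apply/seteqP; split=> w /=.
  move=> [gam [gam0 gam_nb gam_der]].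
  have D := is_derive_chain gam_der (Ham_differentiable f_smooth (gam 0)).
  have gam_H : \forall s \near (0 : R), (H \o gam) s = cst 0 s.
    by apply: (gam_nb (H @^-1` [set 0])); exact: withinT.
  have [_ D0] := near_eq_is_derive gam_H D.
  move: D0; rewrite derive_cst gam0 dHam_row_mx0// => /eqP.
  by rewrite eq_sym oppr_eq0 => /eqP.
set w1 := lsubmx w; set w2 := rsubmx w => fw2.
pose x (s : R) := u + s *: w1.
have x0 : x (0 : R) = u by rewrite /x scale0r addr0.
have Dx : is_derive (0 : R) (1 : R) x w1 by exact: is_derive_affine.
have Dfx : is_derive (0 : R) (1 : R) (fun s => f (x s)) (w1 *m 'J f u).
  rewrite -x0; apply: (is_derive_comp_rV Dx).
  exact: smooth_differentiable.
have [v [v0 Dv Hv]] : exists v : R -> 'rV[R]_n, [/\ v (0 : R) = 0,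
    is_derive (0 : R) (1 : R) v w2 & forall s, H (row_mx (x s) (v s)) = 0].
  (* For [w2 = 0] the curve stays in the plane [v = 0], on which the Hamiltonian vanishes. *)
  have [w20|w20] := eqVneq w2 0.
    exists (cst 0); split=> //; first by rewrite w20; exact: is_derive_cst.
    by move=> s; exact: Ham_row_mx0.
  have dw2 := dot_gt0 w20; have dfu := dot_gt0 fu.
  (* The direction [d s] starts orthogonal to [f u], so [sphere_point] starts at 0. Its velocity
     there is [2 * (dot (w1 *m 'J f u) w2 + k * dot (f u) (f u)) / dot w2 w2] times [w2]; [k] is
     chosen to make this factor 1. *)
  pose k := (dot w2 w2 / 2 - dot (w1 *m 'J f u) w2) / dot (f u) (f u).
  pose d s := w2 + s *: (k *: f u).
  have d0 : d 0 = w2 by rewrite /d scale0r addr0.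
  have Dd : is_derive (0 : R) (1 : R) d (k *: f u) by exact: is_derive_affine.
  have dfd0 : dot (f (x 0)) (d 0) = 0 by rewrite x0 d0.
  exists (fun s => sphere_point (f (x s)) (d s)); split.
  - by rewrite /sphere_point dfd0 mulr0 mul0r scale0r.
  - have D1 := is_derive_dot Dfx Dd; have D2 := is_derive_dot Dd Dd.
    have ddn : dot (d 0) (d 0) != 0 by rewrite d0 gt_eqF.
    apply/is_derive_coordP => i; have /is_derive_coordP/(_ i) D3 := Dd.
    have -> : (fun s => sphere_point (f (x s)) (d s) 0 i) =
      (fun s => 2 * dot (f (x s)) (d s) * (dot (d s) (d s))^-1 * d s 0 i).
      by apply/funext => s; rewrite mxE.
    have D4 := is_deriveV ddn D2.
    apply: is_derive_eq; rewrite /GRing.scale /= dfd0 x0 d0.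
    have -> : dot (f u) (k *: f u) = k * dot (f u) (f u).
      by rewrite !dotE !mulr_sumr; apply: eq_bigr => j _; rewrite !mxE; ring.
    rewrite /k; field.
    by rewrite !gt_eqF.
  - by move=> s; exact: Ham_sphere_point.
have Dgam : is_derive (0 : R) (1 : R) (fun s => row_mx (x s) (v s)) w.
  apply/is_derive_coordP => i; rewrite -[w]hsubmxK; case: (split_ordP i) => j ->.
    have /is_derive_coordP/(_ j) D := Dx; rewrite row_mxEl.
    by under eq_fun do rewrite row_mxEl.
  have /is_derive_coordP/(_ j) D := Dv; rewrite row_mxEr.
  by under eq_fun do rewrite row_mxEr.
exists (fun s => row_mx (x s) (v s)); split; [by congr row_mx;
  [exact: x0|exact: v0]| |exact: Dgam].
have c : row_mx (x s) (v s) @[s --> (0 : R)] --> row_mx u (0 : 'rV[R]_n).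
  have <- : row_mx (x 0) (v 0) = row_mx u 0 by congr row_mx; [exact: x0|exact: v0].
  apply: (@differentiable_continuous _ _ _ _ (fun s => row_mx (x s) (v s))).
  by apply/derivable1_diffP; have [] := Dgam.
move=> U; rewrite /within /= => HU.
have : \forall s \near (0 : R),
  (H @^-1` [set 0]) (row_mx (x s) (v s)) -> U (row_mx (x s) (v s)).
  exact: (c _ HU).
by apply: filterS => s; apply; exact: Hv.
Qed.

End ZeroLevel.

(** * Spectra and manifold dimensions at hyperbolic equilibria *)

Section HyperbolicEquilibria.
Variable R : realType.

Lemma jacobian_opp N (F : 'rV[R]_N -> 'rV[R]_N) x : differentiable F x ->
  'J (fun y => - F y) x = - 'J F x.
Proof.
move=> dF; have dNF : differentiable (fun y => - F y) x by exact: differentiableN.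
apply/row_matrixP => i; rewrite !rowE -(deriveEjacobian _ dNF) mulmxN -(deriveEjacobian
  _ dF).
by have [_ ->] := is_deriveN (is_derive_diff (delta_mx 0 i) dF).
Qed.

Lemma C1_opp N (F : 'rV[R]_N -> 'rV[R]_N) : C1 F -> C1 (fun x => - F x).
Proof.
move=> [dF cF]; split=> [x|w]; first exact: differentiableN.
have -> : 'D_w (fun x => - F x) = fun x => - 'D_w F x.
  by apply/funext => x; have [_ ->] := is_deriveN (is_derive_diff w (dF x)).
by move=> x; apply: (@cvgN _ _ _ (nbhs x) (nbhs_filter x)); exact: cF.
Qed.

Lemma hyperbolic_diagonal_neq0 N (F : 'rV[R]_N -> 'rV[R]_N) e Q d :
  hyperbolic_equilibrium F e -> Q \in unitmx -> 'J F e *m Q = Q *m diag_mx d ->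
  forall i, d 0 i != 0.
Proof.
move=> [_ hyp] Qu JQ i; apply: (hyp (d 0 i)%:C%C).
by apply/(eigenvalue_diagonalizedP Qu JQ); exists i.
Qed.

Lemma dim_Ws_diagonal N (F : 'rV[R]_N -> 'rV[R]_N) e Q d :
  C1 F -> Q \in unitmx -> 'J F e *m Q = Q *m diag_mx d -> (forall i, d 0 i != 0) ->
  dim_Ws F e #|[pred i | d 0 i < 0]|.
Proof.
move=> F1 Qu JQ d0 p [phi phis <-].
by have [-> ] := stable_manifold F1 Qu JQ d0 phis.
Qed.

Lemma dim_Wu_diagonal N (F : 'rV[R]_N -> 'rV[R]_N) e Q d :
  C1 F -> Q \in unitmx -> 'J F e *m Q = Q *m diag_mx d -> (forall i, d 0 i != 0) ->
  dim_Wu F e #|[pred i | 0 < d 0 i]|.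
Proof.
move=> F1 Qu JQ d0.
have -> : #|[pred i | 0 < d 0 i]| = #|[pred i | (- d) 0 i < 0]|.
  by apply: eq_card => i; rewrite !inE mxE oppr_lt0.
apply: (dim_Ws_diagonal (C1_opp F1) Qu) => [|i]; last by rewrite mxE oppr_eq0.
rewrite jacobian_opp; last by have [dF _] := F1; exact: dF.
by rewrite mulNmx JQ -mulmxN; congr (_ *m _); apply/matrixP => i j; rewrite !mxE mulNrn.
Qed.

Lemma card_neg_pos N (d : 'rV[R]_N) : (forall i, d 0 i != 0) ->
  (#|[pred i | (d 0 i < 0)%R]| + #|[pred i | (0 < d 0 i)%R]|)%N = N.
Proof.
move=> d0; rewrite -[RHS]card_ord -(cardC [pred i : 'I_N | d 0 i < 0]); congr (_ + _)%N.
by apply: eq_card => i; rewrite !inE -leNgt lt_neqAle eq_sym d0.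
Qed.

Lemma card_split_row n (P : pred R) (x y : 'rV[R]_n) :
  #|[pred i | P (row_mx x y 0 i)]| =
  (#|[pred i | P (x 0%R i)]| + #|[pred i | P (y 0%R i)]|)%N.
Proof.
rewrite -!sum1_card big_mkcond big_split_ord /=; congr (_ + _)%N.
  by rewrite [RHS]big_mkcond; apply: eq_bigr => i _; rewrite !inE row_mxEl.
by rewrite [RHS]big_mkcond; apply: eq_bigr => i _; rewrite !inE row_mxEr.
Qed.

Section UVEquilibrium.
Variables (n : nat) (f : 'rV[R]_n -> 'rV[R]_n) (e : 'rV[R]_n).
Variables (Q : 'M[R]_n) (d : 'rV[R]_n).
Hypotheses (f_smooth : smooth f) (f_sym : 'J f e = ('J f e)^T) (fe : f e = 0).
Hypotheses (Qu : Q \in unitmx) (JQ : 'J f e *m Q = Q *m diag_mx d).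
Hypothesis d0 : forall i, d 0 i != 0.
Local Notation X := (uv_system f).
Local Notation z := (row_mx e 0 : 'rV[R]_(n + n)).

Definition uv_eigenvalues : 'rV[R]_(n + n) := row_mx (- d) d.

(* The eigenvector [x] of [f_x] for [l] yields [(x, 0)] for [- l] and [(x, 2 l x)]
   for [l]; [Q] acts on columns, hence the transposed pattern. *)
Definition uv_eigenbasis : 'M[R]_(n + n) :=
  block_mx (Q *m diag_mx (2 *: d)) 0 (- Q) Q.

Lemma uv_eigenbasis_unit : uv_eigenbasis \in unitmx.
Proof.
rewrite unitmxE det_lblock det_mulmx det_diag !unitrM -unitmxE Qu andbT /=.
rewrite unitfE prodf_seq_neq0; apply/allP => i _ /=.
by rewrite mxE mulf_neq0// pnatr_eq0.
Qed.

Lemma uv_diagonalization :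
  'J X z *m uv_eigenbasis = uv_eigenbasis *m diag_mx uv_eigenvalues.
Proof.
rewrite uv_jacobian0// -f_sym /uv_eigenbasis /uv_eigenvalues diag_mx_row !mulmx_block.
rewrite !mulmx0 !mul0mx !mul1mx !addr0 !add0r !mulNmx !mulmxN !mulmxA JQ.
have comm : diag_mx d *m diag_mx (2 *: d) = diag_mx (2 *: d) *m diag_mx d.
  by rewrite diag_mxC.
have dN : diag_mx (- d) = - diag_mx d by rewrite raddfN.
congr block_mx.
- by rewrite -!mulmxA comm dN !mulmxN.
- rewrite dN mulmxN opprK -[diag_mx (2 *: d)]/(diag_mx _) linearZ /= -scalemxAr.
  by rewrite scaler_nat mulr2n addrK.
Qed.

Lemma uv_eigenvalues_neq0 i : uv_eigenvalues 0 i != 0.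
Proof.
rewrite /uv_eigenvalues; case: (split_ordP i) => j ->.
  by rewrite row_mxEl mxE oppr_eq0.
by rewrite row_mxEr.
Qed.

Lemma card_uv_neg : #|[pred i | uv_eigenvalues 0 i < 0]| = n.
Proof.
rewrite (card_split_row (fun x => x < 0)) -[RHS](card_neg_pos d0) addnC; congr (_ + _)%N.
by apply: eq_card => i; rewrite !inE mxE oppr_lt0.
Qed.

Lemma card_uv_pos : #|[pred i | 0 < uv_eigenvalues 0 i]| = n.
Proof.
rewrite (card_split_row (fun x => 0 < x)) -[RHS](card_neg_pos d0); congr (_ + _)%N.
by apply: eq_card => i; rewrite !inE mxE oppr_gt0.
Qed.

Lemma uv_saddle : (0 < n)%N -> hyperbolic_saddle X z.
Proof.
move=> n0; have eig := eigenvalue_diagonalizedP uv_eigenbasis_unit uv_diagonalization.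
split; first split.
- by rewrite /uv_system row_mxKl row_mxKr fe oppr0 addr0 mul0mx row_mx0.
- by move=> _ /eig[i ->]; exact: uv_eigenvalues_neq0.
- case: (pickP [pred i | uv_eigenvalues 0 i < 0]) => [i /= ei|noi].
    by exists (uv_eigenvalues 0 i)%:C%C => //; apply/eig; exists i.
  by move: (n0); rewrite -[X in (_ < X)%N]card_uv_neg (eq_card0 noi).
- case: (pickP [pred i | 0 < uv_eigenvalues 0 i]) => [i /= ei|noi].
    by exists (uv_eigenvalues 0 i)%:C%C => //; apply/eig; exists i.
  by move: (n0); rewrite -[X in (_ < X)%N]card_uv_pos (eq_card0 noi).
Qed.

Lemma uv_spectral_dims : stable_spectral_dim X z n /\ unstable_spectral_dim X z n.
Proof.
split; [rewrite -[X in stable_spectral_dim _ _ X]card_uv_neg|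
  rewrite -[X in unstable_spectral_dim _ _ X]card_uv_pos];
  exact: (spectral_dim_diagonalized uv_eigenbasis_unit uv_diagonalization).
Qed.

Lemma uv_manifold_dims : dim_Ws X z n /\ dim_Wu X z n.
Proof.
have X1 := uv_C1 f_smooth.
split.
  rewrite -[X in dim_Ws _ _ X]card_uv_neg.
  exact: (dim_Ws_diagonal X1 uv_eigenbasis_unit uv_diagonalization uv_eigenvalues_neq0).
rewrite -[X in dim_Wu _ _ X]card_uv_pos.
exact: (dim_Wu_diagonal X1 uv_eigenbasis_unit uv_diagonalization uv_eigenvalues_neq0).
Qed.

End UVEquilibrium.
End HyperbolicEquilibria.

(** * Transversality along the connecting orbit *)

Section GlobalSolutions.
Variables (R : realType) (N : nat).
Implicit Types (F : 'rV[R]_N -> 'rV[R]_N) (phi : R -> 'rV[R]_N).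

Lemma solution_setTP F phi : solution F setT phi <->
  continuous phi /\ forall t : R, is_derive t (1 : R) phi (F (phi t)).
Proof.
rewrite /solution interiorT; split=> -[c D]; split.
- exact: (continuous_subspace_setT phi).2 c.
- by move=> t; exact: D.
- exact: (continuous_subspace_setT phi).1 c.
- by move=> t _; exact: D.
Qed.

Lemma solution_setT_ray F phi : solution F setT phi -> solution F `[0, +oo[ phi.
Proof.
move=> /solution_setTP[c D]; split; first exact: continuous_subspaceT.
by move=> t _; exact: D.
Qed.

Lemma solution_affine F phi (c k : R) : solution F setT phi ->
  solution (fun x => k *: F x) setT (fun s => phi (c + k * s)).
Proof.
move=> /solution_setTP[cphi D]; apply/solution_setTP.
have Dl s : is_derive s (1 : R) (fun s => c + k * s) k.
  by apply: is_derive_eq; rewrite /GRing.scale /=; ring.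
have Dphi s : is_derive s (1 : R) (fun s => phi (c + k * s)) (k *: F (phi (c + k * s))).
  have [Dp pE] := D (c + k * s).
  have dphi : differentiable phi (c + k * s) by apply/derivable1_diffP.
  have <- : 'd phi (c + k * s) k = k *: F (phi (c + k * s)).
    by rewrite (deriv1E Dp) derive1E pE.
  exact: (is_derive_chain (Dl s) dphi).
split; last exact: Dphi.
move=> t; apply: differentiable_continuous; apply/derivable1_diffP.
by have [] := Dphi t.
Qed.

Lemma equilibrium_solution F p : F p = 0 -> solution F setT (cst p).
Proof.
move=> Fp; apply/solution_setTP; split; first by move=> t; exact: cvg_cst.
by move=> t; rewrite /= Fp; exact: is_derive_cst.
Qed.

Lemma equilibrium_stable_limit F e p : C1 F -> F p = 0 -> Ws F e p -> p = e.
Proof.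
move=> F1 Fp [phi [phis phi_e] phi0].
have E t : 0 <= t -> phi t = p.
  move=> t0; rewrite (@forward_unique _ _ F phi (cst p))//.
  exact/solution_setT_ray/equilibrium_solution.
apply: (@cvg_unique _ _ ((phi t) @[t --> +oo])) => //.
apply: cvg_near_cst; near=> t; apply: E.
by near: t; apply: nbhs_pinfty_ge; exact: num_real.
Unshelve. all: by end_near. Qed.

(** Uniqueness is available forward in time only; times before [t0] are reached by the reversed
    solution of the opposite field. *)
Lemma equilibrium_unique F phi t0 : C1 F -> solution F setT phi ->
  F (phi t0) = 0 -> forall t, phi t = phi t0.
Proof.
move=> F1 phis Fp t; have [tt|tt] := leP t0 t.
  have s1 := solution_affine t0 1 phis.
  have F1' : C1 (fun x => 1 *: F x).
    by have -> : (fun x => 1 *: F x) = F by apply/funext => x; rewrite scale1r.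
  have := @forward_unique _ _ _ _ (cst (phi t0)) F1' (solution_setT_ray s1) _ _ (t - t0).
  rewrite mulr0 addr0 mul1r [t0 + (t - t0)]addrC subrK; apply=> //;
    last by rewrite subr_ge0.
  by apply/solution_setT_ray/equilibrium_solution; rewrite Fp scaler0.
have s1 := solution_affine t0 (-1) phis.
have F1' : C1 (fun x => -1 *: F x).
  have -> : (fun x => -1 *: F x) = (fun x => - F x) by apply/funext => x;
    rewrite scaleN1r.
  exact: C1_opp.
have := @forward_unique _ _ _ _ (cst (phi t0)) F1' (solution_setT_ray s1) _ _ (t0 - t).
rewrite mulr0 addr0 mulN1r opprB [t0 + (t - t0)]addrC subrK; apply=> //;
  last by rewrite subr_ge0 ltW.
by apply/solution_setT_ray/equilibrium_solution; rewrite Fp scaler0.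
Qed.

Lemma Ws_level F e p (H : 'rV[R]_N -> R) : continuous H -> conserved F H ->
  Ws F e p -> H p = H e.
Proof.
move=> cH consH [phi [phis phi_e] <-].
have E t : 0 <= t -> H (phi t) = H (phi 0).
  by move=> t0; apply: (consH _ _ phis); rewrite in_itv /= ?lexx ?t0.
apply: (@cvg_unique _ _ (H (phi t) @[t --> +oo])) => //.
  apply: cvg_near_cst; near=> t; apply: E.
  by near: t; apply: nbhs_pinfty_ge; exact: num_real.
exact: (continuous_cvg _ (cH e) phi_e).
Unshelve. all: by end_near. Qed.

End GlobalSolutions.

(** * The two invariant manifolds along the connecting orbit *)

Section Connection.
Variables (R : realType) (n : nat) (f : 'rV[R]_n -> 'rV[R]_n) (a b p : 'rV[R]_n).
Hypotheses (f_smooth : smooth f) (f_sym : forall x, 'J f x = ('J f x)^T).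
Hypotheses (a_hyp : hyperbolic_equilibrium f a).
Hypotheses (dim_a : dim_Ws f a n) (dim_b : dim_Wu f b 1).
Hypotheses (pb : Wu f b p) (pa : Ws f a p).
Local Notation X := (uv_system f).
Local Notation emb := (row_mx 1%:M 0 : 'M[R]_(n, n + n)).

Let f1 : C1 f. Proof. exact: smooth_C1. Qed.

(** A saddle must have eigenvalues of both signs, hence [n > 0]; a line contained in R^n provides
    this. *)
Lemma connection_dim_gt0 : (0 < n)%N.
Proof.
have [U _ dU] := dim_b pb.
have := dimvS (subvf U); rewrite dU dimvf /dim /= mul1n; exact.
Qed.

(* Otherwise the connecting orbit is constant, so that a = b is at the same time
   a sink and of Morse index 1. *)
Lemma connection_velocity_neq0 : f p != 0.
Proof.
apply/eqP => fp0.
have ea : p = a by apply: equilibrium_stable_limit pa.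
have eb : p = b.
  by apply: equilibrium_stable_limit pb; [exact: C1_opp|rewrite fp0 oppr0].
have [Q Qu [d JQ]] := symmetric_diagonalizable (f_sym a).
have d0 := hyperbolic_diagonal_neq0 a_hyp Qu JQ.
have h1 := subspace_dim_unique (dim_Ws_diagonal f1 Qu JQ d0 pa) (dim_a pa).
have ba : b = a by rewrite -ea.
have dim_b' : dim_Wu f a 1 by rewrite -ba.
have pb' : Wu f a p by rewrite -ba.
have h2 := subspace_dim_unique (dim_Wu_diagonal f1 Qu JQ d0 pb') (dim_b' _ pb').
by have := card_neg_pos d0; rewrite h1 h2 addn1 => /eqP; rewrite eqn_leq ltnn.
Qed.

Lemma uv_emb u : X (u *m emb) = - f u *m emb.
Proof.
by rewrite !mul_mx_row !mulmx1 !mulmx0 /uv_system row_mxKl row_mxKr addr0 mul0mx.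
Qed.

Lemma embE (u : 'rV[R]_n) : u *m emb = row_mx u 0.
Proof. by rewrite mul_mx_row mulmx1 mulmx0. Qed.

Lemma connection_Wu : Wu X (row_mx a 0) (row_mx p 0).
Proof.
have [phi phis phi0] := pa; exists (fun t => phi t *m emb); last by rewrite phi0 embE.
rewrite -embE; apply: stable_orbit_lift phis => u.
by rewrite uv_emb mulNmx opprK.
Qed.

Lemma connection_Ws : Ws X (row_mx b 0) (row_mx p 0).
Proof.
have [phi phis phi0] := pb; exists (fun t => phi t *m emb); last by rewrite phi0 embE.
by rewrite -embE; apply: stable_orbit_lift phis => u; exact: uv_emb.
Qed.

Lemma connection_TWu w : TWu X (row_mx a 0) (row_mx p 0) (row_mx w 0).
Proof.
have Tw : TWs f a p w by rewrite (full_subspace (dim_a pa)).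
rewrite -!embE; apply: (TWs_lift _ pa Tw) => u.
by rewrite uv_emb mulNmx opprK.
Qed.

Hypothesis b_hyp : hyperbolic_equilibrium f b.

(* If the second component of a bounded variational solution vanishes at 0, then it
   vanishes identically, and the first one solves the variational equation of
   [x' = - f x]. *)
Lemma connection_TWs w : TWs X (row_mx b 0) (row_mx p 0) (row_mx w 0) -> TWu f b p w.
Proof.
have [Q Qu [d JQ]] := symmetric_diagonalizable (f_sym b).
have d0 := hyperbolic_diagonal_neq0 b_hyp Qu JQ.
have [phi phis phi0] := pb.
have phis' : stable_orbit X (row_mx b 0) (fun t => phi t *m emb).
  by rewrite -embE; apply: stable_orbit_lift phis => u; exact: uv_emb.
have Nf1 := C1_opp f1.
have df x : differentiable f x by have [+ _] := f1; apply.
have JNQ : 'J (fun x => - f x) b *m Q = Q *m diag_mx (- d).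
  rewrite jacobian_opp// mulNmx JQ -mulmxN; congr (_ *m _).
  by apply/matrixP => i j; rewrite !mxE mulNrn.
have Nd0 i : (- d) 0 i != 0 by rewrite mxE oppr_eq0.
have [TE _] := stable_manifold Nf1 Qu JNQ Nd0 phis.
have [TE' _] := stable_manifold (uv_C1 f_smooth) (uv_eigenbasis_unit Qu d0)
  (uv_diagonalization f_smooth (f_sym b) JQ) (uv_eigenvalues_neq0 d0) phis'.
have -> : TWu f b p = variational_space (fun x => - f x) phi by rewrite -phi0; exact: TE.
move: TE'; rewrite embE phi0 => ->.
move=> [W [cW DW [M WM]] W0].
have JE t : 'J X (phi t *m emb) = block_mx (- 'J f (phi t)) 0 1%:M ('J f (phi t))^T.
  by rewrite embE uv_jacobian0.
pose W1 t := W t *m (col_mx 1%:M 0 : 'M[R]_(n + n, n)).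
pose W2 t := W t *m (col_mx 0 1%:M : 'M[R]_(n + n, n)).
have W12 t : W t = row_mx (W1 t) (W2 t).
  by rewrite -[LHS]hsubmxK /W1 /W2 -[W t]hsubmxK !mul_row_col !mulmx0 !mulmx1 addr0
    add0r row_mxKl row_mxKr.
have WE t : W t *m 'J X (phi t *m emb) =
    row_mx (- W1 t *m 'J f (phi t) + W2 t) (W2 t *m 'J f (phi t)).
  rewrite JE W12 mul_row_block mulmx0 add0r mulmx1 -f_sym.
  by rewrite mulmxN mulNmx.
have c1 : continuous W1.
  by move=> t; apply: (@continuous_comp _ _ _ W (mulmx^~ _));
    [exact: cW|exact: continuous_mulmxr].
have c2 : continuous W2.
  by move=> t; apply: (@continuous_comp _ _ _ W (mulmx^~ _));
    [exact: cW|exact: continuous_mulmxr].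
have D1 (t : R) : 0 < t -> is_derive t (1 : R) W1 (- W1 t *m 'J f (phi t) + W2 t).
  move=> t0; have := is_derive_mulmxr (col_mx 1%:M 0 : 'M[R]_(n + n, n)) (DW t t0).
  by rewrite WE mul_row_col mulmx1 mulmx0 addr0.
have D2 (t : R) : 0 < t -> is_derive t (1 : R) W2 (W2 t *m 'J f (phi t)).
  move=> t0; have := is_derive_mulmxr (col_mx 0 1%:M : 'M[R]_(n + n, n)) (DW t t0).
  by rewrite WE mul_row_col mulmx1 mulmx0 add0r.
have [W10 W20] : W1 0 = w /\ W2 0 = 0.
  by rewrite /W1 /W2 W0 !mul_row_col !mulmx0 mul0mx mulmx1 !addr0.
have [phi_sol phi_b] := phis.
have [cphi _] := (solution_posP _ _).1 phi_sol.
have [rho rhoP] := continuous_cvg_bounded cphi ((cvg_posP _ _).1 phi_b).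
have {rhoP} rhoP t : 0 <= t -> `|phi t| <= rho.
  by move=> t0; have := rhoP t t0; rewrite /= pos_id.
have [c c0 cP] := jacobian_bound f1 rho.
(* [W2] solves a homogeneous linear equation whose coefficient is bounded along [phi], so Gronwall
   propagates its zero initial value. *)
have {}W20 t : 0 <= t -> W2 t = 0.
  move=> t0; have [C C0 CP] := gronwall_bound n t (ltW c0).
  have := CP W2 (fun t => W2 t *m 'J f (phi t)) t0 c2.
  rewrite W20 normr0 mulr0 => H; apply/eqP; rewrite -normr_le0; apply: H.
    by move=> s /andP[s0 _]; exact: D2.
  by move=> s /andP[s0 _]; apply: cP; apply: rhoP; exact: ltW.
exists W1; last exact: W10.
split; first exact: c1.
  move=> t t0; have := D1 t t0; rewrite (W20 t (ltW t0)) addr0.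
  by rewrite jacobian_opp// mulNmx mulmxN.
have [c' c'0 c'P] := norm_mulmxr (col_mx 1%:M 0 : 'M[R]_(n + n, n)).
exists (c' * M) => t t0; apply: le_trans (c'P _) _.
by rewrite ler_wpM2l ?(ltW c'0) ?WM.
Qed.

(** The tangent space of the level set enters only through its dimension and the two inclusions: a
    subspace of [T] of dimension at least [2 * n - 1] is all of [T]. *)
Lemma connection_transversal (T : set 'rV[R]_(n + n)) :
  subspace_of_dim T (2 * n).-1 ->
  subspace_of_dim (TWu X (row_mx a 0) (row_mx p 0)) n ->
  subspace_of_dim (TWs X (row_mx b 0) (row_mx p 0)) n ->
  TWu X (row_mx a 0) (row_mx p 0) `<=` T ->
  TWs X (row_mx b 0) (row_mx p 0) `<=` T ->
  sum_set (TWu X (row_mx a 0) (row_mx p 0)) (TWs X (row_mx b 0) (row_mx p 0)) = T.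
Proof.
move=> [VT TE dT] [U1 U1E d1] [U2 U2E d2] s1 s2.
have [Ub UbE db] := dim_b pb.
pose L : 'Hom('rV[R]_n, 'rV[R]_(n + n)) := linfun (mulmxr emb).
have LE w : L w = row_mx w 0 by rewrite lfunE /= embE.
have L1 : (limg L <= U1)%VS.
  apply/subvP => _ /memv_imgP[w _ ->]; rewrite LE.
  by change ([set v | v \in U1] (row_mx w 0)); rewrite -U1E; exact: connection_TWu.
have kL : lker L = 0%VS.
  apply/eqP; rewrite -subv0; apply/subvP => w; rewrite memv_ker LE memv0.
  by rewrite -row_mx0 => /eqP/eq_row_mx[-> _].
have dL (U : {vspace 'rV[R]_n}) : \dim (L @: U) = \dim U.
  by rewrite -(limg_ker_dim L U) kL capv0 dimv0.
have {}L1 : limg L = U1.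
  by apply/eqP; rewrite eqEdim L1 d1 dL dimvf /dim /= mul1n leqnn.
have cap : (\dim (U1 :&: U2) <= 1)%N.
  suff /dimvS : (U1 :&: U2 <= L @: Ub)%VS by rewrite dL db.
  apply/subvP => v.
  rewrite memv_cap -L1 => /andP[/memv_imgP[w _ ->]]; rewrite LE => wU2.
  rewrite -LE memv_img//.
  have : TWs X (row_mx b 0) (row_mx p 0) (row_mx w 0) by rewrite U2E.
  by move=> /connection_TWs; rewrite UbE.
have sum_T : (U1 + U2)%VS = VT.
  apply/eqP; rewrite eqEdim; apply/andP; split.
    rewrite subv_add; apply/andP; split; apply/subvP => v vU.
      by change ([set v | v \in VT] v); rewrite -TE; apply: s1; rewrite U1E.
    by change ([set v | v \in VT] v); rewrite -TE; apply: s2; rewrite U2E.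
  have arith (s c m : nat) : (s + c)%N = m -> (c <= 1)%N -> (m.-1 <= s)%N.
    by move=> <- c1; rewrite -subn1 leq_subLR [(1 + s)%N]addnC leq_add2l.
  have := dimv_sum_cap U1 U2; rewrite d1 d2 dT mul2n -addnn => E.
  exact: arith E cap.
rewrite TE U1E U2E -sum_T; apply/seteqP; split=> v /=.
  by move=> [v1 v1U [v2 v2U <-]]; exact: memv_add.
by move=> /memv_addP[v1 v1U [v2 v2U ->]]; exists v1 => //; exists v2.
Qed.

End Connection.

Theorem lemma2 (R : realType) (n : nat) (f : 'rV[R]_n -> 'rV[R]_n)
    (a b : 'rV[R]_n) (h : R -> 'rV[R]_n)
    (f_smooth : smooth f)
    (f_sym : forall x : 'rV[R]_n, 'J f x = ('J f x)^T)
    (a_hyp : hyperbolic_equilibrium f a)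
    (b_hyp : hyperbolic_equilibrium f b)
    (dim_a : dim_Ws f a n)
    (dim_b : dim_Wu f b 1)
    (h_sol : solution f setT h)
    (h_conn : (Wu f b `&` Ws f a) (h 0))
    (h_trans : sum_set (TWu f b (h 0)) (TWs f a (h 0)) = setT) :
  let X := uv_system f in
  let H := Ham f in
  let H0 := H @^-1` [set 0] in
  let z1 := row_mx a 0 in
  let z2 := row_mx b 0 in
  let z := fun t : R => row_mx (h (- t)) 0 in
  (hamiltonian_field X H /\ conserved X H) /\
  [/\ hyperbolic_saddle X z1, hyperbolic_saddle X z2,
      [/\ stable_spectral_dim X z1 n, unstable_spectral_dim X z1 n,
          stable_spectral_dim X z2 n & unstable_spectral_dim X z2 n] &
      [/\ dim_Ws X z1 n, dim_Wu X z1 n, dim_Ws X z2 n & dim_Wu X z2 n]] /\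
  (solution X setT z /\ (Wu X z1 `&` Ws X z2) (z 0)) /\
  [/\ Wu X z1 `<=` H0, Ws X z2 `<=` H0,
      forall t, subspace_of_dim (Tset H0 (z t)) (2 * n).-1,
      forall t, exists w : 'rV[R]_(n + n), 'd H (z t) w != 0 &
      sum_set (TWu X z1 (z 0)) (TWs X z2 (z 0)) = Tset H0 (z 0)].
Proof.
move=> X H H0 z1 z2 z; have [hb ha] := h_conn.
have n0 := connection_dim_gt0 dim_b hb.
have f1 := smooth_C1 f_smooth.
have [Qa Qau [da JQa]] := symmetric_diagonalizable (f_sym a).
have [Qb Qbu [db JQb]] := symmetric_diagonalizable (f_sym b).
have da0 := hyperbolic_diagonal_neq0 a_hyp Qau JQa.
have db0 := hyperbolic_diagonal_neq0 b_hyp Qbu JQb.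
have [fa0 _] := a_hyp; have [fb0 _] := b_hyp.
have [sa ua] := uv_spectral_dims f_smooth (f_sym a) Qau JQa da0.
have [sb ub] := uv_spectral_dims f_smooth (f_sym b) Qbu JQb db0.
have [Wsa Wua] := uv_manifold_dims f_smooth (f_sym a) Qau JQa da0.
have [Wsb Wub] := uv_manifold_dims f_smooth (f_sym b) Qbu JQb db0.
have fh0 : f (h 0) != 0 by apply: (connection_velocity_neq0 f_smooth f_sym a_hyp dim_a
  dim_b).
(* An orbit meeting an equilibrium is constant, so the velocity at time 0 decides for all times. *)
have fh t : f (h t) != 0.
  apply: contra fh0 => /eqP fht.
  by rewrite (equilibrium_unique f1 h_sol fht 0) fht.
have dH := Ham_differentiable f_smooth.
have cH : continuous H by move=> y; exact: differentiable_continuous.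
have Hconst : conserved X H.
  by apply: conserved_first_integral => // y; rewrite dHamE// omega_self.
(* The unstable manifold is the stable one of [- X], so its place in the zero level comes from
   conservation along the reversed field. *)
have HconstN : conserved (fun y => - X y) H.
  by apply: conserved_first_integral => // y; rewrite linearN dHamE// omega_self oppr0.
have zE t : z t = row_mx (h (- t)) 0 by [].
have z0E : z 0 = row_mx (h 0) 0 by rewrite zE oppr0.
have Wu0 : Wu X z1 `<=` H0.
  by move=> q /(Ws_level cH HconstN) qE; exact: etrans qE (Ham_row_mx0 f a).
have Ws0 : Ws X z2 `<=` H0.
  by move=> q /(Ws_level cH Hconst) qE; exact: etrans qE (Ham_row_mx0 f b).
have TH t : subspace_of_dim (Tset H0 (z t)) (2 * n).-1.
  by rewrite zE Tset_Ham//; exact: dot_kernel_dim.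
have zWu : Wu X z1 (row_mx (h 0) 0) by exact: connection_Wu.
have zWs : Ws X z2 (row_mx (h 0) 0) by exact: connection_Ws.
have z1_saddle := uv_saddle f_smooth (f_sym a) fa0 Qau JQa da0 n0.
have z2_saddle := uv_saddle f_smooth (f_sym b) fb0 Qbu JQb db0 n0.
have z_sol : solution X setT z.
  have /solution_setTP[ch Dh] := solution_affine 0 (-1) h_sol.
  have hz : (fun s => h (0 + -1 * s) *m (row_mx 1%:M 0 : 'M[R]_(n, n + n))) = z.
    by apply/funext => s; rewrite embE mulN1r add0r.
  have Dz (t : R) : is_derive t (1 : R) z (X (z t)).
    have := is_derive_mulmxr (row_mx 1%:M 0 : 'M[R]_(n, n + n)) (Dh t).
    by rewrite hz scaleN1r mulN1r add0r -uv_emb embE.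
  apply/solution_setTP; split; last exact: Dz.
  move=> t; apply: differentiable_continuous; apply/derivable1_diffP.
  by have [] := Dz t.
(* In the direction [(0, f u)] the differential at [(u, 0)] is [- dot (f u) (f u)]. Hence 0 is a
   regular value along the orbit, and the level set is a hypersurface there. *)
have dH_neq0 t : exists w : 'rV[R]_(n + n), 'd H (z t) w != 0.
  exists (row_mx 0 (f (h (- t)))).
  by rewrite zE dHam_row_mx0// row_mxKr oppr_eq0 gt_eqF// dot_gt0.
split; first by split; [exact: Ham_hamiltonian|exact: Hconst].
split.
  exact: (And4 z1_saddle z2_saddle (And4 sa ua sb ub) (And4 Wsa Wua Wsb Wub)).
split; first by rewrite z0E; exact: (conj z_sol (conj zWu zWs)).
split; [exact: Wu0|exact: Ws0|exact: TH|exact: dH_neq0|].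
rewrite z0E; apply: (connection_transversal f_smooth f_sym dim_a dim_b hb ha b_hyp).
- by rewrite -z0E.
- exact: Wua.
- exact: Wsb.
- exact: (TWs_sub_Tset Wu0).
- exact: (TWs_sub_Tset Ws0).
Qed.
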